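(* The following lower bounds hold: $$\mu_{D_4}(8)\ge 44,\qquad \mu_{D_4}(16)\ge 352,\qquad \mu_{D_4}(24)\ge 1440,$$ and, for every integer $k\ge 1$, $$\mu_{D_4}(8k)\ge 44\,k^3.$$
   Context: For $d\ge 1$, $\mu_{D_4}(d)$ denotes the maximal number of quotient singularities of type $D_4$ that an irreducible projective surface of degree $d$ in $\mathbf{P}^3(\mathbb{C})$ might have. A point of a surface is a quotient singularity of type $D_4$ if the surface is, locally analytically at that point, isomorphic to the germ at the origin of $\{x^2+y^2z+z^3=0\}\subset\mathbb{C}^3$. *)

(* Defs.v *)
From HB Require Import structures.
From mathcomp Require Import all_boot all_order all_algebra.
From mathcomp Require Import complex.
From mathcomp Require Import all_classical all_reals all_analysis.
(* The notations of mpoly and of the analysis library are incompatible. *)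
From mathcomp Require Import -(notations) mpoly.

Set Implicit Arguments.
Unset Strict Implicit.
Unset Printing Implicit Defensive.
Import Order.TTheory GRing.Theory Num.Theory numFieldNormedType.Exports.
Local Open Scope classical_set_scope.
Local Open Scope ring_scope.

Definition mpoly_irreducible (n : nat) (K : fieldType)
    (F : mpoly n K) : Prop :=
  [/\ F != 0, F \isn't a GRing.unit &
      forall A B : mpoly n K,
        F = A * B -> A \is a GRing.unit \/ B \is a GRing.unit].

(* [differentiable] is Frechet differentiability over the base field [K]; for
   [K] the complex numbers, this is holomorphy on [U] when [U] is open. *)
Definition holomorphic_on (K : numFieldType) (V W : normedModType K)
    (U : set V) (f : V -> W) : Prop :=
  forall z, U z -> differentiable f z.

(* Isomorphism of the germs of (reduced) analytic sets (X, x) and (Y, y):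
   morphisms are restrictions of holomorphic maps of the ambient spaces, and
   are only required to be mutually inverse on X and Y. *)
Definition germ_isomorphic (K : numFieldType) (V W : normedModType K)
    (X : set V) (x : V) (Y : set W) (y : W) : Prop :=
  X x /\ Y y /\
  exists (U : set V) (U' : set W) (f : V -> W) (g : W -> V),
    [/\ [/\ open U, U x, open U' & U' y],
        holomorphic_on U f /\ holomorphic_on U' g,
        f x = y,
        forall z, (X `&` U) z -> (Y `&` U') (f z) /\ g (f z) = z &
        forall w, (Y `&` U') w -> (X `&` U) (g w) /\ f (g w) = w].

Definition D4_model (K : numFieldType) : set 'rV[K]_3 :=
  [set w | let x := w 0 0 in let y := w 0 1 in let z := w 0 2%:R in
           x ^+ 2 + y ^+ 2 * z + z ^+ 3 = 0].
Arguments D4_model : clear implicits.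

(* Homogeneous coordinates of the point with affine coordinates [u] in the
   i-th standard chart of P^3: [u] with a 1 inserted at position [i]. *)
Definition affine_chart (K : numFieldType) (i : 'I_4) (u : 'rV[K]_3) :
    'rV[K]_4 :=
  \row_j (if unlift i j is Some k then u 0 k else 1).

Definition affine_part (K : numFieldType) (F : mpoly 4 K) (i : 'I_4) :
    set 'rV[K]_3 :=
  [set u | meval (affine_chart i u 0) F = 0].

(* Points of P^3 are lines of K^4; any [L] below is a line, since
   [affine_chart i u] is nonzero. *)
Definition D4_points (K : numFieldType) (F : mpoly 4 K) :
    set {vspace 'rV[K]_4} :=
  [set L | exists (i : 'I_4) (u : 'rV[K]_3),
      L = <[affine_chart i u]>%VS /\
      germ_isomorphic (affine_part F i) u (D4_model K) 0].

(* An irreducible surface of degree d in P^3 is given by an irreducible form of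
   degree d. *)
Definition irreducible_surface (K : numFieldType) (d : nat) :
    set (mpoly 4 K) :=
  [set F | F \is @ishomog1 4 K d mdeg /\ mpoly_irreducible F].
Arguments irreducible_surface : clear implicits.

(* [counting] is +oo on infinite sets. The supremum is taken over a set of
   natural numbers and possibly +oo, so a finite supremum is a maximum. *)
Definition mu_D4 (R : realType) (d : nat) : \bar R :=
  ereal_sup [set counting (D4_points F) | F in irreducible_surface R[i] d].

(* Main.v *)
Require Import Defs.
From Stdlib Require Import ZArith.
From HB Require Import structures.
From mathcomp Require Import all_boot all_order all_algebra all_field.
From mathcomp Require Import complex.
From mathcomp Require Import all_classical all_reals all_analysis.
From mathcomp Require Import ring lra ssrZ zify.
From mathcomp Require Import -(notations) mpoly.
Set Implicit Arguments.
Unset Strict Implicit.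
Unset Printing Implicit Defensive.
Import Order.TTheory GRing.Theory Num.Theory numFieldNormedType.Exports.
Local Open Scope classical_set_scope.
Local Open Scope ring_scope.

Local Delimit Scope Z_scope with BZ.

(** The surfaces are F_k = Q(x_0^k, x_1^k, x_2^k, x_3^k), for the octic form Q such that
    F_3 is a multiple of S_24 - (5567/28350) S_12^2, where S_d is the sum of the d-th
    powers of the equations of the 40 mirrors of the complex reflection group G_32,
    scaled to have length sqrt 3.
    The coefficient makes the orbit of (0 : 0 : 1 : i) under G_32 consist of 1440
    points of type D4 of F_3. These lie over 80 points of P^3 with coordinates in
    Z[i, w], 44 of them off the coordinate planes; there (x_j) |-> (x_j^k) is
    unramified, and each of the 44 points is a D4 point of Q, hence has k^3 D4
    points of F_k above it.

    That a point is of type D4 only depends on a jet: if h is s^2 plus a nondegenerate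
    binary cubic in (t, r), up to terms of higher weight for the weights 3, 2, 2 of
    s, t, r, then h = A s^2 + s (B1 t^2 + B2 t r + B3 r^2) + C1 t^3 + .. + C4 r^3 with
    differentiable coefficients; completing the square and bringing the variable cubic
    to a sum of two cubes by the inverse function theorem yields the model. The jets
    are computed exactly over Z[i, w].

    Restricting F_k to the points (y, x, 1, 1) gives H(x^k, y^(2k)), with H quartic
    in its second variable. The constant terms of H in each variable are separable,
    which forces the factors of a factorization of F_k to be polynomials in x^k and
    y^(2k) too; so H would factor compatibly with the weights 1, 2 of its variables,
    and comparing coefficients rules this out. *)

(** * Strict differentiability and the inverse function theorem *)

(** The isomorphism of germs must be differentiable on open sets in both directions, and no power
    series are used. Strict differentiability at all points near the base point is stable under
    products, composition and local inversion, and it turns the inverse function theorem into a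
    contraction argument that makes no use of a continuous derivative. Roots of functions are
    obtained by inverting polynomial maps locally, so the continuity of a branch never has to be
    shown. The weights 3, 2, 2 make s^2 + t^3 + r^3 homogeneous of weight 6. Truncating there leaves
    a finite computation, and every heavier term is absorbed by the variable coefficients A, B1,
    ..., C4. Restricting a form may lower the degree of its factors. What is carried over to the
    restriction is therefore an upper bound on each factor, namely the degree of the unrestricted
    factor; these bounds add up to exactly 8 k, and this leaves the factors of the restriction no
    slack. *)

Section complex_normed.
Variable R : rcfType.
#[non_forgetful_inheritance]
HB.instance Definition _ := GRing.ComAlgebra.copy R[i] R[i]^o.
#[non_forgetful_inheritance]
HB.instance Definition _ := Vector.copy R[i] R[i]^o.
#[non_forgetful_inheritance]
HB.instance Definition _ := NormedModule.copy R[i] R[i]^o.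
End complex_normed.

Section norm1.
Variable R : realType.
Local Notation C := R[i].
Implicit Types z w : C.

Definition cmod : C -> R := @Normc.normc R.

Lemma cmodE z : `|z| = (cmod z)%:C%C.
Proof. by case: z. Qed.
Lemma cmod_ge0 z : 0 <= cmod z.
Proof. by case: z => a b; exact: sqrtr_ge0. Qed.
Lemma cmod0 : cmod 0 = 0. Proof. exact: Normc.normc0. Qed.
Lemma cmodM z w : cmod (z * w) = cmod z * cmod w. Proof. exact: Normc.normcM. Qed.
Lemma cmodD z w : cmod (z + w) <= cmod z + cmod w. Proof. exact: le_normcD. Qed.
Lemma cmodN z : cmod (- z) = cmod z. Proof. exact: normcN. Qed.
Lemma cmod_eq0 z : cmod z = 0 -> z = 0. Proof. exact: Normc.eq0_normc. Qed.
Lemma cmod_sum I (r : seq I) P (F : I -> C) :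
  cmod (\sum_(i <- r | P i) F i) <= \sum_(i <- r | P i) cmod (F i).
Proof.
elim/big_ind2: _ => [|x x' y y' hx hy|//]; first by rewrite cmod0.
by apply: le_trans (cmodD _ _) _; apply: lerD.
Qed.

(** Its values lie in [R], while the matrix norm over [R[i]] has values in [R[i]]; total order,
    suprema and [lra] then apply directly. *)
Definition norm1 n (x : 'rV[C]_n) : R := \sum_j cmod (x 0 j).

Lemma norm1_ge0 n (x : 'rV_n) : 0 <= norm1 x.
Proof. by apply: sumr_ge0 => i _; apply: cmod_ge0. Qed.
Lemma norm10 n : norm1 (0 : 'rV_n) = 0.
Proof. by rewrite /norm1 big1 // => i _; rewrite mxE cmod0. Qed.
Lemma norm1D n (x y : 'rV_n) : norm1 (x + y) <= norm1 x + norm1 y.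
Proof. by rewrite /norm1 -big_split; apply: ler_sum => i _; rewrite mxE cmodD. Qed.
Lemma norm1N n (x : 'rV_n) : norm1 (- x) = norm1 x.
Proof. by apply: eq_bigr => i _; rewrite mxE cmodN. Qed.
Lemma norm1B n (x y : 'rV_n) : norm1 (x - y) = norm1 (y - x).
Proof. by rewrite -opprB norm1N. Qed.
Lemma norm1_eq0 n (x : 'rV_n) : norm1 x = 0 -> x = 0.
Proof.
move/eqP; rewrite psumr_eq0 => [/allP h|i _]; last exact: cmod_ge0.
apply/rowP => j; rewrite mxE; apply: cmod_eq0; apply/eqP.
by apply: h; rewrite mem_index_enum.
Qed.
Lemma cmod_le_norm1 n (x : 'rV_n) j : cmod (x 0 j) <= norm1 x.
Proof. by rewrite /norm1 (bigD1 j) //= lerDl sumr_ge0 // => i _; apply: cmod_ge0. Qed.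
Lemma norm1_triangle n (x y z : 'rV_n) : norm1 (x - z) <= norm1 (x - y) + norm1 (y - z).
Proof. by apply: le_trans (norm1D _ _); rewrite addrA subrK. Qed.

Lemma norm1_mulmx n m (M : 'M[C]_(n, m)) :
  exists2 K : R, 0 < K & forall h : 'rV_n, norm1 (h *m M) <= K * norm1 h.
Proof.
exists (1 + \sum_i \sum_j cmod (M i j)).
  rewrite ltr_pwDl ?ltr01// sumr_ge0 // => i _; rewrite sumr_ge0 // => j _.
  exact: cmod_ge0.
move=> h.
have H : norm1 (h *m M) <= \sum_i (\sum_j cmod (M i j)) * norm1 h.
  rewrite /norm1 -/(norm1 h).
  under [leRHS]eq_bigr do rewrite mulr_suml.
  rewrite exchange_big /=; apply: ler_sum => j _; rewrite mxE.
  apply: le_trans (cmod_sum _ _ _) _; apply: ler_sum => i _.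
  by rewrite cmodM mulrC ler_wpM2l ?cmod_ge0 ?cmod_le_norm1.
by apply: le_trans H _; rewrite -mulr_suml mulrDl mul1r lerDr norm1_ge0.
Qed.

Lemma mx_norm_le_norm1 n (x : 'rV[C]_n) : `|x| <= (norm1 x)%:C%C.
Proof.
have [->|] := eqVneq `|x| 0; first by rewrite lecR norm1_ge0.
move=> /mx_norm_neq0[[i j] /= ]; rewrite -[mx_norm x]/`|x| => ->.
by rewrite cmodE lecR (ord1 i) cmod_le_norm1.
Qed.

Lemma norm1_le_mx_norm n (x : 'rV[C]_n) : (norm1 x)%:C%C <= n%:R * `|x|.
Proof.
rewrite /norm1 rmorph_sum /= -[n in n%:R]card_ord -sum1_card natr_sum mulr_suml.
apply: ler_sum => j _; rewrite mul1r -cmodE.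
have : (`|x 0 j|%:nng)%:num <= mx_norm x; last by [].
rewrite mx_normE num_le.
exact: (le_bigmax _ (fun i : 'I_1 * 'I_n => `|x i.1 i.2|%:nng) (0, j)).
Qed.

Lemma near_norm1 n (x : 'rV[C]_n) (d : R) (P : set 'rV[C]_n) : 0 < d ->
  (forall y, norm1 (y - x) < d -> P y) -> \forall y \near x, P y.
Proof.
move=> d0 H; apply/nbhs_normP; exists (d / n.+1%:R)%:C%C => /=.
  by rewrite ltcR divr_gt0.
move=> y /= hy; apply: H; rewrite -ltcR norm1B.
apply: le_lt_trans (norm1_le_mx_norm _) _.
apply: (@le_lt_trans _ _ (n.+1%:R * `|x - y|)).
  by rewrite ler_wpM2r // ler_nat.
rewrite mulrC -ltr_pdivlMr ?ltr0n //; apply: lt_le_trans hy _.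
by rewrite -(rmorph_nat (real_complex R)) -rmorphV ?unitfE ?pnatr_eq0 // -rmorphM.
Qed.

(** The strict derivative: both [u] and [v] vary near [x]. For [v = x] this is Fréchet
    differentiability; with both free, [f] minus its linear part has arbitrarily small Lipschitz
    constant near [x]. *)
Definition sdiff_at n m (f : 'rV[C]_n -> 'rV[C]_m) x (M : 'M[C]_(n, m)) :=
  forall e : R, 0 < e -> exists2 d : R, 0 < d & forall u v,
    norm1 (u - x) < d -> norm1 (v - x) < d ->
    norm1 (f u - f v - (u - v) *m M) <= e * norm1 (u - v).

Lemma sdiff_at_differentiable n m (f : 'rV[C]_n -> 'rV[C]_m) x M :
  sdiff_at f x M -> differentiable f x.
Proof.
move=> h.
have cM : continuous (mulmxr M : 'rV[C]_n -> 'rV[C]_m).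
  apply/linear_bounded_continuous/linear_boundedP.
  have [K K0 HK] := norm1_mulmx M.
  near=> r => y /=; apply: le_trans (mx_norm_le_norm1 _) _.
  apply: (@le_trans _ _ (K * norm1 y)%:C%C); first by rewrite lecR.
  rewrite rmorphM /=; apply: (@le_trans _ _ (K%:C%C * (n%:R * `|y|))).
    by rewrite ler_wpM2l ?norm1_le_mx_norm // lecR ltW.
  rewrite mulrA ler_wpM2r //; near: r; apply: nbhs_pinfty_ge.
  by rewrite realM ?realn // complex_real.
have fM (e : C) : 0 < e -> \forall y \near (0 : 'rV[C]_n),
    `|(f \o shift x - (cst (f x) + mulmxr M)) y| <= e * `|y|.
  move=> e0.
  have er : e = (complex.Re e)%:C%C by rewrite RRe_real ?gtr0_real.
  have {}e0 : 0 < complex.Re e by move: e0; rewrite [e in 0 < e]er ltcR.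
  have [d d0 H] := h (complex.Re e / n.+1%:R) (divr_gt0 e0 (ltr0Sn _ _)).
  apply: near_norm1 d0 _ => y; rewrite subr0 => hy /=.
  have {H} := H (y + x) x; rewrite addrK subrr norm10 => /(_ hy (le_lt_trans (norm1_ge0 y) hy)) H.
  have -> : (f \o shift x - (cst (f x) + mulmxr M)) y = f (y + x) - f x - y *m M.
    by rewrite !fctE /= opprD addrA.
  apply: le_trans (mx_norm_le_norm1 _) _.
  apply: (@le_trans _ _ ((complex.Re e / n.+1%:R * norm1 y)%:C%C)); first by rewrite lecR.
  rewrite er rmorphM /= rmorphM /= -mulrA ler_wpM2l ?lecR ?(ltW e0) //.
  rewrite rmorphV ?unitfE ?pnatr_eq0 // rmorph_nat ler_pdivrMl ?ltr0n //.
  apply: le_trans (norm1_le_mx_norm _) _.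
  by rewrite ler_wpM2r // ler_nat.
have dM : 'd f x = mulmxr M :> (_ -> _) by apply: diff_unique => //; apply/eqaddoP.
by apply/diff_locallyP; rewrite dM; split => //; apply/eqaddoP.
Unshelve. all: by end_near. Qed.
End norm1.

Section strict_differentiability.
Variable R : realType.
Local Notation C := R[i].

Lemma near_norm1E n (x : 'rV[C]_n) (P : set 'rV[C]_n) :
  (\forall y \near x, P y) ->
  exists2 d : R, 0 < d & forall y, norm1 (y - x) < d -> P y.
Proof.
move=> /nbhs_normP[e /= e0 H].
have er : e = (complex.Re e)%:C%C by rewrite RRe_real ?gtr0_real.
exists (complex.Re e); first by move: e0; rewrite [e in 0 < e]er ltcR.
move=> y hy; apply: H => /=; rewrite -opprB normrN.
by apply: le_lt_trans (mx_norm_le_norm1 _) _; rewrite er ltcR.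
Qed.

Definition sdiff1_at n (f : 'rV[C]_n -> C) x (G : 'cV[C]_n) :=
  forall e : R, 0 < e -> exists2 d : R, 0 < d & forall u v,
    norm1 (u - x) < d -> norm1 (v - x) < d ->
    cmod (f u - f v - ((u - v) *m G) 0 0) <= e * norm1 (u - v).

Lemma cmod_mulmx n (G : 'cV[C]_n) :
  exists2 K : R, 0 < K & forall h : 'rV_n, cmod ((h *m G) 0 0) <= K * norm1 h.
Proof.
have [K K0 H] := norm1_mulmx G; exists K => // h.
exact: le_trans (cmod_le_norm1 _ 0) (H h).
Qed.

Lemma sdiff1_at_cvg n (f : 'rV[C]_n -> C) x G : sdiff1_at f x G ->
  forall e : R, 0 < e -> exists2 d : R, 0 < d & forall u,
    norm1 (u - x) < d -> cmod (f u - f x) <= e.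
Proof.
move=> h e e0; have [d d0 H] := h 1 ltr01; have [K K0 HK] := cmod_mulmx G.
exists (Num.min d (e / (K + 1))).
  by rewrite lt_min d0 divr_gt0 // addr_gt0.
move=> u; rewrite lt_min => /andP[ud ue].
have := H u x ud; rewrite subrr norm10 mul1r => /(_ d0) {}H.
rewrite -[f u - f x](subrK (((u - x) *m G) 0 0)).
apply: le_trans (cmodD _ _) _; apply: le_trans (lerD H (HK _)) _.
rewrite -[X in X + _]mul1r -mulrDl addrC -ler_pdivlMl ?addr_gt0 // mulrC.
exact: ltW.
Qed.

Lemma sdiff_at_row n m (f : 'rV[C]_n -> 'rV[C]_m) x M :
  (forall j, sdiff1_at (fun u => f u 0 j) x (col j M)) -> sdiff_at f x M.
Proof.
move=> H e e0.
have em : 0 < e / m.+1%:R by rewrite divr_gt0.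
have /boolp.choice[d Hd] : forall j, exists d : R, 0 < d /\ forall u v,
    norm1 (u - x) < d -> norm1 (v - x) < d ->
    cmod (f u 0 j - f v 0 j - ((u - v) *m col j M) 0 0)
      <= e / m.+1%:R * norm1 (u - v).
  by move=> j; have [d d0 Hd] := H j _ em; exists d.
exists (\big[Num.min/1]_j d j).
  by apply/bigmin_gtP; split => // j _; have [] := Hd j.
move=> u v /bigmin_gtP[_ hu] /bigmin_gtP[_ hv].
apply: (@le_trans _ _ (\sum_(j < m) e / m.+1%:R * norm1 (u - v))).
  apply: ler_sum => j _; rewrite !mxE.
  have [_ /(_ u v (hu j isT) (hv j isT))] := Hd j.
  suff -> : ((u - v) *m col j M) 0 0 = \sum_k (u - v) 0 k * M k j by [].
  by rewrite mxE; apply: eq_bigr => k _; rewrite !mxE.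
rewrite sumr_const card_ord -[leLHS]mulr_natr [leLHS]mulrAC ler_wpM2r ?norm1_ge0 //.
by rewrite [leLHS]mulrAC ler_pdivrMr // ler_wpM2l ?(ltW e0) // ler_nat.
Qed.

Lemma sdiff_at_coord n m (f : 'rV[C]_n -> 'rV[C]_m) x M j :
  sdiff_at f x M -> sdiff1_at (fun u => f u 0 j) x (col j M).
Proof.
move=> H e e0; have [d d0 Hd] := H e e0; exists d => // u v hu hv.
apply: le_trans (Hd u v hu hv); apply: le_trans (cmod_le_norm1 _ j).
suff -> : ((u - v) *m col j M) 0 0 = ((u - v) *m M) 0 j by rewrite !mxE.
by rewrite !mxE; apply: eq_bigr => k _; rewrite !mxE.
Qed.

Lemma sdiff1_at_cst n (c : C) (x : 'rV[C]_n) : sdiff1_at (fun=> c) x 0.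
Proof.
move=> e e0; exists 1 => // u v _ _.
by rewrite mulmx0 mxE subrr subr0 cmod0 mulr_ge0 ?norm1_ge0 // ltW.
Qed.

Lemma sdiff1_at_linear n (G : 'cV[C]_n) x : sdiff1_at (fun u => (u *m G) 0 0) x G.
Proof.
move=> e e0; exists 1 => // u v _ _.
by rewrite mulmxBl !mxE subrr cmod0 mulr_ge0 ?norm1_ge0 // ltW.
Qed.

Lemma sdiff1_atD n (f g : 'rV[C]_n -> C) x F G :
  sdiff1_at f x F -> sdiff1_at g x G -> sdiff1_at (fun u => f u + g u) x (F + G).
Proof.
move=> hf hg e e0; have e2 : 0 < e / 2 by rewrite divr_gt0.
have [d1 d10 H1] := hf _ e2; have [d2 d20 H2] := hg _ e2.
exists (Num.min d1 d2); first by rewrite lt_min d10.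
move=> u v; rewrite !lt_min => /andP[u1 u2] /andP[v1 v2].
rewrite mulmxDr mxE.
have -> : f u + g u - (f v + g v) - (((u - v) *m F) 0 0 + ((u - v) *m G) 0 0) =
  (f u - f v - ((u - v) *m F) 0 0) + (g u - g v - ((u - v) *m G) 0 0) by ring.
apply: le_trans (cmodD _ _) _; apply: le_trans (lerD (H1 _ _ u1 v1) (H2 _ _ u2 v2)) _.
by rewrite -mulrDl -splitr.
Qed.

Lemma sdiff1_atM n (f g : 'rV[C]_n -> C) x F G :
  sdiff1_at f x F -> sdiff1_at g x G ->
  sdiff1_at (fun u => f u * g u) x (g x *: F + f x *: G).
Proof.
move=> hf hg e e0.
have [K1 K10 HK1] := cmod_mulmx F; have [K2 K20 HK2] := cmod_mulmx G.
have a0 : 0 < cmod (f x) + 1 by rewrite ltr_wpDl ?cmod_ge0.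
have b0 : 0 < cmod (g x) + 1 by rewrite ltr_wpDl ?cmod_ge0.
have e4 : 0 < e / 4 by rewrite divr_gt0.
have [d1 d10 H1] := hf _ (divr_gt0 e4 b0); have [d2 d20 H2] := hg _ (divr_gt0 e4 a0).
have [d3 d30 H3] := sdiff1_at_cvg hf (divr_gt0 e4 K20).
have [d4 d40 H4] := sdiff1_at_cvg hg (divr_gt0 e4 K10).
have [d5 d50 H5] := sdiff1_at_cvg hf ltr01.
have [d6 d60 H6] := sdiff1_at_cvg hg ltr01.
exists (Num.min (Num.min d1 d2) (Num.min (Num.min d3 d4) (Num.min d5 d6))).
  by rewrite !lt_min d10 d20 d30 d40 d50 d60.
move=> u v; rewrite !lt_min.
move=> /andP[/andP[u1 u2] /andP[/andP[u3 u4] /andP[u5 u6]]].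
move=> /andP[/andP[v1 v2] /andP[/andP[v3 v4] /andP[v5 v6]]].
have -> : ((u - v) *m (g x *: F + f x *: G)) 0 0 =
    g x * ((u - v) *m F) 0 0 + f x * ((u - v) *m G) 0 0.
  by rewrite mulmxDr -!scalemxAr mxE [X in X + _]mxE [X in _ + X]mxE.
have {}HK1 := HK1 (u - v); have {}HK2 := HK2 (u - v).
have {}H1 := H1 u v u1 v1; have {}H2 := H2 u v u2 v2.
have {}H3 := H3 v v3; have {}H4 := H4 u u4.
have {H5} fv : cmod (f v) <= cmod (f x) + 1.
  by rewrite -[f v](subrK (f x)) addrC; apply: le_trans (cmodD _ _) _; rewrite lerD2l H5.
have {H6} gu : cmod (g u) <= cmod (g x) + 1.
  by rewrite -[g u](subrK (g x)) addrC; apply: le_trans (cmodD _ _) _; rewrite lerD2l H6.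
move: (((u - v) *m F) 0 0) (((u - v) *m G) 0 0) HK1 HK2 H1 H2 => p q HK1 HK2 H1 H2.
move: (norm1 (u - v)) (norm1_ge0 (u - v)) HK1 HK2 H1 H2 => N N0 HK1 HK2 H1 H2.
(* Two errors of strict differentiability, and two from replacing [g u] and [f v] by the values at
   [x]; each is at most e / 4 times [N]. *)
have -> : f u * g u - f v * g v - (g x * p + f x * q) =
  (f u - f v - p) * g u + f v * (g u - g v - q) + (p * (g u - g x) + q * (f v - f x)).
  by ring.
have B1 : cmod ((f u - f v - p) * g u) <= e / 4 * N.
  rewrite cmodM; apply: le_trans (ler_pM (cmod_ge0 _) (cmod_ge0 _) H1 gu) _.
  by rewrite mulrAC divfK // gt_eqF.
have B2 : cmod (f v * (g u - g v - q)) <= e / 4 * N.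
  rewrite cmodM mulrC; apply: le_trans (ler_pM (cmod_ge0 _) (cmod_ge0 _) H2 fv) _.
  by rewrite mulrAC divfK // gt_eqF.
have B3 : cmod (p * (g u - g x)) <= e / 4 * N.
  rewrite cmodM; apply: le_trans (ler_pM (cmod_ge0 _) (cmod_ge0 _) HK1 H4) _.
  by rewrite mulrC mulrA divfK // gt_eqF.
have B4 : cmod (q * (f v - f x)) <= e / 4 * N.
  rewrite cmodM; apply: le_trans (ler_pM (cmod_ge0 _) (cmod_ge0 _) HK2 H3) _.
  by rewrite mulrC mulrA divfK // gt_eqF.
apply: le_trans (cmodD _ _) _; apply: le_trans (lerD (cmodD _ _) (cmodD _ _)) _.
apply: le_trans (lerD (lerD B1 B2) (lerD B3 B4)) _.
by rewrite le_eqVlt; apply/orP; left; apply/eqP; field.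
Qed.

Lemma sdiff_at_cvg n m (f : 'rV[C]_n -> 'rV[C]_m) x M : sdiff_at f x M ->
  exists2 K : R, 0 < K & exists2 d : R, 0 < d & forall u v,
    norm1 (u - x) < d -> norm1 (v - x) < d ->
    norm1 (f u - f v) <= K * norm1 (u - v).
Proof.
move=> h; have [d d0 H] := h 1 ltr01; have [K K0 HK] := norm1_mulmx M.
exists (1 + K); rewrite ?addr_gt0 //; exists d => // u v hu hv.
rewrite -[f u - f v](subrK ((u - v) *m M)).
apply: le_trans (norm1D _ _) _; apply: le_trans (lerD (H u v hu hv) (HK _)) _.
by rewrite mulrDl.
Qed.

Lemma sdiff_at_comp n m l (f : 'rV[C]_n -> 'rV[C]_m) (g : 'rV[C]_m -> 'rV[C]_l) x F G :
  sdiff_at f x F -> sdiff_at g (f x) G -> sdiff_at (g \o f) x (F *m G).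
Proof.
move=> hf hg e e0.
have e2 : 0 < e / 2 by rewrite divr_gt0.
have [K K0 [d0 d00 HK]] := sdiff_at_cvg hf.
have [L L0 HL] := norm1_mulmx G.
have [d1 d10 H1] := hg (e / 2 / K) (divr_gt0 e2 K0).
have [d2 d20 H2] := hf (e / 2 / L) (divr_gt0 e2 L0).
exists (Num.min (Num.min d0 d2) (d1 / K)); first by rewrite !lt_min d00 d20 divr_gt0.
have near_f u : norm1 (u - x) < d0 -> norm1 (u - x) < d1 / K -> norm1 (f u - f x) < d1.
  move=> u0 u1; apply: le_lt_trans (HK u x u0 _) _; first by rewrite subrr norm10.
  by rewrite mulrC -ltr_pdivlMr.
move=> u v; rewrite !lt_min => /andP[/andP[u0 u2] u1] /andP[/andP[v0 v2] v1] /=.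
have B1 := H1 _ _ (near_f _ u0 u1) (near_f _ v0 v1).
have B2 := H2 _ _ u2 v2.
have -> : g (f u) - g (f v) - (u - v) *m (F *m G) = (g (f u) - g (f v) -
    (f u - f v) *m G) + (f u - f v - (u - v) *m F) *m G.
  by rewrite mulmxA [(_ - _ *m F) *m G]mulmxBl addrA subrK.
apply: le_trans (norm1D _ _) _.
have := HK u v u0 v0 => B0.
apply: (@le_trans _ _ (e / 2 * norm1 (u - v) + e / 2 * norm1 (u - v))); last first.
  by rewrite -mulrDl -splitr.
apply: lerD.
  apply: le_trans B1 _; rewrite -mulrA ler_wpM2l ?(ltW e2) //.
  by rewrite mulrC ler_pdivrMr // mulrC.
apply: le_trans (HL _) _; rewrite mulrC -ler_pdivlMr //.
by apply: le_trans B2 _; rewrite mulrAC.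
Qed.

Definition sdiff1 n (f : 'rV[C]_n -> C) (x : 'rV[C]_n) := \forall y \near x, exists G, sdiff1_at
  f y G.
Definition sdiff n m (f : 'rV[C]_n -> 'rV[C]_m) (x : 'rV[C]_n) :=
  \forall y \near x, exists M, sdiff_at f y M.

Lemma sdiff_nbhs n m (f : 'rV[C]_n -> 'rV[C]_m) x : sdiff f x ->
  {for x, continuous f}.
Proof.
by move=> /nbhs_singleton[M /sdiff_at_differentiable /differentiable_continuous].
Qed.

Lemma sdiff1_cst n (c : C) (x : 'rV[C]_n) : sdiff1 (fun=> c) x.
Proof. by apply: (@nearW _ (nbhs x)) => y; exists 0; apply: sdiff1_at_cst. Qed.

Lemma sdiff1_at_coordinate n (j : 'I_n) x :
  sdiff1_at (fun u : 'rV[C]_n => u 0 j) x (delta_mx j 0).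
Proof.
move=> e /(sdiff1_at_linear (delta_mx j 0) x)[d d0 H]; exists d => // u v hu hv.
have E (w : 'rV[C]_n) : (w *m (delta_mx j 0 : 'cV_n)) 0 0 = w 0 j.
  by rewrite -colE mxE.
by have := H u v hu hv; rewrite !E.
Qed.

Lemma sdiff1_coord n (j : 'I_n) (x : 'rV[C]_n) : sdiff1 (fun u => u 0 j) x.
Proof. by apply: (@nearW _ (nbhs x)) => y; exists (delta_mx j 0); apply: sdiff1_at_coordinate. Qed.

Lemma sdiff1D n (f g : 'rV[C]_n -> C) x :
  sdiff1 f x -> sdiff1 g x -> sdiff1 (fun u => f u + g u) x.
Proof.
apply: (@filterS2 _ (nbhs x)) => y [F hF] [G hG]; exists (F + G); exact: sdiff1_atD.
Qed.

Lemma sdiff1M n (f g : 'rV[C]_n -> C) x :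
  sdiff1 f x -> sdiff1 g x -> sdiff1 (fun u => f u * g u) x.
Proof.
apply: (@filterS2 _ (nbhs x)) => y [F hF] [G hG]; exists (g y *: F + f y *: G); exact: sdiff1_atM.
Qed.

Lemma sdiff1X n (f : 'rV[C]_n -> C) x k : sdiff1 f x -> sdiff1 (fun u => f u ^+ k) x.
Proof.
move=> hf; elim: k => [|k IH].
  by under [X in sdiff1 X _]eq_fun do rewrite expr0; exact: sdiff1_cst.
by under [X in sdiff1 X _]eq_fun do rewrite exprS; exact: sdiff1M.
Qed.

Lemma sdiff_row n m (f : 'rV[C]_n -> 'rV[C]_m) x :
  (forall j, sdiff1 (fun u => f u 0 j) x) -> sdiff f x.
Proof.
move=> H; have : \forall y \near x, forall j, exists G, sdiff1_at (fun u => f u 0 j) y G.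
  exact: (@filter_forall _ _ (fun j y => exists G, sdiff1_at (fun u => f u 0 j) y G) (nbhs x)).
apply: (@filterS _ (nbhs x)) => y /boolp.choice[G hG]; exists (\matrix_(i, j) G j i 0).
apply: sdiff_at_row => j; suff -> : col j (\matrix_(i, j) G j i 0) = G j by [].
by apply/colP => i; rewrite !mxE.
Qed.

Lemma sdiff_comp n m l (f : 'rV[C]_n -> 'rV[C]_m) (g : 'rV[C]_m -> 'rV[C]_l) x :
  sdiff f x -> sdiff g (f x) -> sdiff (g \o f) x.
Proof.
move=> hf hg; move: (sdiff_nbhs hf hg).
apply: (@filterS2 _ (nbhs x)) hf => y [F hF] [G hG]; exists (F *m G); exact: sdiff_at_comp.
Qed.

Lemma sdiff_coord n m (f : 'rV[C]_n -> 'rV[C]_m) x j :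
  sdiff f x -> sdiff1 (fun u => f u 0 j) x.
Proof. by apply: (@filterS _ (nbhs x)) => y [M hM]; exists (col j M); apply: sdiff_at_coord. Qed.

End strict_differentiability.

(** * Inverse function theorem for strictly differentiable maps *)

Section inverse_function.
Variable R : realType.
Local Notation C := R[i].

Lemma norm1Z n (c : C) (x : 'rV[C]_n) : norm1 (c *: x) = cmod c * norm1 x.
Proof. by rewrite mulr_sumr; apply: eq_bigr => j _; rewrite mxE cmodM. Qed.

(** The intervals of radius [e k] around [x k] meet pairwise, so the supremum of their left ends
    lies in all of them. *)
Lemma real_cauchy_limit (x e : nat -> R) :
  (forall k l, (k <= l)%N -> `|x l - x k| <= e k) ->
  exists a, forall k, `|a - x k| <= e k.
Proof.
move=> h; have e0 k : 0 <= e k by apply: le_trans (normr_ge0 _) (h k k (leqnn k)).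
have le k m : x k - e k <= x m + e m.
  have := e0 k; have := e0 m.
  case: (leqP k m) => [/h|/ltnW/h]; rewrite ler_norml => /andP[]; lra.
pose S := range (fun k => x k - e k).
have hs : has_sup S.
  by split; [exists (x 0%N - e 0%N), 0%N|exists (x 0%N + e 0%N) => _ [k _ <-]].
exists (sup S) => k; rewrite ler_norml; apply/andP; split.
  by have := ub_le_sup hs.2 (ex_intro2 _ _ k I erefl); rewrite /=; lra.
have : sup S <= x k + e k by apply: ge_sup => [|_ [m _ <-]//]; exact: hs.1.
lra.
Qed.

Lemma norm1_cauchy_limit n (x : nat -> 'rV[C]_n) (e : nat -> R) :
  (forall k l, (k <= l)%N -> norm1 (x l - x k) <= e k) ->
  exists a, forall k, norm1 (a - x k) <= n%:R * (2 * e k).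
Proof.
move=> h.
have ReL (z : C) : `|complex.Re z| <= cmod z.
  by case: z => a b /=; rewrite -sqrtr_sqr ler_wsqrtr // lerDl sqr_ge0.
have ImL (z : C) : `|complex.Im z| <= cmod z.
  by case: z => a b /=; rewrite -sqrtr_sqr ler_wsqrtr // lerDr sqr_ge0.
have /boolp.choice[a Ha] j : exists a, forall k, `|a - complex.Re (x k 0 j)| <= e k.
  apply: real_cauchy_limit => k l /h; apply: le_trans.
  apply: le_trans (cmod_le_norm1 _ j); rewrite !mxE.
  by move: (x l 0 j) (x k 0 j) => z w; rewrite -(raddfB (@complex.Re R)) ReL.
have /boolp.choice[b Hb] j : exists a, forall k, `|a - complex.Im (x k 0 j)| <= e k.
  apply: real_cauchy_limit => k l /h; apply: le_trans.
  apply: le_trans (cmod_le_norm1 _ j); rewrite !mxE.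
  by move: (x l 0 j) (x k 0 j) => z w; rewrite -(raddfB (@complex.Im R)) ImL.
exists (\row_j (a j +i* b j)%C) => k.
rewrite -[n in n%:R]card_ord -sum1_card natr_sum mulr_suml.
apply: ler_sum => j _; rewrite !mxE mul1r.
move: (Ha j k) (Hb j k); case: (x k 0 j) => p q /= {}Ha {}Hb.
apply: (@le_trans _ _ (`|a j - p| + `|b j - q|)); last by rewrite mulr_natl mulr2n lerD.
rewrite -[leRHS]ger0_norm ?addr_ge0 // -sqrtr_sqr ler_wsqrtr //.
by rewrite [leRHS]sqrrD !real_normK ?num_real // lerD2r lerDl mulrn_wge0 // mulr_ge0.
Qed.

Lemma geometric_small (c e : R) : 0 < e -> exists k, c / 2 ^+ k < e.
Proof.
move=> e0; pose k := Num.bound `|c / e|; exists k.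
rewrite ltr_pdivrMr ?exprn_gt0 // mulrC -ltr_pdivrMr //.
apply: le_lt_trans (ler_norm _) _; apply: lt_le_trans (archi_boundP (normr_ge0 _)) _.
by rewrite -natrX ler_nat; apply/ltnW/ltn_expl.
Qed.

(** In the direction of a kernel vector, [f] would move by at most half of what the expansion bound
    demands. This yields invertible derivatives at the points near the centre of the inverse
    function theorem. *)
Lemma sdiff_inj n (f : 'rV[C]_n -> 'rV[C]_n) u M K d : 0 < K -> 0 < d ->
  (forall v, norm1 (v - u) < d -> norm1 (v - u) <= K * norm1 (f v - f u)) ->
  sdiff_at f u M -> forall h : 'rV[C]_n, h *m M = 0 -> h = 0.
Proof.
move=> K0 d0 H hM h hM0; apply: norm1_eq0; apply/eqP/negPn/negP => hn.
have {hn} h0 : 0 < norm1 h by rewrite lt_def hn norm1_ge0.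
have [d1 d10 H1] := hM (2 * K)^-1 (ltac:(by rewrite invr_gt0 mulr_gt0)).
pose t := Num.min d d1 / 2 / norm1 h.
have m0 : 0 < Num.min d d1 by rewrite lt_min d0.
have t0 : 0 < t by rewrite !divr_gt0.
have th : norm1 (t%:C%C *: h) = Num.min d d1 / 2.
  rewrite norm1Z -[cmod _]/(complex.Re (cmod t%:C%C)%:C%C) -cmodE ger0_norm ?ler0c ?ltW //=.
  by rewrite divfK // gt_eqF.
have [td td1] : norm1 (t%:C%C *: h) < d /\ norm1 (t%:C%C *: h) < d1.
  by split; rewrite th; [have : Num.min d d1 <= d by rewrite ge_min lexx
                       | have : Num.min d d1 <= d1 by rewrite ge_min lexx orbT]; lra.
have Eu : u + t%:C%C *: h - u = t%:C%C *: h by rewrite addrC addKr.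
have := H (u + t%:C%C *: h); rewrite Eu => /(_ td) B.
have := H1 (u + t%:C%C *: h) u; rewrite Eu subrr norm10 => /(_ td1 d10).
rewrite -scalemxAl hM0 scaler0 subr0 => A.
have := le_trans B (ler_wpM2l (ltW K0) A).
rewrite mulrA invfM [K * _]mulrC divfK ?gt_eqF // => Q.
by move: Q; rewrite th; lra.
Qed.

Lemma half_bound (a b c d : R) : a <= 2^-1 * d -> b <= c -> d <= a + b -> d <= 2 * c.
Proof. lra. Qed.
Lemma half_lt (a d : R) : 0 < d -> a <= d / 2 -> a < d.
Proof. lra. Qed.
Lemma quarter_bound (a b c d e : R) :
  a <= 2^-1 * c -> c <= d / 2 -> b < d / 4 -> e <= a + b -> e <= d / 2.
Proof. lra. Qed.
Lemma half_add_lt (a b c d e : R) :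
  a <= c -> c < d / 2 -> b <= d / 2 -> e <= a + b -> e < d.
Proof. lra. Qed.
Lemma half_absurd (a b c d e : R) :
  e <= a + b -> a <= 2^-1 * c -> b <= d / 2 -> c <= d -> d < e -> False.
Proof. lra. Qed.

Lemma inverse_function n (f : 'rV[C]_n -> 'rV[C]_n) x M :
  sdiff f x -> sdiff_at f x M -> (forall h : 'rV[C]_n, h *m M = 0 -> h = 0) ->
  exists g d r, [/\ 0 < d, 0 < r,
    forall y, norm1 (y - f x) < r -> norm1 (g y - x) < d /\ f (g y) = y,
    forall u, norm1 (u - x) < d -> norm1 (f u - f x) < r -> g (f u) = u &
    (forall u, norm1 (u - x) < d -> exists M', sdiff_at f u M') /\
    (forall y, norm1 (y - f x) < r -> exists M', sdiff_at g y M')].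
Proof.
move=> /near_norm1E[d1 d10 Hd1] hM inj.
have Mu : M \in unitmx by rewrite -row_free_unit; apply: inj_row_free => v /inj.
have [K K0 HK] := norm1_mulmx (invmx M).
have [d2 d20 Hd2] := hM (2 * K)^-1 (ltac:(by rewrite invr_gt0 mulr_gt0)).
pose d := Num.min d1 d2; have d0 : 0 < d by rewrite lt_min d10.
have [dd1 dd2] : d <= d1 /\ d <= d2 by rewrite !ge_min !lexx orbT.
(* Newton's iteration with the derivative frozen at [x]: its fixed points solve f u = y, and it
   contracts by 1/2 on the ball of radius [d]. *)
pose T y u := u - (f u - y) *m invmx M.
have TE y u : T y u = u - (f u - y) *m invmx M by [].
clearbody T.
have TC y u v : norm1 (u - x) < d -> norm1 (v - x) < d ->
    norm1 (T y u - T y v) <= 2^-1 * norm1 (u - v).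
  move=> hu hv; have -> : T y u - T y v = - ((f u - f v - (u - v) *m M) *m invmx M).
    rewrite [(_ - _ *m M) *m _]mulmxBl mulmxK // !TE !mulmxBl.
    move: (f u *m _) (f v *m _) (y *m _) => a b c.
    by apply/rowP => i; rewrite !mxE; ring.
  rewrite norm1N; apply: le_trans (HK _) _.
  have := Hd2 u v (lt_le_trans hu dd2) (lt_le_trans hv dd2).
  move=> /(ler_wpM2l (ltW K0)) /le_trans; apply.
  by rewrite mulrA invfM [K * _]mulrC divfK ?gt_eqF.
have LB u v : norm1 (u - x) < d -> norm1 (v - x) < d ->
    norm1 (u - v) <= 2 * K * norm1 (f u - f v).
  move=> hu hv; have := TC (f v) u v hu hv.
  rewrite !TE (subrr (f v)) mul0mx subr0 (addrAC u) => A.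
  have := norm1D (u - v - (f u - f v) *m invmx M) ((f u - f v) *m invmx M).
  by rewrite subrK -mulrA; apply: half_bound A (HK _).
(* With this radius the first step T y x - x is shorter than d / 4, so the iterates stay within d /
   2 of [x]. *)
pose r := d / (4 * K).
have r0 : 0 < r by rewrite divr_gt0 // mulr_gt0.
have Tx y : norm1 (y - f x) < r -> norm1 (T y x - x) < d / 4.
  move=> hy; rewrite TE addrAC subrr add0r norm1N -norm1N -mulNmx opprB.
  apply: le_lt_trans (HK _) _; move: hy.
  by rewrite -(ltr_pM2l K0) /r invfM mulrCA [K * (_ * _)]mulrCA divff ?gt_eqF // mulr1.
have solve y : exists u, norm1 (y - f x) < r -> norm1 (u - x) < d /\ f u = y.
  have [hy|hn] := pselect (norm1 (y - f x) < r); last by exists x => /hn.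
  pose s k := iter k (T y) x.
  have s0 : s 0%N = x by [].
  have sS k : s k.+1 = T y (s k) by [].
  clearbody s.
  have s_ball k : norm1 (s k - x) <= d / 2.
    elim: k => [|k IH]; first by rewrite s0 subrr norm10 divr_ge0 ?ltW.
    have hk : norm1 (s k - x) < d by apply: half_lt.
    have := TC y (s k) x hk; rewrite subrr norm10 => /(_ d0) A.
    rewrite sS; exact: quarter_bound A IH (Tx y hy) (norm1_triangle _ (T y x) x).
  have s_in k : norm1 (s k - x) < d := half_lt d0 (s_ball k).
  have s_step k : norm1 (s k.+1 - s k) <= d / 4 / 2 ^+ k.
    elim: k => [|k IH]; first by rewrite expr0 divr1 sS s0 ltW // Tx.
    have -> : s k.+2 - s k.+1 = T y (s k.+1) - T y (s k) by rewrite !sS.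
    apply: le_trans (TC _ _ _ (s_in _) (s_in _)) _.
    by rewrite exprS invfM mulrCA ler_pM2l.
  have s_cauchy k l : (k <= l)%N -> norm1 (s l - s k) <= d / 2 / 2 ^+ k.
    move=> kl; apply: (@le_trans _ _ (d / 2 / 2 ^+ k - d / 2 / 2 ^+ l)); last first.
      by rewrite gerBl !divr_ge0 ?exprn_ge0 // ltW.
    elim: l kl => [|l IH].
      by rewrite leqn0 => /eqP->; rewrite !subrr norm10.
    rewrite leq_eqVlt => /predU1P[->|]; first by rewrite !subrr norm10.
    rewrite ltnS => /IH {}IH; have A := s_step l.
    apply: le_trans (norm1_triangle _ (s l) _) _.
    have -> : d / 2 / 2 ^+ l.+1 = d / 4 / 2 ^+ l.
      by rewrite exprS; field; rewrite ?expf_eq0 ?pnatr_eq0 ?andbF.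
    have -> : d / 2 / 2 ^+ k - d / 4 / 2 ^+ l =
      d / 4 / 2 ^+ l + (d / 2 / 2 ^+ k - d / 2 / 2 ^+ l).
      by field; rewrite !expf_eq0 !pnatr_eq0 !andbF.
    exact: lerD.
  have [l Hl] := norm1_cauchy_limit s_cauchy.
  have {}Hl k : norm1 (l - s k) <= n%:R * d / 2 ^+ k.
    apply: le_trans (Hl k) _; rewrite le_eqVlt; apply/orP; left; apply/eqP.
    by field; rewrite expf_eq0 pnatr_eq0 andbF.
  have l_in : norm1 (l - x) < d.
    have [k hk] := geometric_small (n%:R * d) (divr_gt0 d0 (ltr0Sn _ 1)).
    exact: half_add_lt (Hl k) hk (s_ball k) (norm1_triangle l (s k) x).
  exists l => _; split => //; apply/eqP; rewrite -subr_eq0; apply/eqP.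
  suff Tl : T y l = l.
    have : (f l - y) *m invmx M = 0.
      by rewrite -[LHS]opprK -[- (_ *m _)](addKr l) -TE Tl addNr oppr0.
    by move=> /(congr1 (mulmx^~ M)); rewrite mulmxKV // mul0mx.
  apply/eqP; rewrite -subr_eq0; apply/eqP/norm1_eq0/eqP; rewrite eq_le norm1_ge0 andbT.
  rewrite leNgt; apply/negP => h0.
  have [k hk] := geometric_small (n%:R * d) h0.
  have A := norm1_triangle (T y l) (s k.+1) l; rewrite sS in A; have B := TC y l (s k) l_in
    (s_in k).
  have D := Hl k.+1; rewrite norm1B sS in D; have F := Hl k.
  have E : n%:R * d / 2 ^+ k.+1 = n%:R * d / 2 ^+ k / 2.
    by rewrite exprSr; field; rewrite expf_eq0 pnatr_eq0 andbF.
  by rewrite E in D; apply: half_absurd A B D F hk.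
have [g Hg] := boolp.choice solve.
have gK u : norm1 (u - x) < d -> norm1 (f u - f x) < r -> g (f u) = u.
  move=> hu hf; have [h1 h2] := Hg _ hf; apply/eqP; rewrite -subr_eq0; apply/eqP.
  apply: norm1_eq0; apply/eqP; rewrite eq_le norm1_ge0 andbT.
  by apply: le_trans (LB _ _ h1 hu) _; rewrite h2 subrr norm10 mulr0.
have fS u : norm1 (u - x) < d -> exists M', sdiff_at f u M'.
  by move=> hu; apply: Hd1; apply: lt_le_trans hu dd1.
exists g, d, r; split => //; split => // y hy.
have [gy1 gy2] := Hg y hy; have [M' hM'] := fS _ gy1.
exists (invmx M').
have K20 : 0 < 2 * K by rewrite mulr_gt0.
(* The bound [LB] also holds around [g y], so the derivative there is invertible, and its inverse is
   the strict derivative of [g] at [y]. *)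
have inj' : forall h : 'rV[C]_n, h *m M' = 0 -> h = 0.
  apply: (@sdiff_inj _ f (g y) M' (2 * K) (d - norm1 (g y - x))) => //.
    by rewrite subr_gt0.
  move=> v hv; apply: LB => //; apply: le_lt_trans (norm1_triangle v (g y) x) _.
  by rewrite -ltrBrDr.
have M'u : M' \in unitmx by rewrite -row_free_unit; apply: inj_row_free => v /inj'.
have [K' K'0 HK'] := norm1_mulmx (invmx M').
move=> e e0.
have e1 : 0 < e / (2 * K) / K' by rewrite !divr_gt0.
have [d3 d30 H3] := hM' _ e1.
exists (Num.min (r - norm1 (y - f x)) (d3 / (2 * K))).
  by rewrite lt_min subr_gt0 hy divr_gt0.
move=> w1 w2; rewrite !lt_min => /andP[w1r w1d] /andP[w2r w2d].
have in_r w : norm1 (w - y) < r - norm1 (y - f x) -> norm1 (w - f x) < r.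
  move=> hw; apply: le_lt_trans (norm1_triangle w y (f x)) _.
  by rewrite -ltrBrDr.
have [g11 g12] := Hg _ (in_r _ w1r); have [g21 g22] := Hg _ (in_r _ w2r).
have near_g w : norm1 (g w - x) < d -> f (g w) = w -> norm1 (w - y) < d3 / (2 * K) ->
    norm1 (g w - g y) < d3.
  move=> h1 h2; rewrite ltr_pdivlMr // => h3; apply: le_lt_trans (LB _ _ h1 gy1) _.
  by rewrite h2 gy2 mulrC.
have := H3 _ _ (near_g _ g11 g12 w1d) (near_g _ g21 g22 w2d).
rewrite g12 g22 => A; have B := LB _ _ g11 g21; rewrite g12 g22 in B.
have -> : g w1 - g w2 - (w1 - w2) *m invmx M' =
    - ((w1 - w2 - (g w1 - g w2) *m M') *m invmx M').
  by rewrite [(_ - _ *m M') *m _]mulmxBl mulmxK // opprB.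
rewrite norm1N; apply: le_trans (HK' _) _.
apply: le_trans (ler_wpM2l (ltW K'0) A) _.
rewrite mulrA [K' * _]mulrC divfK ?gt_eqF // -mulrA ler_pM2l // ler_pdivrMl //.
Qed.

End inverse_function.

(** * Normal form of D4 singularities *)

Section D4_recognition.
Variable R : realType.
Local Notation C := R[i].

Lemma germ_isomorphic_sdiff n (X Y : set 'rV[C]_n) (f : 'rV[C]_n -> 'rV[C]_n) x M :
  sdiff f x -> sdiff_at f x M -> (forall h : 'rV[C]_n, h *m M = 0 -> h = 0) ->
  X x -> (\forall u \near x, X u <-> Y (f u)) -> germ_isomorphic X x Y (f x).
Proof.
move=> sf hM inj Xx nXY; have [d1 d10 XY] := near_norm1E nXY.
have [g [d [r [d0 r0 Hg gK [fS gS]]]]] := inverse_function sf hM inj.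
have gx : g (f x) = x by apply: gK; rewrite subrr norm10.
have [N /sdiff_at_cvg[K K0 [d2 d20 HK]]] := gS (f x) (ltac:(by rewrite subrr norm10)).
(* The local inverse [g] is Lipschitz near [f x], so it maps the ball of radius [r'] into the ball
   of radius [d1], where [X] is the preimage of [Y]. *)
pose r' := Num.min r (Num.min d2 (d1 / K)).
have r'0 : 0 < r' by rewrite !lt_min r0 d20 divr_gt0.
have [r'r r'd2 r'd1] : [/\ r' <= r, r' <= d2 & r' <= d1 / K].
  by rewrite !ge_min !lexx !orbT.
have gU y : norm1 (y - f x) < r' -> norm1 (g y - x) < d1.
  move=> hy; have := HK y (f x) (lt_le_trans hy r'd2).
  rewrite subrr norm10 gx => /(_ d20) /le_lt_trans; apply.
  by rewrite mulrC -ltr_pdivlMr // (lt_le_trans hy).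
pose U := [set u | (norm1 (u - x) < d /\ norm1 (u - x) < d1) /\ norm1 (f u - f x) < r'].
pose U' := [set y | norm1 (y - f x) < r'].
have near_ball m (z y : 'rV[C]_m) e : norm1 (z - y) < e -> \forall u \near z, norm1 (u - y) < e.
  move=> hz; apply: (@near_norm1 _ _ z (e - norm1 (z - y))); first by rewrite subr_gt0.
  by move=> u hu; apply: le_lt_trans (norm1_triangle u z y) _; rewrite -ltrBrDr.
split => //; split; first exact: (nbhs_singleton nXY).1.
exists U, U', f, g; split.
- split.
  + rewrite openE => z [[zd zd1] zf]; rewrite /interior.
    have [Mz /sdiff_at_differentiable /differentiable_continuous cf] := fS z zd.
    have A := near_ball _ _ _ _ zd; have B := near_ball _ _ _ _ zd1.
    have D := cf _ (near_ball _ _ _ _ zf).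
    by apply: (@filterS3 _ (nbhs z)) A B D.
  + by rewrite /U /= !subrr !norm10.
  + by rewrite openE => z zf; apply: near_ball zf.
  + by rewrite /U' /= subrr norm10.
- split.
  + by move=> z [[/fS[Mz /sdiff_at_differentiable]]].
  + by move=> y hy; have [My /sdiff_at_differentiable] := gS y (lt_le_trans hy r'r).
- by [].
- move=> z [Xz [[zd zd1] zf]]; split; last by apply: gK => //; apply: lt_le_trans r'r.
  by split => //; apply/(XY z zd1).
- move=> y [Yy hy]; have [gy fy] := Hg y (lt_le_trans hy r'r).
  have gy1 := gU y hy; split => //; split; first by apply/(XY _ gy1); rewrite fy.
  by rewrite /U /= fy.
Qed.

Definition has_differential n (f : 'rV[C]_n -> C) x (L : 'rV[C]_n -> C) :=
  exists2 G, sdiff1_at f x G & forall h, (h *m G) 0 0 = L h.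

Lemma has_differential_sdiff1 n (f : 'rV[C]_n -> C) x :
  sdiff1 f x -> exists L, has_differential f x L.
Proof. by move=> /nbhs_singleton[G hG]; exists (fun h => (h *m G) 0 0), G. Qed.

Lemma has_differential_cst n c (x : 'rV[C]_n) : has_differential (fun=> c) x (fun=> 0).
Proof. by exists 0; [exact: sdiff1_at_cst|move=> h; rewrite mulmx0 mxE]. Qed.

Lemma has_differential_coord n j (x : 'rV[C]_n) :
  has_differential (fun u => u 0 j) x (fun h => h 0 j).
Proof.
by exists (delta_mx j 0); [exact: sdiff1_at_coordinate|move=> h; rewrite -colE mxE].
Qed.

Lemma has_differentialD n (f g : 'rV[C]_n -> C) x F G :
  has_differential f x F -> has_differential g x G ->
  has_differential (fun u => f u + g u) x (fun h => F h + G h).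
Proof.
move=> [F' hF eF] [G' hG eG]; exists (F' + G'); first exact: sdiff1_atD.
by move=> h; rewrite mulmxDr mxE eF eG.
Qed.

Lemma has_differentialM n (f g : 'rV[C]_n -> C) x F G :
  has_differential f x F -> has_differential g x G ->
  has_differential (fun u => f u * g u) x (fun h => g x * F h + f x * G h).
Proof.
move=> [F' hF eF] [G' hG eG]; exists (g x *: F' + f x *: G'); first exact: sdiff1_atM.
by move=> h; rewrite mulmxDr -!scalemxAr mxE [X in X + _]mxE [X in _ + X]mxE eF eG.
Qed.

Lemma has_differentialX n (f : 'rV[C]_n -> C) x F k : has_differential f x F ->
  has_differential (fun u => f u ^+ k) x (fun h => k%:R * f x ^+ k.-1 * F h).
Proof.
move=> hf; elim: k => [|k IH].
  under [X in has_differential X]eq_fun do rewrite expr0.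
  under [X in has_differential _ _ X]eq_fun do rewrite mulr0n !mul0r.
  exact: has_differential_cst.
have := has_differentialM hf IH; under [X in has_differential X]eq_fun do rewrite -exprS.
congr has_differential; apply/funext => h; rewrite mulrA -mulrDl; congr (_ * _).
case: k {IH} => [|k]; first by rewrite mulr0n mul0r mulr0 addr0 mulr1.
by rewrite /= mulrCA -exprS [in RHS]mulrSr mulrDl mul1r addrC.
Qed.

Lemma has_differential_row n m (f : 'rV[C]_n -> 'rV[C]_m) x L :
  (forall j, has_differential (fun u => f u 0 j) x (L j)) ->
  exists2 M, sdiff_at f x M & forall h j, (h *m M) 0 j = L j h.
Proof.
move=> H; have /boolp.choice[G hG] : forall j, exists G : 'cV[C]_n,
    sdiff1_at (fun u => f u 0 j) x G /\ forall h, (h *m G) 0 0 = L j h.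
  by move=> j; have [G] := H j; exists G.
exists (\matrix_(i, j) G j i 0).
  apply: sdiff_at_row => j; have [+ _] := hG j; congr sdiff1_at.
  by apply/colP => i; rewrite !mxE.
move=> h j; have [_ <-] := hG j; rewrite !mxE.
by apply: eq_bigr => i _; rewrite !mxE.
Qed.

(* P is locally invertible at w; W is the local inverse composed with f. *)
Lemma local_lift n m (P : 'rV[C]_m -> 'rV[C]_m) w L (f : 'rV[C]_n -> 'rV[C]_m) x :
  sdiff P w -> (forall j, has_differential (fun u => P u 0 j) w (L j)) ->
  (forall h : 'rV[C]_m, (forall j, L j h = 0) -> h = 0) ->
  sdiff f x -> f x = P w ->
  exists W : 'rV[C]_n -> 'rV[C]_m, [/\ sdiff W x, W x = w & \forall u \near x, P (W u) = f u].
Proof.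
move=> sP /has_differential_row[M hM ML] inj sf fx.
have injM (h : 'rV[C]_m) : h *m M = 0 -> h = 0.
  by move=> h0; apply: inj => j; rewrite -ML h0 mxE.
have [g [d [r [d0 r0 Hg gK [fS gS]]]]] := inverse_function sP hM injM.
exists (g \o f); split.
- by apply: sdiff_comp => //; apply: near_norm1 r0 _ => y; rewrite fx; apply: gS.
- by rewrite /= fx gK // subrr norm10.
- have nr : \forall y \near f x, norm1 (y - P w) < r.
    by apply: near_norm1 r0 _ => y; rewrite fx.
  by move: (sdiff_nbhs sf nr); apply: (@filterS _ (nbhs x)) => u /Hg[].
Qed.

Lemma row_nth_inj n (h : 'rV[C]_n) : (forall j, h 0 j = 0) -> h = 0.
Proof. by move=> H; apply/rowP => j; rewrite H mxE. Qed.

(** The map (t, a) |-> (a t^2, a) is locally invertible where a t is nonzero. Lifting u |-> (1, A u)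
    through it gives [t] as first coordinate, the second one carrying [A] along as a parameter. *)
Lemma inverse_sqrt n (A : 'rV[C]_n -> C) x : sdiff1 A x -> A x != 0 ->
  exists2 t : 'rV[C]_n -> C, sdiff1 t x & \forall u \near x, A u * t u ^+ 2 = 1.
Proof.
move=> sA A0.
pose t0 := (sqrtc (A x))^-1; pose w := \row_(j < 2) [:: t0; A x]`_j.
pose P (w : 'rV[C]_2) := \row_(j < 2) [:: w 0 1 * w 0 0 ^+ 2; w 0 1]`_j.
pose f u := \row_(j < 2) [:: 1; A u]`_j.
have t0E : A x * t0 ^+ 2 = 1 by rewrite exprVn sqr_sqrtc divff.
have t00 : t0 != 0 by apply: contra_eq_neq t0E => ->; rewrite expr0n mulr0 eq_sym oner_eq0.
have w0 : w 0 0 = t0 by rewrite mxE.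
have w1 : w 0 1 = A x by rewrite mxE.
have sP : sdiff P w.
  apply: sdiff_row => -[[|[|//]] ?]; under [X in sdiff1 X]eq_fun do rewrite mxE /=.
    by apply: sdiff1M; [|apply: sdiff1X]; apply: sdiff1_coord.
  exact: sdiff1_coord.
have sf : sdiff f x.
  apply: sdiff_row => -[[|[|//]] ?]; under [X in sdiff1 X]eq_fun do rewrite mxE /=.
    exact: sdiff1_cst.
  exact: sA.
pose L (j : 'I_2) (h : 'rV[C]_2) := [:: t0 ^+ 2 * h 0 1 + A x * (2 * t0 * h 0 0); h 0 1]`_j.
have hL j : has_differential (fun u => P u 0 j) w (L j).
  case: j => [[|[|//]] ?]; under [X in has_differential X]eq_fun do rewrite mxE /=.
    rewrite /L /= -w0 -w1; apply: has_differentialM (has_differential_coord _ _) _.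
    exact: has_differentialX 2 (has_differential_coord _ _).
  exact: has_differential_coord.
have injL h : (forall j, L j h = 0) -> h = 0.
  move=> H; have h1 : h 0 1 = 0 := H 1; have := H 0.
  rewrite /L /= h1 mulr0 add0r => /eqP; rewrite !mulf_eq0 (negPf A0) pnatr_eq0 (negPf t00) /=.
  move=> /eqP h0; apply: row_nth_inj => -[[|[|//]] ?].
    by rewrite -[RHS]h0; congr (h 0 _); apply: val_inj.
  by rewrite -[RHS]h1; congr (h 0 _); apply: val_inj.
have fx : f x = P w.
  by apply/rowP => -[[|[|//]] ?]; rewrite mxE [RHS]mxE /= w1 ?w0 ?t0E.
have [W [sW _ nW]] := local_lift sP hL injL sf fx.
exists (fun u => W u 0 0); first exact: (sdiff_coord 0 sW).
move: nW; apply: (@filterS _ (nbhs x)) => u /rowP e.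
by have := e 0; have := e 1; rewrite !mxE /= => ->.
Qed.

(** The coefficients of (w0 t + w1 r)^3 + (w2 t + w3 r)^3 are polynomials in w. At w = (a0, 0, 0,
    d0), with a0 and d0 cube roots of [c1 x] and [c4 x], their derivative is diagonal with entries 3
    a0^2, 3 a0^2, 3 d0^2, 3 d0^2, so [local_lift] applies. *)
Lemma binary_cubic_normal_form n (c1 c2 c3 c4 : 'rV[C]_n -> C) x :
  sdiff1 c1 x -> sdiff1 c2 x -> sdiff1 c3 x -> sdiff1 c4 x ->
  c1 x != 0 -> c2 x = 0 -> c3 x = 0 -> c4 x != 0 ->
  exists W : 'rV[C]_n -> 'rV[C]_4, [/\ sdiff W x,
    W x 0 0 != 0, W x 0 1 = 0, W x 0 2 = 0 /\ W x 0 3 != 0 &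
    \forall u \near x, forall t r,
      c1 u * t ^+ 3 + c2 u * t ^+ 2 * r + c3 u * t * r ^+ 2 + c4 u * r ^+ 3 =
      (W u 0 0 * t + W u 0 1 * r) ^+ 3 + (W u 0 2 * t + W u 0 3 * r) ^+ 3].
Proof.
move=> s1 s2 s3 s4 c10 c20 c30 c40.
pose a0 := 3.-root (c1 x); pose d0 := 3.-root (c4 x).
have a0E : a0 ^+ 3 = c1 x by rewrite rootCK.
have d0E : d0 ^+ 3 = c4 x by rewrite rootCK.
have a00 : a0 != 0 by apply: contraNneq c10 => a00; rewrite -a0E a00 expr0n.
have d00 : d0 != 0 by apply: contraNneq c40 => d00; rewrite -d0E d00 expr0n.
pose w := \row_(j < 4) [:: a0; 0; 0; d0]`_j.
pose P (w : 'rV[C]_4) := \row_(j < 4) [:: w 0 0 ^+ 3 + w 0 2 ^+ 3;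
  3 * (w 0 0 ^+ 2 * w 0 1 + w 0 2 ^+ 2 * w 0 3);
  3 * (w 0 0 * w 0 1 ^+ 2 + w 0 2 * w 0 3 ^+ 2);
  w 0 1 ^+ 3 + w 0 3 ^+ 3]`_j.
pose f u := \row_(j < 4) [:: c1 u; c2 u; c3 u; c4 u]`_j.
have w0 : w 0 0 = a0 by rewrite mxE.
have w1 : w 0 1 = 0 by rewrite mxE.
have w2 : w 0 2 = 0 by rewrite mxE.
have w3 : w 0 3 = d0 by rewrite mxE.
pose L (j : 'I_4) (h : 'rV[C]_4) := [:: 3 * a0 ^+ 2 * h 0 0; 3 * (a0 ^+ 2 * h 0 1);
  3 * (d0 ^+ 2 * h 0 2); 3 * d0 ^+ 2 * h 0 3]`_j.
have sP : sdiff P w.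
  have sc j := sdiff1_coord j w; have sX j k := sdiff1X k (sc j).
  have s3' := sdiff1_cst (3 : C) w.
  apply: sdiff_row => -[[|[|[|[|//]]]] ?]; under [X in sdiff1 X]eq_fun do rewrite mxE /=.
  - exact: sdiff1D (sX 0 3) (sX 2 3).
  - exact: sdiff1M s3' (sdiff1D (sdiff1M (sX 0 2) (sc 1)) (sdiff1M (sX 2 2) (sc 3))).
  - exact: sdiff1M s3' (sdiff1D (sdiff1M (sc 0) (sX 1 2)) (sdiff1M (sc 2) (sX 3 2))).
  - exact: sdiff1D (sX 1 3) (sX 3 3).
have sf : sdiff f x.
  by apply: sdiff_row => -[[|[|[|[|//]]]] ?]; under [X in sdiff1 X]eq_fun do rewrite mxE /=.
have hc j := has_differential_coord j w.
have hX j k := has_differentialX k (hc j).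
have h3 := @has_differential_cst 4 3 w.
have hL j : has_differential (fun u => P u 0 j) w (L j).
  have eqL (g : 'rV[C]_4 -> C) F G : has_differential g w F -> F = G ->
      has_differential g w G by move=> + <-.
  case: j => [[|[|[|[|//]]]] ?]; under [X in has_differential X]eq_fun do rewrite mxE /=.
  - apply: eqL (has_differentialD (hX 0 3) (hX 2 3)) _; apply/funext => h.
    by rewrite /L /= w0 w2; ring.
  - apply: eqL (has_differentialM h3 (has_differentialD (has_differentialM (hX 0 2) (hc 1))
      (has_differentialM (hX 2 2) (hc 3)))) _; apply/funext => h.
    by rewrite /L /= w0 w1 w2 w3; ring.
  - apply: eqL (has_differentialM h3 (has_differentialD (has_differentialM (hc 0) (hX 1 2))
      (has_differentialM (hc 2) (hX 3 2)))) _; apply/funext => h.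
    by rewrite /L /= w0 w1 w2 w3; ring.
  - apply: eqL (has_differentialD (hX 1 3) (hX 3 3)) _; apply/funext => h.
    by rewrite /L /= w1 w3; ring.
have injL h : (forall j, L j h = 0) -> h = 0.
  move=> H; apply: row_nth_inj => j; have := H j; rewrite /L.
  have n3 : 3 != 0 :> C by rewrite pnatr_eq0.
  case: j => [[|[|[|[|//]]]] ?] /= /eqP; rewrite !mulf_eq0 ?expf_eq0 (negPf n3) ?(negPf a00)
    ?(negPf d00) /=;
  by move=> /eqP h0; rewrite -[RHS]h0; congr (h 0 _); apply: val_inj.
have fx : f x = P w.
  apply/rowP => -[[|[|[|[|//]]]] ?]; rewrite mxE [RHS]mxE /= ?w1 ?w2 ?w0 ?w3.
  - by rewrite a0E expr0n addr0.
  - by rewrite c20 expr0n !mulr0 !mul0r addr0 mulr0.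
  - by rewrite c30 expr0n !mulr0 !mul0r addr0 mulr0.
  - by rewrite d0E expr0n add0r.
have [W [sW Ww nW]] := local_lift sP hL injL sf fx.
exists W; split; rewrite ?Ww ?w0 ?w1 ?w2 ?w3 //.
move: nW; apply: (@filterS _ (nbhs x)) => u /rowP e t r.
have := e 0; have := e 1; have := e 2; have := e 3; rewrite !mxE /= => <- <- <- <-.
by ring.
Qed.
End D4_recognition.

Section D4_germ.
Variable R : realType.
Local Notation C := R[i].
Local Notation V := 'rV[C]_3.

(** As [f] vanishes at [x], only the value of [g] enters the derivative; the coefficient functions
    contribute without their derivatives being known. *)
Lemma sdiff1_atM0 n (f g : 'rV[C]_n -> C) x F :
  has_differential f x F -> f x = 0 -> sdiff1 g x ->
  has_differential (fun u => f u * g u) x (fun h => g x * F h).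
Proof.
move=> hf f0 /has_differential_sdiff1[G hG]; have := has_differentialM hf hG.
congr has_differential; apply/funext => h.
by rewrite f0 mul0r addr0.
Qed.

(* h is s^2 + (nondegenerate cubic in t, r) up to terms of weight > 6,
   where s, t, r have weights 3, 2, 2. *)
Definition D4_form (h : V -> C) :=
  exists A B1 B2 B3 C1 C2 C3 C4 : V -> C,
    [/\ [/\ sdiff1 A 0, sdiff1 B1 0, sdiff1 B2 0 & sdiff1 B3 0],
        [/\ sdiff1 C1 0, sdiff1 C2 0, sdiff1 C3 0 & sdiff1 C4 0],
        A 0 != 0,
        [/\ C1 0 != 0, C2 0 = 0, C3 0 = 0 & C4 0 != 0] &
        forall v : V, let s := v 0 0 in let t := v 0 1 in let r := v 0 2 in
          h v = A v * s ^+ 2 + s * (B1 v * t ^+ 2 + B2 v * t * r + B3 v * r ^+ 2)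
             + (C1 v * t ^+ 3 + C2 v * t ^+ 2 * r + C3 v * t * r ^+ 2 + C4 v * r ^+ 3)].

Lemma D4_form_coordinates h : D4_form h ->
  exists (f : V -> V), [/\ sdiff f 0, f 0 = 0,
    exists2 M, sdiff_at f 0 M & forall k : V, k *m M = 0 -> k = 0 &
    \forall v \near (0 : V), h v = 0 <-> D4_model C (f v)].
Proof.
move=> [A [B1 [B2 [B3 [C1 [C2 [C3 [C4 [[sA sB1 sB2 sB3] [s1 s2 s3 s4] A0 [c1 c2 c3 c4] hE]]]]]]]]].
have sc j : sdiff1 (fun v : V => v 0 j) 0 := sdiff1_coord j _.
have [tau st nt] := inverse_sqrt sA A0.
(* Completing the square: with Q = B1 t^2 + B2 t r + B3 r^2 and A tau^2 = 1, A s^2 + s Q is the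
   square of tau (A s + Q / 2) minus tau^2 Q^2 / 4. This quartic in t, r is spread over the cubic:
   each Di below is Ci plus terms that vanish at 0. *)
pose q (v : V) := tau v ^+ 2 * (- 4^-1).
have sq : sdiff1 q 0 := sdiff1M (sdiff1X 2 st) (sdiff1_cst _ _).
pose D1 (v : V) := C1 v + q v * (B1 v ^+ 2 * v 0 1 + B1 v * B2 v * (2 * v 0 2)).
pose D2 (v : V) := C2 v + q v * ((B2 v ^+ 2 + B1 v * B3 v * 2) * v 0 2).
pose D3 (v : V) := C3 v + q v * (B2 v * B3 v * (2 * v 0 2)).
pose D4 (v : V) := C4 v + q v * (B3 v ^+ 2 * v 0 2).
have s2c := sdiff1_cst (2 : C) (0 : V).
have sD1 : sdiff1 D1 0 := sdiff1D s1 (sdiff1M sq (sdiff1D (sdiff1M (sdiff1X 2 sB1) (sc 1))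
  (sdiff1M (sdiff1M sB1 sB2) (sdiff1M s2c (sc 2))))).
have sD2 : sdiff1 D2 0 := sdiff1D s2 (sdiff1M sq (sdiff1M (sdiff1D (sdiff1X 2 sB2)
  (sdiff1M (sdiff1M sB1 sB3) s2c)) (sc 2))).
have sD3 : sdiff1 D3 0 := sdiff1D s3 (sdiff1M sq (sdiff1M (sdiff1M sB2 sB3) (sdiff1M s2c (sc 2)))).
have sD4 : sdiff1 D4 0 := sdiff1D s4 (sdiff1M sq (sdiff1M (sdiff1X 2 sB3) (sc 2))).
have v0 j : (0 : V) 0 j = 0 by rewrite mxE.
have [W [sW W0 W1 [W2 W3] nW]] : exists W : V -> 'rV[C]_4, [/\ sdiff W 0,
    W 0 0 0 != 0, W 0 0 1 = 0, W 0 0 2 = 0 /\ W 0 0 3 != 0 &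
    \forall u \near (0 : V), forall t r,
      D1 u * t ^+ 3 + D2 u * t ^+ 2 * r + D3 u * t * r ^+ 2 + D4 u * r ^+ 3 =
      (W u 0 0 * t + W u 0 1 * r) ^+ 3 + (W u 0 2 * t + W u 0 3 * r) ^+ 3].
  apply: binary_cubic_normal_form => //;
    by rewrite /D1 /D2 /D3 /D4 !v0 !mulr0 ?addr0 ?mulr0 ?addr0.
have sw j := sdiff_coord j sW.
pose w3 : C := sqrtc 3; have w3E : w3 ^+ 2 = 3 by rewrite sqr_sqrtc.
have w30 : w3 != 0 by apply: contra_eq_neq w3E => ->; rewrite expr0n eq_sym pnatr_eq0.
pose x (v : V) := v 0 0 * (A v * tau v) +
  (v 0 1 * (B1 v * v 0 1 + B2 v * v 0 2) + v 0 2 * (B3 v * v 0 2)) * (tau v * 2^-1).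
pose y (v : V) := v 0 1 * W v 0 0 + v 0 2 * W v 0 1.
pose z (v : V) := v 0 1 * W v 0 2 + v 0 2 * W v 0 3.
(* From 3 (y - z)^2 (y + z) + (y + z)^3 = 4 (y^3 + z^3), these coordinates put 4 (x^2 + y^3 + z^3)
   in the form of the model. *)
pose f (v : V) : V := \row_(j < 3) [:: 2 * x v; w3 * (y v + -1 * z v); y v + z v]`_j.
have sAt := sdiff1M sA st.
have sx1 := sdiff1D (sdiff1M sB1 (sc 1)) (sdiff1M sB2 (sc 2)).
have sx2 := sdiff1M sB3 (sc 2).
have sx3 := sdiff1M st (sdiff1_cst (2^-1 : C) (0 : V)).
have sx : sdiff1 x 0 := sdiff1D (sdiff1M (sc 0) sAt)
  (sdiff1M (sdiff1D (sdiff1M (sc 1) sx1) (sdiff1M (sc 2) sx2)) sx3).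
have sy : sdiff1 y 0 := sdiff1D (sdiff1M (sc 1) (sw 0)) (sdiff1M (sc 2) (sw 1)).
have sz : sdiff1 z 0 := sdiff1D (sdiff1M (sc 1) (sw 2)) (sdiff1M (sc 2) (sw 3)).
exists f; split.
- apply: sdiff_row => -[[|[|[|//]]] ?]; under [X in sdiff1 X]eq_fun do rewrite mxE /=.
  + exact: sdiff1M s2c sx.
  + exact: sdiff1M (sdiff1_cst _ _) (sdiff1D sy (sdiff1M (sdiff1_cst _ _) sz)).
  + exact: sdiff1D sy sz.
- apply/rowP => -[[|[|[|//]]] ?]; rewrite mxE [RHS]mxE /= /x /y /z !v0;
  by rewrite !(mul0r, mulr0, addr0).
- have hc j := has_differential_coord j (0 : V).
  have hx := has_differentialD (sdiff1_atM0 (hc 0) (v0 0) sAt) (sdiff1_atM0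
    (has_differentialD (sdiff1_atM0 (hc 1) (v0 1) sx1) (sdiff1_atM0 (hc 2) (v0 2) sx2))
    (ltac:(by rewrite /= !v0 !mul0r addr0)) sx3).
  have hy := has_differentialD (sdiff1_atM0 (hc 1) (v0 1) (sw 0)) (sdiff1_atM0 (hc 2) (v0 2) (sw
    1)).
  have hz := has_differentialD (sdiff1_atM0 (hc 1) (v0 1) (sw 2)) (sdiff1_atM0 (hc 2) (v0 2) (sw
    3)).
  pose a := 2 * (A 0 * tau 0).
  pose L (j : 'I_3) (h : V) := [:: a * h 0 0;
    w3 * (W 0 0 0 * h 0 1 - W 0 0 3 * h 0 2); W 0 0 0 * h 0 1 + W 0 0 3 * h 0 2]`_j.
  have eqL (g : V -> C) F G : has_differential g 0 F -> F = G ->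
      has_differential g 0 G by move=> + <-.
  have hL j : has_differential (fun v => f v 0 j) 0 (L j).
    case: j => [[|[|[|//]]] ?]; under [X in has_differential X]eq_fun do rewrite mxE /=.
    + apply: eqL (has_differentialM (has_differential_cst _ _) hx) _; apply/funext => k.
      by rewrite /L /= /a !v0; ring.
    + apply: eqL (has_differentialM (has_differential_cst _ _) (has_differentialD hy
        (has_differentialM (has_differential_cst _ _) hz))) _; apply/funext => k.
      by rewrite /L /= W1 W2; ring.
    + apply: eqL (has_differentialD hy hz) _; apply/funext => k.
      by rewrite /L /= W1 W2; ring.
  have [M hM ML] := has_differential_row hL; exists M => // k kM.
  have {ML kM} L0 j : L j k = 0 by rewrite -ML kM mxE.
  have a0 : a != 0.
    have := nbhs_singleton nt; rewrite /a => e.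
    rewrite !mulf_neq0 ?pnatr_eq0 //.
    by apply: contra_eq_neq e => ->; rewrite expr0n mulr0 eq_sym oner_eq0.
  have e0 := L0 0; have e1 := L0 1; have e2 := L0 2; rewrite /L /= in e0 e1 e2.
  have k0 : k 0 0 = 0 by apply: (mulfI a0); rewrite e0 mulr0.
  move/eqP: e1; rewrite mulf_eq0 (negPf w30) /= => /eqP e1.
  have k1 : k 0 1 = 0.
    apply: (mulfI W0); apply: (mulfI (ltac:(by rewrite pnatr_eq0) : 2 != 0 :> C)).
    by rewrite !mulr0; transitivity (0 + 0 : C); [rewrite -{1}e1 -e2; ring|rewrite addr0].
  have k2 : k 0 2 = 0 by apply: (mulfI W3); rewrite mulr0 -e2 k1 mulr0 add0r.
  apply: row_nth_inj => -[[|[|[|//]]] ?].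
  + by rewrite -[RHS]k0; congr (k 0 _); apply: val_inj.
  + by rewrite -[RHS]k1; congr (k 0 _); apply: val_inj.
  + by rewrite -[RHS]k2; congr (k 0 _); apply: val_inj.
- move: nW nt; apply: (@filterS2 _ (nbhs (0 : V))) => v vW vt.
  suff E : f v 0 0 ^+ 2 + f v 0 1 ^+ 2 * f v 0 2 + f v 0 2 ^+ 3 = 4 * h v.
    rewrite /D4_model /= E; split=> [->|/eqP]; first by rewrite mulr0.
    by rewrite mulf_eq0 pnatr_eq0 => /eqP.
  rewrite hE !mxE /=.
  have Ey : W v 0 0 * v 0 1 + W v 0 1 * v 0 2 = y v by rewrite /y; ring.
  have Ez : W v 0 2 * v 0 1 + W v 0 3 * v 0 2 = z v by rewrite /z; ring.
  have := vW (v 0 1) (v 0 2); rewrite Ey Ez => vW'.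
  have -> : (2 * x v) ^+ 2 + (w3 * (y v + -1 * z v)) ^+ 2 * (y v + z v) + (y v + z v) ^+ 3
    = 4 * x v ^+ 2 + w3 ^+ 2 * (y v - z v) ^+ 2 * (y v + z v) + (y v + z v) ^+ 3 by ring.
  rewrite w3E.
  have -> : 4 * x v ^+ 2 + 3 * (y v - z v) ^+ 2 * (y v + z v) + (y v + z v) ^+ 3 =
    4 * (x v ^+ 2 + (y v ^+ 3 + z v ^+ 3)) by ring.
  rewrite -vW' /D1 /D2 /D3 /D4 /q /x.
  set a := A v in vt *; set b := tau v in vt *.
  pose Q := B1 v * v 0 1 ^+ 2 + B2 v * v 0 1 * v 0 2 + B3 v * v 0 2 ^+ 2.
  have -> : (v 0 0 * (a * b) + (v 0 1 * (B1 v * v 0 1 + B2 v * v 0 2) + v 0 2 * (B3 v * v 0 2)) *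
     (b * 2^-1)) ^+ 2 = a * (a * b ^+ 2) * v 0 0 ^+ 2 + v 0 0 * (a * b ^+ 2) * Q
       + 4^-1 * b ^+ 2 * Q ^+ 2 by rewrite /Q; field.
  by rewrite vt /Q; field.
Qed.

Lemma D4_form_germ h (phi : V -> V) u M (X : set V) : D4_form h ->
  sdiff phi u -> sdiff_at phi u M -> (forall k : V, k *m M = 0 -> k = 0) -> phi u = 0 ->
  (\forall v \near u, X v <-> h (phi v) = 0) -> germ_isomorphic X u (D4_model C) 0.
Proof.
move=> hh sphi hM inj phi0 nX.
have [f [sf f0 [N hN injN] nf]] := D4_form_coordinates hh.
have -> : (0 : V) = (f \o phi) u by rewrite /= phi0 f0.
have nf' : \forall v \near phi u, h v = 0 <-> D4_model C (f v) by rewrite phi0.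
have near_phi : \forall v \near u, h (phi v) = 0 <-> D4_model C (f (phi v)).
  exact: (sdiff_nbhs sphi nf').
have sf' : sdiff f (phi u) by rewrite phi0.
have hN' : sdiff_at f (phi u) N by rewrite phi0.
have injMN (k : V) : k *m (M *m N) = 0 -> k = 0 by rewrite mulmxA => /injN/inj.
have Xu : X u.
  apply/(nbhs_singleton nX)/(nbhs_singleton near_phi).
  by rewrite phi0 f0 /D4_model /= !mxE !expr0n !mulr0 !addr0.
apply: (germ_isomorphic_sdiff (sdiff_comp sphi sf') (sdiff_at_comp hM hN') injMN Xu).
by move: nX near_phi; apply: (@filterS2 _ (nbhs u)) => v -> ->.
Qed.
End D4_germ.

(** * The octic and its jets over Z[i, w] *)

(* (a, b, [:: (c1, d1, e1); ..]) stands for x_0^a x_1^b (c1 x_2^d1 x_3^e1 + ..). *)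
Definition octic_rows : seq (nat * nat * seq (Z * nat * nat)) := ([::
   (8, 0, [:: (1%BZ, 0, 0)]);
   (6, 2, [:: ((-6)%BZ, 0, 0)]);
   (6, 1, [:: (60%BZ, 1, 0); (60%BZ, 0, 1)]);
   (6, 0, [:: ((-6)%BZ, 2, 0); (60%BZ, 1, 1); ((-6)%BZ, 0, 2)]);
   (5, 2, [:: ((-2240)%BZ, 1, 0); (2240%BZ, 0, 1)]);
   (5, 1, [:: (2240%BZ, 2, 0); ((-2240)%BZ, 0, 2)]);
   (5, 0, [:: ((-2240)%BZ, 2, 1); (2240%BZ, 1, 2)]);
   (4, 4, [:: ((-14)%BZ, 0, 0)]);
   (4, 3, [:: ((-10180)%BZ, 1, 0); ((-10180)%BZ, 0, 1)]);
   (4, 2, [:: (40412%BZ, 2, 0); ((-23440)%BZ, 1, 1); (40412%BZ, 0, 2)]);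
   (4, 1, [:: ((-10180)%BZ, 3, 0); ((-23440)%BZ, 2, 1); ((-23440)%BZ, 1, 2);
     ((-10180)%BZ, 0, 3)]);
   (4, 0, [:: ((-14)%BZ, 4, 0); ((-10180)%BZ, 3, 1); (40412%BZ, 2, 2); ((-10180)%BZ, 1, 3);
     ((-14)%BZ, 0, 4)]);
   (3, 4, [:: ((-10180)%BZ, 1, 0); (10180%BZ, 0, 1)]);
   (3, 3, [:: (111980%BZ, 2, 0); ((-111980)%BZ, 0, 2)]);
   (3, 2, [:: ((-111980)%BZ, 3, 0); (111980%BZ, 0, 3)]);
   (3, 1, [:: (10180%BZ, 4, 0); ((-10180)%BZ, 0, 4)]);
   (3, 0, [:: ((-10180)%BZ, 4, 1); (111980%BZ, 3, 2); ((-111980)%BZ, 2, 3);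
     (10180%BZ, 1, 4)]);
   (2, 6, [:: ((-6)%BZ, 0, 0)]);
   (2, 5, [:: ((-2240)%BZ, 1, 0); ((-2240)%BZ, 0, 1)]);
   (2, 4, [:: (40412%BZ, 2, 0); (23440%BZ, 1, 1); (40412%BZ, 0, 2)]);
   (2, 3, [:: ((-111980)%BZ, 3, 0); ((-111980)%BZ, 0, 3)]);
   (2, 2, [:: (40412%BZ, 4, 0); (154704%BZ, 2, 2); (40412%BZ, 0, 4)]);
   (2, 1, [:: ((-2240)%BZ, 5, 0); (23440%BZ, 4, 1); (23440%BZ, 1, 4); ((-2240)%BZ, 0, 5)]);
   (2, 0, [:: ((-6)%BZ, 6, 0); ((-2240)%BZ, 5, 1); (40412%BZ, 4, 2); ((-111980)%BZ, 3, 3);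
     (40412%BZ, 2, 4); ((-2240)%BZ, 1, 5); ((-6)%BZ, 0, 6)]);
   (1, 6, [:: (60%BZ, 1, 0); ((-60)%BZ, 0, 1)]);
   (1, 5, [:: (2240%BZ, 2, 0); ((-2240)%BZ, 0, 2)]);
   (1, 4, [:: ((-10180)%BZ, 3, 0); (23440%BZ, 2, 1); ((-23440)%BZ, 1, 2);
     (10180%BZ, 0, 3)]);
   (1, 3, [:: (10180%BZ, 4, 0); ((-10180)%BZ, 0, 4)]);
   (1, 2, [:: ((-2240)%BZ, 5, 0); ((-23440)%BZ, 4, 1); (23440%BZ, 1, 4); (2240%BZ, 0, 5)]);
   (1, 1, [:: ((-60)%BZ, 6, 0); (23440%BZ, 4, 2); ((-23440)%BZ, 2, 4); (60%BZ, 0, 6)]);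
   (1, 0, [:: (60%BZ, 6, 1); (2240%BZ, 5, 2); ((-10180)%BZ, 4, 3); (10180%BZ, 3, 4);
     ((-2240)%BZ, 2, 5); ((-60)%BZ, 1, 6)]);
   (0, 8, [:: (1%BZ, 0, 0)]);
   (0, 6, [:: ((-6)%BZ, 2, 0); ((-60)%BZ, 1, 1); ((-6)%BZ, 0, 2)]);
   (0, 5, [:: (2240%BZ, 2, 1); (2240%BZ, 1, 2)]);
   (0, 4, [:: ((-14)%BZ, 4, 0); (10180%BZ, 3, 1); (40412%BZ, 2, 2); (10180%BZ, 1, 3);
     ((-14)%BZ, 0, 4)]);
   (0, 3, [:: (10180%BZ, 4, 1); (111980%BZ, 3, 2); (111980%BZ, 2, 3); (10180%BZ, 1, 4)]);
   (0, 2, [:: ((-6)%BZ, 6, 0); (2240%BZ, 5, 1); (40412%BZ, 4, 2); (111980%BZ, 3, 3);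
     (40412%BZ, 2, 4); (2240%BZ, 1, 5); ((-6)%BZ, 0, 6)]);
   (0, 1, [:: ((-60)%BZ, 6, 1); (2240%BZ, 5, 2); (10180%BZ, 4, 3); (10180%BZ, 3, 4);
     (2240%BZ, 2, 5); ((-60)%BZ, 1, 6)]);
   (0, 0, [:: (1%BZ, 8, 0); ((-6)%BZ, 6, 2); ((-14)%BZ, 4, 4); ((-6)%BZ, 2, 6);
     (1%BZ, 0, 8)])])%N.

Definition octic_terms : seq (Z * seq nat) :=
  flatten [seq [seq (t.1.1, [:: r.1.1; r.1.2; t.1.2; t.2]) | t <- r.2] | r <- octic_rows].

Section octic.
Variable R : comNzRingType.
Definition Zr (z : Z) : R := (int_of_Z z)%:~R.
Definition octic (x : 'I_4 -> R) : R :=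
  \sum_(m <- octic_terms) Zr m.1 * \prod_(j < 4) x j ^+ nth 0%N m.2 j.

Lemma octic_rowsE (x : 'I_4 -> R) : octic x =
  \sum_(r <- octic_rows) x 0 ^+ r.1.1 * x 1 ^+ r.1.2 *
    \sum_(t <- r.2) Zr t.1.1 * (x 2 ^+ t.1.2 * x 3 ^+ t.2).
Proof.
rewrite /octic /octic_terms big_flatten big_map; apply: eq_bigr => r _.
rewrite big_map big_distrr /=; apply: eq_bigr => t _.
rewrite !big_ord_recl big_ord0 mulr1.
have -> : lift ord0 ord0 = 1 :> 'I_4 by apply: val_inj.
have -> : lift ord0 (lift ord0 ord0) = 2 :> 'I_4 by apply: val_inj.
have -> : lift ord0 (lift ord0 (lift ord0 ord0)) = 3 :> 'I_4 by apply: val_inj.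
by rewrite -[ord0]/(0 : 'I_4) /=; ring.
Qed.

Lemma ZrD a b : Zr (a + b)%BZ = Zr a + Zr b.
Proof. by rewrite /Zr -[(a + b)%BZ]/(a + b)%R rmorphD rmorphD. Qed.
Lemma ZrM a b : Zr (a * b)%BZ = Zr a * Zr b.
Proof. by rewrite /Zr -[(a * b)%BZ]/(a * b)%R rmorphM rmorphM. Qed.
Lemma ZrN a : Zr (- a)%BZ = - Zr a.
Proof. by rewrite /Zr -[(- a)%BZ]/(- a)%R rmorphN rmorphN. Qed.
Lemma ZrB a b : Zr (a - b)%BZ = Zr a - Zr b.
Proof. by rewrite ZrD ZrN. Qed.
Lemma Zr0 : Zr 0 = 0. Proof. by []. Qed.
Lemma Zr1 : Zr 1 = 1. Proof. by []. Qed.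
End octic.

Lemma rmorph_Zr (R S : comNzRingType) (f : {rmorphism R -> S}) z : f (Zr R z) = Zr S z.
Proof. by rewrite rmorph_int. Qed.

Lemma rmorph_octic (R S : comNzRingType) (f : {rmorphism R -> S}) x :
  f (octic x) = octic (f \o x).
Proof.
rewrite rmorph_sum; apply: eq_bigr => m _; rewrite rmorphM rmorph_Zr rmorph_prod.
by congr (_ * _); apply: eq_bigr => j _; rewrite rmorphXn.
Qed.

(* (a, b, c, d) stands for (a + b w) + i (c + d w) in Z[i, w], w^2 + w + 1 = 0. *)
Definition z12 : Type := (Z * Z * Z * Z)%type.
Definition z12_add (x y : z12) : z12 :=
  let: (a, b, c, d) := x in let: (a', b', c', d') := y in
  (a + a', b + b', c + c', d + d')%BZ.
Definition z12_opp (x : z12) : z12 := let: (a, b, c, d) := x in (- a, - b, - c, - d)%BZ.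
Definition z12_mul (x y : z12) : z12 :=
  let: (a, b, c, d) := x in let: (a', b', c', d') := y in
  (a * a' - b * b' - (c * c' - d * d'),
   a * b' + b * a' - b * b' - (c * d' + d * c' - d * d'),
   a * c' - b * d' + (c * a' - d * b'),
   a * d' + b * c' - b * d' + (c * b' + d * a' - d * b'))%BZ.
Definition z12_sub x y := z12_add x (z12_opp y).
Definition z12_int (a : Z) : z12 := (a, 0, 0, 0)%BZ.
Definition z12_conj (x : z12) : z12 := let: (a, b, c, d) := x in (a, b, - c, - d)%BZ.
Definition z12_conjw (x : z12) : z12 := let: (a, b, c, d) := x in (a - b, - b, c - d, - d)%BZ.
(** The product of the three other Galois conjugates of [x]; its product with [x] is the norm, an
    integer. That this integer is nonzero certifies that [x] is nonzero under every evaluation in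
    characteristic 0. *)
Definition z12_conorm x :=
  z12_mul (z12_conj x) (z12_conjw (z12_mul x (z12_conj x))).
Definition z12_neq0 (x : z12) : bool :=
  let: (n, b, c, d) := z12_mul x (z12_conorm x) in
  [&& ~~ (n =? 0)%BZ, (b =? 0)%BZ, (c =? 0)%BZ & (d =? 0)%BZ].
Definition z12_eqb (x y : z12) : bool :=
  let: (a, b, c, d) := x in let: (a', b', c', d') := y in
  [&& (a =? a')%BZ, (b =? b')%BZ, (c =? c')%BZ & (d =? d')%BZ].

Lemma z12_eqbP x y : z12_eqb x y -> x = y.
Proof.
case: x y => [[[a b] c] d] [[[a' b'] c'] d'].
by move=> /and4P[/Z.eqb_eq-> /Z.eqb_eq-> /Z.eqb_eq-> /Z.eqb_eq->].
Qed.

Section z12_eval.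
Variables (C : comNzRingType) (w i : C).
Hypotheses (w2 : w ^+ 2 + w + 1 = 0) (i2 : i ^+ 2 + 1 = 0).
Definition z12_eval (x : z12) : C := let: (a, b, c, d) := x in
  (Zr C a + Zr C b * w) + i * (Zr C c + Zr C d * w).

Lemma z12_evalD x y : z12_eval (z12_add x y) = z12_eval x + z12_eval y.
Proof.
by case: x y => [[[a b] c] d] [[[a' b'] c'] d']; rewrite /= !ZrD; ring.
Qed.
Lemma z12_evalN x : z12_eval (z12_opp x) = - z12_eval x.
Proof. by case: x => [[[a b] c] d]; rewrite /= !ZrN; ring. Qed.
Lemma z12_evalB x y : z12_eval (z12_sub x y) = z12_eval x - z12_eval y.
Proof. by rewrite z12_evalD z12_evalN. Qed.
Lemma z12_evalM x y : z12_eval (z12_mul x y) = z12_eval x * z12_eval y.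
Proof.
case: x y => [[[a b] c] d] [[[a' b'] c'] d'].
rewrite /= !(ZrD, ZrB, ZrM).
move: (Zr C a) (Zr C b) (Zr C c) (Zr C d) => {}a {}b {}c {}d.
move: (Zr C a') (Zr C b') (Zr C c') (Zr C d') => {}a' {}b' {}c' {}d'.
apply/eqP; rewrite -subr_eq0; apply/eqP.
transitivity (- (b * b' + i * (b * d' + d * b') - d * d') * (w ^+ 2 + w + 1)
  - (c + d * w) * (c' + d' * w) * (i ^+ 2 + 1)); first ring.
by rewrite w2 i2 !mulr0 subr0.
Qed.
Lemma z12_eval_int a : z12_eval (z12_int a) = Zr C a.
Proof. by rewrite /= /Zr /=; ring. Qed.
End z12_eval.

Lemma z12_eval_neq0 (C : numFieldType) (w i : C) x :
  w ^+ 2 + w + 1 = 0 -> i ^+ 2 + 1 = 0 -> z12_neq0 x -> z12_eval w i x != 0.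
Proof.
move=> w2 i2 hx; suff : z12_eval w i x * z12_eval w i (z12_conorm x) != 0.
  by apply: contraNneq => ->; rewrite mul0r.
rewrite -z12_evalM //; move: hx; rewrite /z12_neq0.
case: z12_mul => [[[n b] c] d] /and4P[n0 /Z.eqb_eq-> /Z.eqb_eq-> /Z.eqb_eq->].
rewrite /= !Zr0 !mul0r !addr0 mulr0 addr0 /Zr intr_eq0.
by apply: contra n0 => /eqP; rewrite -[0]/(int_of_Z 0) => /(can_inj int_of_ZK)->.
Qed.

(** * Polynomials in s, t, r over Z[i, w], truncated at weight 6 *)

Definition jmono : Type := (nat * nat * nat)%type.
Definition jpoly : Type := seq (jmono * z12).
Definition jmono_mul (m m' : jmono) : jmono :=
  let: (a, b, c) := m in let: (a', b', c') := m' in (a + a', b + b', c + c')%N.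
Definition jmono_eqb (m m' : jmono) : bool :=
  let: (a, b, c) := m in let: (a', b', c') := m' in [&& eqn a a', eqn b b' & eqn c c'].
Definition jweight (m : jmono) : nat := let: (a, b, c) := m in (3 * a + 2 * b + 2 * c)%N.
Fixpoint jinsert (m : jmono) (x : z12) (l : jpoly) : jpoly :=
  if l is (m', x') :: l' then
    if jmono_eqb m m' then (m', z12_add x' x) :: l' else (m', x') :: jinsert m x l'
  else [:: (m, x)].
Definition jadd (l l' : jpoly) : jpoly := foldr (fun t acc => jinsert t.1 t.2 acc) l' l.
Definition jmul_mono (t : jmono * z12) (l acc : jpoly) : jpoly :=
  foldr (fun t' acc => let m := jmono_mul t.1 t'.1 in
    if (jweight m <= 6)%N then jinsert m (z12_mul t.2 t'.2) acc else acc) acc l.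
Definition jmul (l l' : jpoly) : jpoly := foldr (fun t acc => jmul_mono t l' acc) [::] l.
Definition jconst (x : z12) : jpoly := [:: ((0, 0, 0)%N, x)].
Definition jexp (l : jpoly) (n : nat) : jpoly := iter n (jmul l) (jconst (z12_int 1)).
Definition jcoef (m : jmono) (l : jpoly) : z12 :=
  foldr (fun t acc => if jmono_eqb t.1 m then z12_add t.2 acc else acc) (z12_int 0) l.

Definition jpower_products (l l' : jpoly) : seq (seq jpoly) :=
  let powers k := traject (jmul k) (jconst (z12_int 1)) 9 in
  let s := powers l' in [seq [seq jmul p q | q <- s] | p <- powers l].
(* The tables of products are bound by [let] so as to be computed only once. *)
Definition joctic (x : seq jpoly) : jpoly :=
  let s := jpower_products (nth [::] x 0) (nth [::] x 1) in
  let s' := jpower_products (nth [::] x 2) (nth [::] x 3) in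
  let row l := foldr (fun t acc => jadd (jmul (jconst (z12_int t.1.1))
    (nth [::] (nth [::] s' t.1.2) t.2)) acc) [::] l in
  foldr (fun r acc => jadd (jmul (nth [::] (nth [::] s r.1.1) r.1.2) (row r.2)) acc)
    [::] octic_rows.

(** Cancelled terms stay in the list with coefficient 0, hence the last alternative. The cross terms
    t^2 r and t r^2 must vanish too: the basis at each point diagonalises the cubic. *)
Definition D4_check (l : jpoly) : bool :=
  [&& all (fun t => [|| jmono_eqb t.1 (2, 0, 0)%N, jmono_eqb t.1 (0, 3, 0)%N,
                     jmono_eqb t.1 (0, 0, 3)%N | z12_eqb t.2 (z12_int 0)]) l,
      z12_neq0 (jcoef (2, 0, 0)%N l), z12_neq0 (jcoef (0, 3, 0)%N l) &
      z12_neq0 (jcoef (0, 0, 3)%N l)].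

Section jets.
Variable R : realType.
Local Notation C := R[i].
Local Notation V := 'rV[C]_3.

Definition omega : C := (sqrtc (- 3) - 1) / 2.
Lemma omega2 : omega ^+ 2 + omega + 1 = 0.
Proof.
have e : sqrtc (- 3 : C) ^+ 2 = - 3 by rewrite sqr_sqrtc.
transitivity ((sqrtc (- 3 : C) ^+ 2 + 3) / 4); first by rewrite /omega; field.
by rewrite e addNr mul0r.
Qed.
Lemma complexi2 : ('i%C : C) ^+ 2 + 1 = 0.
Proof. by rewrite sqr_i addNr. Qed.
Definition zev : z12 -> C := z12_eval omega 'i%C.
Lemma zevM x y : zev (z12_mul x y) = zev x * zev y.
Proof. exact: z12_evalM omega2 complexi2 _ _. Qed.
Lemma zevD x y : zev (z12_add x y) = zev x + zev y.
Proof. exact: z12_evalD. Qed.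
Lemma zev_neq0 x : z12_neq0 x -> zev x != 0.
Proof. exact: z12_eval_neq0 omega2 complexi2. Qed.
Lemma zev_int a : zev (z12_int a) = Zr _ a.
Proof. exact: z12_eval_int. Qed.
Lemma zev0 : zev (z12_int 0) = 0. Proof. by rewrite zev_int. Qed.

Definition jmono_eval (m : jmono) (v : V) : C :=
  let: (a, b, c) := m in v 0 0 ^+ a * v 0 1 ^+ b * v 0 2 ^+ c.
Definition jeval (l : jpoly) (v : V) : C := \sum_(t <- l) zev t.2 * jmono_eval t.1 v.

Lemma jmono_evalM m m' v : jmono_eval (jmono_mul m m') v = jmono_eval m v * jmono_eval m' v.
Proof. by case: m m' => [[a b] c] [[a' b'] c'] /=; rewrite !exprD; ring. Qed.

Lemma jmono_eqbP m m' : jmono_eqb m m' -> m = m'.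
Proof. by case: m m' => [[a b] c] [[a' b'] c'] /and3P[/eqP-> /eqP-> /eqP->]. Qed.

Lemma jeval_nil v : jeval [::] v = 0.
Proof. by rewrite /jeval big_nil. Qed.

Lemma jeval_cons t l v : jeval (t :: l) v = zev t.2 * jmono_eval t.1 v + jeval l v.
Proof. by rewrite /jeval big_cons. Qed.

Lemma jeval_insert m x l v : jeval (jinsert m x l) v = zev x * jmono_eval m v + jeval l v.
Proof.
elim: l => [|[m' x'] l IH] /=; first by rewrite jeval_cons jeval_nil.
case: ifP => [/jmono_eqbP->|_]; rewrite !jeval_cons /=; first by rewrite zevD; ring.
by rewrite IH; ring.
Qed.

Lemma jevalD l l' v : jeval (jadd l l') v = jeval l v + jeval l' v.
Proof.
elim: l => [|t l IH] /=; first by rewrite jeval_nil add0r.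
by rewrite jeval_insert IH jeval_cons; ring.
Qed.

(** The ideal generated by the monomials of weight above 6 among the functions strictly
    differentiable near 0. Remainders are tracked by membership rather than by growth, because the
    normal form needs them as explicit multiples of monomials. *)
Inductive higher_order : (V -> C) -> Prop :=
| higher_order0 : higher_order (fun=> 0)
| higher_order_mono m g : (6 < jweight m)%N -> sdiff1 g 0 ->
    higher_order (fun v => g v * jmono_eval m v)
| higher_orderD f g : higher_order f -> higher_order g ->
    higher_order (fun v => f v + g v).

Lemma sdiff1_jmono m x : sdiff1 (jmono_eval m) x.
Proof.
case: m => [[a b] c]; have sc j := sdiff1_coord j x.
exact: sdiff1M (sdiff1M (sdiff1X a (sc 0)) (sdiff1X b (sc 1))) (sdiff1X c (sc 2)).
Qed.

Lemma sdiff1_jeval l x : sdiff1 (jeval l) x.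
Proof.
rewrite (_ : jeval l = fun v => \sum_(t <- l) zev t.2 * jmono_eval t.1 v) //.
elim: l => [|t l IH]; first by under eq_fun do rewrite big_nil; exact: sdiff1_cst.
under eq_fun do rewrite big_cons; apply: sdiff1D IH.
exact: sdiff1M (sdiff1_cst _ _) (sdiff1_jmono _ _).
Qed.

Lemma higher_order_sdiff1 f : higher_order f -> sdiff1 f 0.
Proof.
elim=> [|m g _ sg|f' g _ sf _ sg]; first exact: sdiff1_cst.
  exact: sdiff1M sg (sdiff1_jmono _ _).
exact: sdiff1D.
Qed.

Lemma higher_orderM f g : higher_order f -> sdiff1 g 0 ->
  higher_order (fun v => g v * f v).
Proof.
move=> hf sg; elim: hf => [|m h hm sh|f1 f2 _ h1 _ h2].
- by under eq_fun do rewrite mulr0; exact: higher_order0.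
- by under eq_fun do rewrite mulrA; apply: higher_order_mono => //; apply: sdiff1M.
- by under eq_fun do rewrite mulrDr; apply: higher_orderD.
Qed.

Definition has_jet (h : V -> C) (l : jpoly) :=
  exists2 f, higher_order f & forall v, h v = jeval l v + f v.

Lemma has_jetD h h' l l' : has_jet h l -> has_jet h' l' ->
  has_jet (fun v => h v + h' v) (jadd l l').
Proof.
move=> [f hf e] [f' hf' e']; exists (fun v => f v + f' v); first exact: higher_orderD.
by move=> v; rewrite e e' jevalD; ring.
Qed.

Lemma has_jet_const x : has_jet (fun=> zev x) (jconst x).
Proof.
exists (fun=> 0); first exact: higher_order0.
by move=> v; rewrite jeval_cons jeval_nil /= !expr0 !mulr1 !addr0.
Qed.

Lemma jeval_mul_mono t l acc : exists2 f, higher_order f & forall v,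
  zev t.2 * jmono_eval t.1 v * jeval l v + jeval acc v = jeval (jmul_mono t l acc) v + f v.
Proof.
elim: l => [|t' l [f hf IH]].
  by exists (fun=> 0); [exact: higher_order0|move=> v; rewrite jeval_nil mulr0 add0r addr0].
have E v : zev t.2 * jmono_eval t.1 v * jeval (t' :: l) v + jeval acc v =
    zev (z12_mul t.2 t'.2) * jmono_eval (jmono_mul t.1 t'.1) v +
    (jeval (jmul_mono t l acc) v + f v).
  by rewrite -IH jeval_cons zevM jmono_evalM; ring.
rewrite /jmul_mono /= -/(jmul_mono t l acc); case: leqP => hw.
  by exists f => // v; rewrite E jeval_insert addrA.
exists (fun v => zev (z12_mul t.2 t'.2) * jmono_eval (jmono_mul t.1 t'.1) v + f v).
  by apply: higher_orderD => //; apply: higher_order_mono => //; apply: sdiff1_cst.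
by move=> v; rewrite E; ring.
Qed.

Lemma has_jetM h h' l l' : has_jet h l -> has_jet h' l' ->
  has_jet (fun v => h v * h' v) (jmul l l').
Proof.
move=> [f hf e] [f' hf' e'].
have [g hg E] : exists2 g, higher_order g & forall v,
    jeval l v * jeval l' v = jeval (jmul l l') v + g v.
  elim: l {e} => [|t l [g hg IH]].
    by exists (fun=> 0); [exact: higher_order0|move=> v; rewrite jeval_nil mul0r addr0].
  have [g' hg' E] := jeval_mul_mono t l' (jmul l l').
  exists (fun v => g v + g' v); first exact: higher_orderD.
  move=> v; have := E v; rewrite [jeval (jmul (t :: l) l') v]/= => E'.
  by rewrite jeval_cons mulrDl IH addrA E' -addrA; congr (_ + _); rewrite addrC.
exists (fun v => g v + (jeval l v * f' v + h' v * f v)).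
  apply: higher_orderD => //; apply: higher_orderD; apply: higher_orderM => //.
    exact: sdiff1_jeval.
  have -> : h' = fun v => jeval l' v + f' v by apply/funext.
  by apply: sdiff1D; [exact: sdiff1_jeval|exact: higher_order_sdiff1].
by move=> v; rewrite [in RHS]e' e addrA -E e'; ring.
Qed.

Lemma has_jetX h l n : has_jet h l -> has_jet (fun v => h v ^+ n) (jexp l n).
Proof.
move=> hl; elim: n => [|n IH].
  have -> : (fun v => h v ^+ 0) = fun=> zev (z12_int 1).
    by apply/funext => v; rewrite zev_int Zr1 expr0.
  exact: has_jet_const.
by under eq_fun do rewrite exprS; exact: has_jetM.
Qed.

Lemma has_jet_power_product h h' l l' a b : has_jet h l -> has_jet h' l' ->
  (a < 9)%N -> (b < 9)%N ->
  has_jet (fun v => h v ^+ a * h' v ^+ b) (nth [::] (nth [::] (jpower_products l l') a) b).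
Proof.
move=> hl hl' a9 b9; rewrite /jpower_products (nth_map [::]) ?size_traject //.
rewrite (nth_map [::]) ?size_traject //.
rewrite !(set_nth_default (jconst (z12_int 1)) [::]) ?size_traject // !nth_traject //.
by apply: has_jetM; apply: has_jetX.
Qed.

Lemma has_jet_sum (T : Type) (s : seq T) (f : T -> V -> C) (F : T -> jpoly) (P : pred T) :
  (forall t, P t -> has_jet (f t) (F t)) -> all P s ->
  has_jet (fun v => \sum_(t <- s) f t v) (foldr (fun t acc => jadd (F t) acc) [::] s).
Proof.
move=> h; elim: s => [_|t s IH /= /andP[Pt /IH{}IH]].
  under eq_fun do rewrite big_nil; exists (fun=> 0); first exact: higher_order0.
  by move=> v; rewrite jeval_nil addr0.
by under eq_fun do rewrite big_cons; apply: has_jetD IH; apply: h.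
Qed.

Lemma has_jet_octic (x : 'I_4 -> V -> C) (l : seq jpoly) :
  (forall j : 'I_4, has_jet (x j) (nth [::] l j)) ->
  has_jet (fun v => octic (fun j => x j v)) (joctic l).
Proof.
move=> H; under eq_fun do rewrite octic_rowsE.
(* The predicate keeps exponents within the 9 entries of the power tables, so that [nth] never
   returns its default. *)
apply: (@has_jet_sum _ _ _ _ (fun r => [&& (r.1.1 < 9)%N, (r.1.2 < 9)%N &
    all (fun t : Z * nat * nat => (t.1.2 < 9)%N && (t.2 < 9)%N) r.2])); last by vm_compute.
move=> r /and3P[a9 b9 ok].
apply: has_jetM; first exact: (has_jet_power_product (H 0) (H 1)).
apply: has_jet_sum ok => t /andP[c9 d9]; apply: has_jetM.
  by under eq_fun do rewrite -zev_int; exact: has_jet_const.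
exact: (has_jet_power_product (H 2) (H 3)).
Qed.

Definition D4_monomials : seq jmono := [:: (2, 0, 0); (1, 2, 0); (1, 1, 1); (1, 0, 2);
  (0, 3, 0); (0, 2, 1); (0, 1, 2); (0, 0, 3)]%N.

Lemma D4_monomials_dvd m : (6 < jweight m)%N ->
  exists (i : 'I_8) m', m = jmono_mul m' (nth (0, 0, 0)%N D4_monomials i).
Proof.
have D (i : nat) a b c : (i < 8)%N ->
    m = jmono_mul (a, b, c) (nth (0, 0, 0)%N D4_monomials i) ->
    exists (i' : 'I_8) m', m = jmono_mul m' (nth (0, 0, 0)%N D4_monomials i').
  by move=> Hi e; exists (Ordinal Hi), (a, b, c).
case: m D => [[[|[|a]] b] c] D /= hw.
- case: b hw D => [|[|[|b]]] hw D.
  + by apply: (D 7 0 0 (c - 3))%N => //; congr (_, _, _); lia.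
  + by apply: (D 6 0 0 (c - 2))%N => //; congr (_, _, _); lia.
  + by apply: (D 5 0 0 (c - 1))%N => //; congr (_, _, _); lia.
  + by apply: (D 4 0 b c)%N => //; congr (_, _, _); lia.
- case: b hw D => [|[|b]] hw D.
  + by apply: (D 3 0 0 (c - 2))%N => //; congr (_, _, _); lia.
  + by apply: (D 2 0 0 (c - 1))%N => //; congr (_, _, _); lia.
  + by apply: (D 1 0 b c)%N => //; congr (_, _, _); lia.
- by apply: (D 0 a b c)%N => //; congr (_, _, _); lia.
Qed.

Lemma jmono_eval0 m : (0 < jweight m)%N -> jmono_eval m 0 = 0.
Proof.
case: m => [[a b] c] /=; rewrite !mxE !expr0n.
by case: a b c => [|a] [|b] [|c]; rewrite ?mulr0 ?mul0r.
Qed.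

(** A cofactor of a monomial of weight 6 has positive weight, hence vanishes at 0: remainders do not
    disturb the values there of the coefficients of s^2 and of the cubic. *)
Lemma higher_order_normal f : higher_order f -> exists F : 'I_8 -> V -> C,
  [/\ forall i, sdiff1 (F i) 0,
      forall i : 'I_8, jweight (nth (0, 0, 0)%N D4_monomials i) = 6 -> F i 0 = 0 &
      forall v, f v = \sum_i F i v * jmono_eval (nth (0, 0, 0)%N D4_monomials i) v].
Proof.
elim=> [|m g wm sg|f1 f2 _ [F1 [s1 z1 e1]] _ [F2 [s2 z2 e2]]].
- exists (fun _ _ => 0); split => // [i|v]; first exact: sdiff1_cst.
  by rewrite big1 // => i _; rewrite mul0r.
- have [i [m' em]] := D4_monomials_dvd wm.
  exists (fun i' v => if i' == i then g v * jmono_eval m' v else 0); split.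
  + move=> i'; case: (i' == i); last exact: sdiff1_cst.
    exact: sdiff1M sg (sdiff1_jmono _ _).
  + move=> i'; case: (i' =P i) => // -> w6; rewrite jmono_eval0 ?mulr0 //.
    move: wm w6; rewrite em; case: m' {em} => [[a b] c].
    by case: (nth _ _ _) => [[a' b'] c'] /=; lia.
  + move=> v; rewrite (bigD1 i) //= eqxx big1 => [|i' /negPf->]; last by rewrite mul0r.
    by rewrite addr0 em jmono_evalM mulrA.
- exists (fun i v => F1 i v + F2 i v); split.
  + by move=> i; apply: sdiff1D.
  + by move=> i hi; rewrite z1 // z2 // addr0.
  + by move=> v; rewrite e1 e2 -big_split; apply: eq_bigr => i _; rewrite mulrDl.
Qed.

Lemma D4_form_of_jet h l : has_jet h l -> D4_check l -> D4_form h.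
Proof.
move=> [f /higher_order_normal[F [sF zF eF]] eh] /and4P[al n1 n2 n3].
pose a := zev (jcoef (2, 0, 0)%N l); pose b := zev (jcoef (0, 3, 0)%N l).
pose c := zev (jcoef (0, 0, 3)%N l).
have el v : jeval l v = a * v 0 0 ^+ 2 + b * v 0 1 ^+ 3 + c * v 0 2 ^+ 3.
  rewrite /a /b /c; elim: l al {eh n1 n2 n3 a b c} => [_|[m x] l IH /= /andP[hm /IH{}IH]].
    by rewrite jeval_nil !zev0; ring.
  rewrite jeval_cons IH /=.
  case: ifP hm => [/jmono_eqbP-> _|_ /=]; first by rewrite /= zevD; ring.
  case: ifP => [/jmono_eqbP-> _|_ /=]; first by rewrite /= zevD; ring.
  case: ifP => [/jmono_eqbP-> _|_ /=]; first by rewrite /= zevD; ring.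
  by move=> /z12_eqbP->; rewrite zev0; ring.
have sAdd x i : sdiff1 (fun v => x + F i v) 0 := sdiff1D (sdiff1_cst _ _) (sF i).
exists (fun v => a + F 0 v), (F 1), (F 2), (F 3), (fun v => b + F 4 v), (F 5), (F 6),
  (fun v => c + F 7 v); split => //.
- by rewrite zF // addr0 zev_neq0.
- by rewrite !zF // !addr0 !zev_neq0.
- move=> v /=; rewrite eh el eF.
  rewrite !big_ord_recl big_ord0 /=.
  have E (i j : 'I_8) : val i = val j -> F i v = F j v by move=> /val_inj->.
  rewrite -(E 0 ord0) // -(E 1 (lift ord0 ord0)) //.
  rewrite -(E 2 (lift ord0 (lift ord0 ord0))) //.
  rewrite -(E 3 (lift ord0 (lift ord0 (lift ord0 ord0)))) //.
  rewrite -(E 4 (lift ord0 (lift ord0 (lift ord0 (lift ord0 ord0))))) //.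
  rewrite -(E 5 (lift ord0 (lift ord0 (lift ord0 (lift ord0 (lift ord0 ord0)))))) //.
  rewrite -(E 6 (lift ord0 (lift ord0 (lift ord0 (lift ord0 (lift ord0 (lift ord0 ord0))))))) //.
  rewrite -(E 7 (lift ord0 (lift ord0 (lift ord0 (lift ord0 (lift ord0 (lift ord0 (lift ord0
    ord0)))))))) //.
  by rewrite !expr0 !expr1; ring.
Qed.
End jets.

(** * Singular points of the octic and of its pullbacks *)

Definition z12_0 : z12 := z12_int 0.
Definition z12_is0 (x : z12) := z12_eqb x z12_0.

(* (i, p, [:: v1; v2; v3]): the point p of the octic, normalised by p_i = 1, and
   a basis of the hyperplane x_i = 0 adapted to the D4 singularity. *)
Definition point_data : Type := (nat * seq z12 * seq (seq z12))%type.

(** One representative for each orbit of the symmetries below. The coordinates are cubes of those of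
    D4 points of F_3: writing q for -i (1 + 2 w), a square root of 3, the first point is (1 : -1 :
    q^3 : 1) and the fourth is (1 : (q - 2)^3 : (q - 1)^3 : 0). *)
Definition base_points : seq point_data :=
  [:: (0%N, [:: (1, 0, 0, 0); (-1, 0, 0, 0); (0, 0, -3, -6); (1, 0, 0, 0)],
    [:: [:: (0, 0, 0, 0); (1, 0, 0, 0); (0, 0, 0, 0); (0, 0, 0, 0)];
       [:: (0, 0, 0, 0); (1, 0, 0, 0); (0, 0, 0, 3); (-1, -1, 0, 0)];
       [:: (0, 0, 0, 0); (0, 1, 0, 0); (0, 0, -3, 0); (-1, -1, 0, 0)]]);
   (0%N, [:: (1, 0, 0, 0); (-2, 0, -2, 0); (2, 0, -2, 0); (0, 0, 1, 0)],
    [:: [:: (0, 0, 0, 0); (1, 0, 0, 0); (0, 0, 0, 0); (0, 0, 0, 0)];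
       [:: (0, 0, 0, 0); (2, 0, 0, 0); (1, 0, 3, 0); (0, 0, -1, 0)];
       [:: (0, 0, 0, 0); (1, 0, -3, 0); (2, 0, 0, 0); (0, 0, 1, 0)]]);
   (0%N, [:: (1, 0, 0, 0); (-4, -3, -1, 3); (0, 0, -1, 0); (4, 3, -1, 3)],
    [:: [:: (0, 0, 0, 0); (1, 0, 0, 0); (0, 0, 0, 0); (0, 0, 0, 0)];
       [:: (0, 0, 0, 0); (10, -1, -7, -12); (0, 1, 0, 0); (1, 2, -2, 0)];
       [:: (0, 0, 0, 0); (1, 2, 2, 0); (0, 1, 0, 0); (10, -1, 7, 12)]]);
   (0%N, [:: (1, 0, 0, 0); (-26, 0, -15, -30); (-10, 0, -6, -12); (0, 0, 0, 0)],
    [:: [:: (0, 0, 0, 0); (1, 0, 0, 0); (0, 0, 0, 0); (0, 0, 0, 0)];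
       [:: (0, 0, 0, 0); (1, 2, -2, 0); (1, 2, 1, 0); (0, 0, 0, 0)];
       [:: (0, 0, 0, 0); (0, 0, 0, 0); (0, 0, 0, 0); (1, 0, 0, 0)]]);
   (0%N, [:: (1, 0, 0, 0); (0, 0, -1, 0); (0, 0, 0, 0); (0, 0, 0, 0)],
    [:: [:: (0, 0, 0, 0); (1, 0, 0, 0); (0, 0, 0, 0); (0, 0, 0, 0)];
       [:: (0, 0, 0, 0); (0, 0, 0, 0); (1, 0, 0, 0); (0, 0, 0, 0)];
       [:: (0, 0, 0, 0); (0, 0, 0, 0); (0, 0, 0, 0); (1, 0, 0, 0)]])]%BZ.

Definition same_point (d e : point_data) : bool :=
  all (fun i => all (fun j => z12_eqb
      (z12_mul (nth z12_0 d.1.2 i) (nth z12_0 e.1.2 j))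
      (z12_mul (nth z12_0 d.1.2 j) (nth z12_0 e.1.2 i))) (iota 0 4)) (iota 0 4).

Definition signed_permute (g : seq nat * seq Z) (x : seq z12) : seq z12 :=
  [seq z12_mul (z12_int (nth 0%BZ g.2 j)) (nth z12_0 x (nth 0%N g.1 j)) | j <- iota 0 4].
(** The coordinate 1 lands at index [j] with a sign; multiplying the point by this sign again
    restores the normalisation. A common sign of the basis vectors is harmless. *)
Definition act_point (g : seq nat * seq Z) (d : point_data) : point_data :=
  let: (i, p, V) := d in let j := index i g.1 in
  (j, [seq z12_mul (z12_int (nth 0%BZ g.2 j)) x | x <- signed_permute g p],
   [seq signed_permute g v | v <- V]).
Definition conj_point (d : point_data) : point_data :=
  let: (i, p, V) := d in (i, map z12_conj p, map (map z12_conj) V).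
(* Together with the conjugation i |-> - i these generate a group of symmetries
   of the octic. *)
Definition generators : seq (seq nat * seq Z) :=
  [:: ([:: 0; 1; 3; 2]%N, [:: 1; -1; -1; -1]%BZ);
      ([:: 0; 2; 3; 1]%N, [:: 1; 1; 1; 1]%BZ);
      ([:: 1; 0; 2; 3]%N, [:: 1; 1; 1; -1]%BZ)].

Definition add_point (d : point_data) (l : seq point_data) :=
  if has (same_point d) l then l else d :: l.
Definition orbit_step (l : seq point_data) :=
  foldr add_point l (flatten ([seq conj_point d | d <- l]
    :: [seq [seq act_point g d | d <- l] | g <- generators])).
(** Symmetry only produces candidates: [point_ok] certifies each of them and [distinct_points]
    separates them, both by computation. Six rounds reach the counts stated at the end. *)
Definition octic_points : seq point_data :=
  flatten [seq iter 6 orbit_step [:: d] | d <- base_points].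

(* Over a coordinate plane only the pullback by x |-> x^3 is singular of type D4,
   so a coordinate vanishing at the point enters through its cube. *)
Definition jcoord (d : point_data) (j : nat) : jpoly :=
  let p := nth z12_0 d.1.2 j in let v a := nth z12_0 (nth [::] d.2 a) j in
  let l := [seq t <- [:: ((0, 0, 0)%N, p); ((1, 0, 0)%N, v 0%N); ((0, 1, 0)%N, v 1%N);
    ((0, 0, 1)%N, v 2)] | ~~ z12_is0 t.2] in
  if z12_is0 p then jexp l 3 else l.

Definition z12_det3 (m : nat -> nat -> z12) : z12 :=
  let cross i j := z12_sub (z12_mul (m 1%N i) (m 2 j)) (z12_mul (m 1%N j) (m 2 i)) in
  z12_add (z12_mul (m 0%N 0%N) (cross 1%N 2))
    (z12_add (z12_mul (m 0%N 1%N) (cross 2 0%N)) (z12_mul (m 0%N 2) (cross 0%N 1%N))).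

Definition point_ok (d : point_data) : bool :=
  [&& all (fun j => z12_is0 (nth z12_0 d.1.2 j) || z12_neq0 (nth z12_0 d.1.2 j)) (iota 0 4),
      z12_eqb (nth z12_0 d.1.2 d.1.1) (z12_int 1),
      all (fun a => z12_is0 (nth z12_0 (nth [::] d.2 a) d.1.1)) (iota 0 3),
      z12_neq0 (z12_det3 (fun a k => nth z12_0 (nth [::] d.2 a) (bump d.1.1 k))) &
      D4_check (joctic [seq jcoord d j | j <- iota 0 4])].

Definition octic_pullback (K : comNzRingType) (k : nat) : mpoly 4 K :=
  octic (fun j => (mpolyX K (mnm1 j)) ^+ k).

Lemma meval_octic_pullback (K : comNzRingType) k (v : 'I_4 -> K) :
  meval v (octic_pullback K k) = octic (fun j => v j ^+ k).
Proof.
rewrite /octic_pullback rmorph_octic; congr octic; apply/funext => j.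
by rewrite /= rmorphXn /= mevalXU.
Qed.

Section octic_point_germ.
Variable R : realType.
Local Notation C := R[i].
Local Notation V := 'rV[C]_3.

Lemma sdiff_at_affine n m (c : 'rV[C]_n) (W : 'M[C]_(n, m)) x :
  sdiff_at (fun y => (y - c) *m W) x W.
Proof.
move=> e e0; exists 1 => // u v _ _.
rewrite -[(u - c) *m W - _]mulmxBl opprB addrA subrK subrr norm10.
by rewrite mulr_ge0 ?norm1_ge0 // ltW.
Qed.

(** Cramer's rule, with the determinant bracketed as in [z12_det3]. *)
Lemma unitmx3 (N : 'M[C]_3) :
  N 0 0 * (N 1 1 * N 2 2 - N 1 2 * N 2 1) + (N 0 1 * (N 1 2 * N 2 0 - N 1 0 * N 2 2) +
  N 0 2 * (N 1 0 * N 2 1 - N 1 1 * N 2 0)) != 0 -> N \in unitmx.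
Proof.
set d := (X in X != 0) => d0; rewrite -row_free_unit; apply: inj_row_free => h hN.
have e m : h 0 0 * N 0 m + h 0 1 * N 1 m + h 0 2 * N 2 m = 0.
  have := congr1 (fun A : V => A 0 m) hN; rewrite !mxE !big_ord_recl big_ord0 addr0 addrA.
  have -> : lift ord0 ord0 = 1 :> 'I_3 by apply: val_inj.
  by have -> : lift ord0 (lift ord0 ord0) = 2 :> 'I_3 by apply: val_inj.
have z (x : C) : x * d = 0 -> x = 0 by move/eqP; rewrite mulf_eq0 (negPf d0) orbF => /eqP.
have h0 : h 0 0 = 0.
  apply: z; transitivity (
    (h 0 0 * N 0 0 + h 0 1 * N 1 0 + h 0 2 * N 2 0) * (N 1 1 * N 2 2 - N 1 2 * N 2 1) +
    (h 0 0 * N 0 1 + h 0 1 * N 1 1 + h 0 2 * N 2 1) * (N 1 2 * N 2 0 - N 1 0 * N 2 2) +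
    (h 0 0 * N 0 2 + h 0 1 * N 1 2 + h 0 2 * N 2 2) * (N 1 0 * N 2 1 - N 1 1 * N 2 0)).
    by rewrite /d; ring.
  by rewrite !e !mul0r !addr0.
have h1 : h 0 1 = 0.
  apply: z; transitivity (
    (h 0 0 * N 0 0 + h 0 1 * N 1 0 + h 0 2 * N 2 0) * (N 2 1 * N 0 2 - N 2 2 * N 0 1) +
    (h 0 0 * N 0 1 + h 0 1 * N 1 1 + h 0 2 * N 2 1) * (N 2 2 * N 0 0 - N 2 0 * N 0 2) +
    (h 0 0 * N 0 2 + h 0 1 * N 1 2 + h 0 2 * N 2 2) * (N 2 0 * N 0 1 - N 2 1 * N 0 0)).
    by rewrite /d; ring.
  by rewrite !e !mul0r !addr0.
have h2 : h 0 2 = 0.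
  apply: z; transitivity (
    (h 0 0 * N 0 0 + h 0 1 * N 1 0 + h 0 2 * N 2 0) * (N 0 1 * N 1 2 - N 0 2 * N 1 1) +
    (h 0 0 * N 0 1 + h 0 1 * N 1 1 + h 0 2 * N 2 1) * (N 0 2 * N 1 0 - N 0 0 * N 1 2) +
    (h 0 0 * N 0 2 + h 0 1 * N 1 2 + h 0 2 * N 2 2) * (N 0 0 * N 1 1 - N 0 1 * N 1 0)).
    by rewrite /d; ring.
  by rewrite !e !mul0r !addr0.
apply: row_nth_inj => -[[|[|[|//]]] ?].
- by rewrite -[RHS]h0; congr (h 0 _); apply: val_inj.
- by rewrite -[RHS]h1; congr (h 0 _); apply: val_inj.
- by rewrite -[RHS]h2; congr (h 0 _); apply: val_inj.
Qed.

Lemma has_jet_jcoord d (j : nat) :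
  let p := zev R (nth z12_0 d.1.2 j) in
  let v a := zev R (nth z12_0 (nth [::] d.2 a) j) in
  has_jet (fun x : V => (p + (x 0 0 * v 0%N + (x 0 1 * v 1%N + x 0 2 * v 2))) ^+
      (if z12_is0 (nth z12_0 d.1.2 j) then 3 else 1)) (jcoord d j).
Proof.
move=> p v; rewrite /jcoord.
set l := (X in jexp X 3).
have hl : has_jet (fun x : V => p + (x 0 0 * v 0%N + (x 0 1 * v 1%N + x 0 2 * v 2))) l.
  exists (fun=> 0); first exact: higher_order0.
  have jf k y : jeval [seq t <- k | ~~ z12_is0 t.2] y = jeval k y :> C.
    elim: k => [|t k IH] //=; rewrite jeval_cons -IH; case: ifP => [_|/negbFE/z12_eqbP->].
      by rewrite jeval_cons.
    by rewrite zev0 mul0r add0r.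
  move=> x; rewrite /l jf !jeval_cons jeval_nil /= -/p -/(v 0%N) -/(v 1%N) -/(v 2).
  by rewrite !expr0 !expr1; ring.
case: z12_is0; first exact: has_jetX.
by under eq_fun do rewrite expr1.
Qed.

(** The coordinate change [phi] raises the nonvanishing affine coordinates to the power k, keeps the
    vanishing ones, and expresses the result in the basis at the point. The powers are unramified
    since the coordinates are nonzero; for a vanishing coordinate the power is already the cube in
    [jcoord], whence k = 3. The equation of the pullback is then exactly [h (phi x)]. *)
Lemma octic_point_germ (d : point_data) k (i : 'I_4) (u : V) :
  point_ok d -> (0 < k)%N -> (forall j : 'I_4, z12_is0 (nth z12_0 d.1.2 j) -> k = 3) ->
  d.1.1 = i ->
  (forall m : 'I_3, if z12_is0 (nth z12_0 d.1.2 (lift i m)) then u 0 m = 0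
     else u 0 m ^+ k = zev R (nth z12_0 d.1.2 (lift i m))) ->
  germ_isomorphic (affine_part (octic_pullback C k) i) u (D4_model C) 0.
Proof.
move=> /and5P[/allP pn0 /z12_eqbP p1 /allP v0 det0 chk] k0 k3 di hu.
rewrite di in p1 v0 det0.
pose p j := zev R (nth z12_0 d.1.2 j).
pose v a j := zev R (nth z12_0 (nth [::] d.2 a) j).
pose e j := if z12_is0 (nth z12_0 d.1.2 j) then 3 else 1%N.
have pi : p i = 1 by rewrite /p p1 zev_int Zr1.
have vi a : (a < 3)%N -> v a i = 0.
  by move=> ha; rewrite /v (z12_eqbP (v0 a _)) ?zev0 // mem_iota.
pose N : 'M[C]_3 := \matrix_(a, m) v a (lift i m).
have Nu : N \in unitmx.
  apply: unitmx3; rewrite !mxE; move: (zev_neq0 R det0).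
  have zevB x z : zev R (z12_sub x z) = zev R x - zev R z by exact: z12_evalB.
  by rewrite /z12_det3 !(zevD, zevM, zevB).
pose X (j : 'I_4) (x : V) := (p j + (x 0 0 * v 0%N j + (x 0 1 * v 1%N j + x 0 2 * v 2 j))) ^+ e j.
pose h x := octic (fun j => X j x).
have D4h : D4_form h.
  apply: D4_form_of_jet chk; apply: has_jet_octic => j.
  rewrite (nth_map 0%N) ?size_iota ?nth_iota ?add0n //; exact: has_jet_jcoord.
pose ex m := if z12_is0 (nth z12_0 d.1.2 (lift i m)) then 1%N else k.
pose y (x : V) : V := \row_m x 0 m ^+ ex m.
pose c : V := \row_m p (lift i m).
pose phi x := (y x - c) *m invmx N.
have yu : y u = c.
  apply/rowP => m; rewrite !mxE /ex /p; have := hu m.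
  by case: ifP => [/z12_eqbP-> ->|_ ->//]; rewrite expr1 zev0.
have sy : sdiff y u.
  apply: sdiff_row => m; under [X in sdiff1 X]eq_fun do rewrite mxE.
  exact: sdiff1X (sdiff1_coord _ _).
have saff z : sdiff (fun x : V => (x - c) *m invmx N) z.
  by apply: (@nearW _ (nbhs z)) => t; exists (invmx N); apply: sdiff_at_affine.
have hy m : has_differential (fun x => y x 0 m) u
    (fun h => (ex m)%:R * u 0 m ^+ (ex m).-1 * h 0 m).
  under [X in has_differential X]eq_fun do rewrite mxE.
  exact: has_differentialX (has_differential_coord _ _).
have [M hM ML] := has_differential_row hy.
have inj (x : V) : x *m (M *m invmx N) = 0 -> x = 0.
  move=> hx; apply: row_nth_inj => m.
  have {}hx : x *m M = 0 by rewrite -[x *m M](mulmxKV Nu) -[x *m M *m _]mulmxA hx mul0mx.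
  have := ML x m; rewrite hx mxE => /esym/eqP; rewrite !mulf_eq0 => /orP[|/eqP//].
  rewrite pnatr_eq0 /ex; have := hu m; have := pn0 (lift i m).
  rewrite mem_iota ltn_ord => /(_ isT).
  case: ifP => [_ _ _|n0 /(zev_neq0 R) nz hm]; first by rewrite /= ?expr0 ?oner_eq0.
  rewrite eqn0Ngt k0 /= expf_eq0 => /andP[_ /eqP um].
  by move: nz; rewrite -hm um expr0n (gtn_eqF k0) eqxx.
have phi0 : phi u = 0 by rewrite /phi yu subrr mul0mx.
have sphi : sdiff phi u := sdiff_comp sy (saff _).
have hphi : sdiff_at phi u (M *m invmx N) := sdiff_at_comp hM (sdiff_at_affine _ _ _).
refine (@D4_form_germ R h phi u _ (affine_part (octic_pullback C k) i) D4h sphi hphi inj phi0 _).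
apply: (@nearW _ (nbhs u)) => x; rewrite /affine_part /= meval_octic_pullback /h.
suff -> : (fun j => X j (phi x)) = fun j => affine_chart i x 0 j ^+ k by [].
apply/funext => j; rewrite /X.
have -> : affine_chart i x 0 j = if unlift i j is Some m then x 0 m else 1 by rewrite mxE.
case: (unliftP i j) => [m ->|->]; last by rewrite pi !vi // !mulr0 !addr0 !expr1n.
have E : phi x 0 0 * v 0%N (lift i m) + (phi x 0 1 * v 1%N (lift i m) +
    phi x 0 2 * v 2 (lift i m)) = y x 0 m - p (lift i m).
  have PN : phi x *m N = y x - c := mulmxKV Nu _.
  transitivity ((y x - c) 0 m); last by rewrite mxE [X in _ + X]mxE [X in - X]mxE.
  rewrite -PN; move: (phi x) => ph; rewrite mxE !big_ord_recl big_ord0 !mxE addr0.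
  have -> : lift ord0 ord0 = 1 :> 'I_3 by apply: val_inj.
  by have -> : lift ord0 (lift ord0 ord0) = 2 :> 'I_3 by apply: val_inj.
rewrite E addrC subrK mxE /ex /e; case: ifP => [/k3->|_]; last by rewrite expr1.
by rewrite expr1.
Qed.

End octic_point_germ.

(** * Counting points in the fibres of the power map *)

Definition distinct_points (d e : point_data) : bool :=
  has (fun i => has (fun j => z12_neq0 (z12_sub
      (z12_mul (nth z12_0 d.1.2 i) (nth z12_0 e.1.2 j))
      (z12_mul (nth z12_0 d.1.2 j) (nth z12_0 e.1.2 i)))) (iota 0 4)) (iota 0 4).

Definition fiber_size (k : nat) (d : point_data) : nat :=
  \prod_(m <- iota 0 3) if z12_is0 (nth z12_0 d.1.2 (bump d.1.1 m)) then 1%N else k.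

Lemma le_counting (R : realType) (T : choiceType) (A : set T) (s : seq T) :
  uniq s -> (forall x, x \in s -> A x) -> ((size s)%:R%:E <= counting A :> \bar R)%E.
Proof.
move=> us sA; rewrite /counting; case: asboolP => [fA|_]; last exact: leey.
rewrite lee_fin ler_nat; apply: uniq_leq_size us _ => x /sA Ax.
by rewrite in_fset_set // mem_set.
Qed.

Section fibers.
Variable R : realType.
Local Notation C := R[i].

Lemma nth_roots (k : nat) (a : C) : (0 < k)%N -> a != 0 ->
  exists s : seq C, [/\ uniq s, size s = k & forall x, x \in s -> x ^+ k = a].
Proof.
move=> k0 a0; have [r er] := closed_field_poly_normal ('X^k - 1 : {poly C}).
have lc : lead_coef ('X^k - 1 : {poly C}) = 1 by apply/eqP; rewrite -monicE monicXnsubC.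
have sz : size ('X^k - 1 : {poly C}) = k.+1 by rewrite size_XnsubC.
rewrite lc scale1r in er.
have ur : uniq r.
  by rewrite -separable_prod_XsubC -er separable_Xn_sub_1 // pnatr_eq0 -lt0n.
exists [seq z * k.-root a | z <- r]; split.
- rewrite map_inj_uniq //; apply: mulIf; apply: contraNneq a0 => ka.
  by rewrite -(rootCK k0 a) ka expr0n (gtn_eqF k0).
- by rewrite size_map; apply/eqP; rewrite -eqSS -sz er size_prod_XsubC.
- move=> _ /mapP[z zr ->]; rewrite exprMn rootCK //.
  have : root ('X^k - 1 : {poly C}) z by rewrite er root_prod_XsubC.
  by rewrite rootE !hornerE subr_eq0 => /eqP->; rewrite mul1r.
Qed.

Definition fiber_point (k : nat) (d : point_data) (u : 'rV[C]_3) : Prop :=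
  forall m : 'I_3, if z12_is0 (nth z12_0 d.1.2 (bump d.1.1 m)) then u 0 m = 0
    else u 0 m ^+ k = zev R (nth z12_0 d.1.2 (bump d.1.1 m)).

Definition point_nz (d : point_data) : bool :=
  all (fun j => z12_is0 (nth z12_0 d.1.2 j) || z12_neq0 (nth z12_0 d.1.2 j)) (iota 0 4).

Lemma fiber_points k d : (0 < k)%N -> point_nz d -> exists s : seq 'rV[C]_3,
  [/\ uniq s, size s = fiber_size k d & forall u, u \in s -> fiber_point k d u].
Proof.
move=> k0 /allP nz.
have rts m : (m < 3)%N -> exists s : seq C, [/\ uniq s,
    size s = (if z12_is0 (nth z12_0 d.1.2 (bump d.1.1 m)) then 1%N else k) &
    forall x, x \in s -> if z12_is0 (nth z12_0 d.1.2 (bump d.1.1 m)) then x = 0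
      else x ^+ k = zev R (nth z12_0 d.1.2 (bump d.1.1 m))].
  move=> hm; case: ifP => n0; first by exists [:: 0]; split => // x; rewrite inE => /eqP.
  have := nz (bump d.1.1 m); rewrite mem_iota n0 /= => h.
  have [|s [us ss sP]] := nth_roots k0 (zev_neq0 R (h _)); first by rewrite add0n /bump; case:
    (d.1.1 <= m)%N; lia.
  by exists s; split => // x /sP.
have [s0 [u0 z0 h0]] := rts 0%N isT; have [s1 [u1 z1 h1]] := rts 1%N isT.
have [s2 [u2 z2 h2]] := rts 2 isT.
pose row3 (t : C * C * C) : 'rV[C]_3 := \row_m [:: t.1.1; t.1.2; t.2]`_m.
exists [seq row3 t | t <- [seq (x, z) | x <- [seq (x, y) | x <- s0, y <- s1], z <- s2]].
split.
- rewrite map_inj_uniq.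
    apply: allpairs_uniq => // [|[x z] [x' z'] _ _ []-> -> //].
    by apply: allpairs_uniq => // -[x z] [x' z'] _ _ []-> ->.
  move=> [[a b] c] [[a' b'] c'] /rowP e.
  by have := e 0; have := e 1; have := e 2; rewrite !mxE /= => -> -> ->.
- rewrite size_map !size_allpairs z0 z1 z2 /fiber_size /= !big_cons big_nil muln1.
  by rewrite mulnA.
- move=> u /mapP[[[a b] c] /allpairsP[[[a' b'] c'] /= [/allpairsP[[a2 b2] /= [ha hb [-> ->]]] hc
  [-> -> ->]]] -> m].
  rewrite mxE; case: m => [[|[|[|//]]] ?] /=.
  + exact: (h0 _ ha).
  + exact: (h1 _ hb).
  + exact: (h2 _ hc).
Qed.

(** Taking k-th powers of coordinates is well defined on points of P^3, so fibre points on one line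
    lie over proportional points, whose 2 x 2 minors all vanish. *)
Lemma chart_lines k (d d' : point_data) u u' (i i' : 'I_4) : (0 < k)%N ->
  d.1.1 = i -> d'.1.1 = i' -> fiber_point k d u -> fiber_point k d' u' ->
  z12_eqb (nth z12_0 d.1.2 i) (z12_int 1) -> z12_eqb (nth z12_0 d'.1.2 i') (z12_int 1) ->
  <[affine_chart i u]>%VS = <[affine_chart i' u']>%VS -> distinct_points d d' = false.
Proof.
move=> k0 di di' hu hu' /z12_eqbP p1 /z12_eqbP p1' e.
have fib (dd : point_data) (w : 'rV[C]_3) (ii : 'I_4) : dd.1.1 = ii -> fiber_point k dd w ->
    nth z12_0 dd.1.2 ii = z12_int 1 ->
    forall j : 'I_4, affine_chart ii w 0 j ^+ k = zev R (nth z12_0 dd.1.2 j).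
  move=> dii hw pii j; rewrite mxE; case: (unliftP ii j) => [m ->|->]; last first.
    by rewrite pii zev_int Zr1 expr1n.
  have := hw m; rewrite dii /= -[bump ii m]/(nat_of_ord (lift ii m)).
  by case: ifP => [/z12_eqbP-> ->|_ ->//]; rewrite zev0 expr0n (gtn_eqF k0).
have [c ec] : exists c, affine_chart i u = c *: affine_chart i' u'.
  by apply/vlineP; rewrite -e memv_line.
have P j : zev R (nth z12_0 d.1.2 (j : 'I_4)) = c ^+ k * zev R (nth z12_0 d'.1.2 j).
  by rewrite -(fib d u i) // -(fib d' u' i') // ec mxE exprMn.
apply/negbTE/hasPn => a; rewrite mem_iota => /andP[_ ha].
apply/hasPn => b; rewrite mem_iota => /andP[_ hb].
apply/negP => /(zev_neq0 R)/negP; apply; apply/eqP.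
have zevB x y : zev R (z12_sub x y) = zev R x - zev R y by exact: z12_evalB.
have := P (Ordinal ha); have := P (Ordinal hb) => /= Pb Pa.
by rewrite zevB !zevM Pa Pb; ring.
Qed.

Lemma chart_line_inj (i : 'I_4) (u u' : 'rV[C]_3) :
  <[affine_chart i u]>%VS = <[affine_chart i u']>%VS -> u = u'.
Proof.
move=> e; have [c ec] : exists c, affine_chart i u = c *: affine_chart i u'.
  by apply/vlineP; rewrite -e memv_line.
have c1 : c = 1.
  have := congr1 (fun A : 'rV[C]_4 => A 0 i) ec; rewrite !mxE unlift_none mulr1.
  by move=> ->.
apply/rowP => m; have := congr1 (fun A : 'rV[C]_4 => A 0 (lift i m)) ec.
by rewrite c1 scale1r !mxE liftK.
Qed.

Definition over_point k (d : point_data) (x : {vspace 'rV[C]_4}) : Prop :=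
  exists (i : 'I_4) (u : 'rV[C]_3),
    [/\ d.1.1 = i, fiber_point k d u & x = <[affine_chart i u]>%VS].

Lemma lines_over_points (L : seq point_data) k : (0 < k)%N ->
  all point_ok L -> all (fun d => d.1.1 < 4)%N L -> pairwise distinct_points L ->
  exists s : seq {vspace 'rV[C]_4}, [/\ uniq s, size s = sumn [seq fiber_size k d | d <- L] &
    forall x, x \in s -> exists2 d, d \in L & over_point k d x].
Proof.
move=> k0; elim: L => [_ _ _|d L IH]; first by exists [::].
move=> /= /andP[okd okL] /andP[d4 /(IH okL){}IH] /andP[dL /IH[s [us ss hs]]].
have ok1 e : point_ok e -> z12_eqb (nth z12_0 e.1.2 e.1.1) (z12_int 1) by case/and5P.
have [s' [us' ss' hs']] := fiber_points k0 (proj1 (andP okd)).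
pose i : 'I_4 := Ordinal d4.
exists ([seq <[affine_chart i u]>%VS | u <- s'] ++ s); split.
- rewrite cat_uniq us andbT map_inj_uniq; last by move=> u u' /chart_line_inj.
  rewrite us' /=; apply/hasPn => x /hs[d' d'L [i' [u' [di' hu' ->]]]].
  apply/negP => /mapP[u us'u e].
  have := allP dL d' d'L; rewrite (chart_lines k0 (erefl : d.1.1 = i) di' (hs' _ us'u) hu') //.
  + exact: ok1.
  + by rewrite -di'; apply/ok1/(allP okL).
- by rewrite size_cat size_map ss' ss.
- move=> x; rewrite mem_cat => /orP[/mapP[u us'u ->]|/hs[d' d'L hx]].
    by exists d; [rewrite mem_head|exists i, u; split => //; apply: hs'].
  by exists d' => //; rewrite inE d'L orbT.
Qed.

Lemma counting_D4_points (L : seq point_data) k : (0 < k)%N ->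
  all point_ok L -> all (fun d => d.1.1 < 4)%N L -> pairwise distinct_points L ->
  (forall d (j : 'I_4), d \in L -> z12_is0 (nth z12_0 d.1.2 j) -> k = 3) ->
  ((sumn [seq fiber_size k d | d <- L])%:R%:E <=
    counting (D4_points (octic_pullback C k)) :> \bar R)%E.
Proof.
move=> k0 ok d4 dist k3; have [s [us <- hs]] := lines_over_points k0 ok d4 dist.
apply: le_counting us _ => x /hs[d dL [i [u [di hu ->]]]].
exists i, u; split => //.
apply: (octic_point_germ (allP ok _ dL) k0 _ di) => [j|m]; first exact: k3.
by have := hu m; rewrite di.
Qed.
End fibers.

(** * Plane section of the octic *)

Section section_polynomial.
Variable K : comNzRingType.
Implicit Types x v : K.
(* Numerals are written in base 1000, literals being unary. *)
Definition sec0 x := x ^+ 8 - 72 * x ^+ 6 + (4 * 1000 + 480) * x ^+ 5 + (60 * 1000 + 744) *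
  x ^+ 4 + (244 * 1000 + 320) * x ^+ 3 + (197 * 1000 + 272) * x ^+ 2 + (24 * 1000 + 720) * x -
  24.
Definition sec1 x := - 6 * x ^+ 6 - (4 * 1000 + 480) * x ^+ 5 + (104 * 1000 + 264) * x ^+ 4 -
  (223 * 1000 + 960) * x ^+ 3 + (235 * 1000 + 528) * x ^+ 2 + (42 * 1000 + 400) * x - (35 * 1000
  + 648).
Definition sec2 x := - 14 * x ^+ 4 - (20 * 1000 + 360) * x ^+ 3 + (57 * 1000 + 384) * x ^+ 2 -
  (67 * 1000 + 240) * x + (20 * 1000 + 24).
Definition sec3 x := - 6 * x ^+ 2 + 120 * x + 48.
Definition sec x v := sec0 x + sec1 x * v + sec2 x * v ^+ 2 + sec3 x * v ^+ 3 + v ^+ 4.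
Definition sec0' x := 8 * x ^+ 7 - 432 * x ^+ 5 + (22 * 1000 + 400) * x ^+ 4 + (242 * 1000 +
  976) * x ^+ 3 + (732 * 1000 + 960) * x ^+ 2 + (394 * 1000 + 544) * x + (24 * 1000 + 720).
Definition edge v := v ^+ 4 + 48 * v ^+ 3 + (20 * 1000 + 24) * v ^+ 2 - (35 * 1000 + 648) * v - 24.
Definition edge' v := 4 * v ^+ 3 + 144 * v ^+ 2 + (40 * 1000 + 48) * v - (35 * 1000 + 648).

Lemma sec_edge v : sec 0 v = edge v.
Proof. by rewrite /sec /sec0 /sec1 /sec2 /sec3 /edge !expr0n /=; ring. Qed.

(** A Bezout certificate: the right-hand side is a constant, nonzero in characteristic 0, so [sec0]
    is coprime to its derivative [sec0']. *)
Lemma sec0_bezout x : (- (7 * 1000 ^+ 2 + 219 * 1000 + 720) * x ^+ 6 + (860 * 1000 + 336) *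
  x ^+ 5 + (389 * 1000 ^+ 2 + 597 * 1000 + 840) * x ^+ 4 - (20 * 1000 ^+ 3 + 261 * 1000 ^+ 2 +
  547 * 1000 + 56) * x ^+ 3 - (216 * 1000 ^+ 3 + 853 * 1000 ^+ 2 + 817 * 1000 + 840) * x ^+ 2 -
  (636 * 1000 ^+ 3 + 97 * 1000 ^+ 2 + 119 * 1000 + 56) * x - (284 * 1000 ^+ 3 + 989 * 1000 ^+ 2
  + 217 * 1000 + 280)) * sec0 x + ((902 * 1000 + 465) * x ^+ 7 - (107 * 1000 + 542) * x ^+ 6 -
  (64 * 1000 ^+ 2 + 944 * 1000 + 100) * x ^+ 5 + (4 * 1000 ^+ 3 + 50 * 1000 ^+ 2 + 770 * 1000 +
  338) * x ^+ 4 + (54 * 1000 ^+ 3 + 335 * 1000 ^+ 2 + 122 * 1000 + 810) * x ^+ 3 +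
  (214 * 1000 ^+ 3 + 108 * 1000 ^+ 2 + 644 * 1000 + 106) * x ^+ 2 + (153 * 1000 ^+ 3 +
  712 * 1000 ^+ 2 + 777 * 1000 + 590) * x + (8 * 1000 ^+ 3 + 186 * 1000 ^+ 2 + 380 * 1000 +
  374)) * sec0' x = (209 * 1000 ^+ 4 + 207 * 1000 ^+ 3 + 64 * 1000 ^+ 2 + 60 * 1000).
Proof. by rewrite /sec0 /sec0'; ring. Qed.

Lemma edge_bezout v : (- (990 * 1000 ^+ 2 + 70 * 1000 + 732) * v ^+ 2 - (36 * 1000 ^+ 3 +
  513 * 1000 ^+ 2 + 36 * 1000 + 608) * v - (9 * 1000 ^+ 4 + 946 * 1000 ^+ 3 + 222 * 1000 ^+ 2 +
  190 * 1000 + 248)) * edge v + ((247 * 1000 ^+ 2 + 517 * 1000 + 683) * v ^+ 3 + (12 * 1000 ^+ 3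
  + 98 * 1000 ^+ 2 + 471 * 1000 + 348) * v ^+ 2 + (4 * 1000 ^+ 4 + 967 * 1000 ^+ 3 +
  314 * 1000 ^+ 2 + 60 * 1000 + 526) * v - (4 * 1000 ^+ 4 + 431 * 1000 ^+ 3 + 906 * 1000 ^+ 2 +
  545 * 1000 + 176)) * edge' v = (158 * 1000 ^+ 5 + 227 * 1000 ^+ 4 + 313 * 1000 ^+ 3 +
  855 * 1000 ^+ 2).
Proof. by rewrite /edge /edge'; ring. Qed.
End section_polynomial.

(** Positivity is read off the shape of the expression, so base 1000 numerals are never expanded. *)
Ltac numneq0 := refine (lt0r_neq0 _);
  repeat lazymatch goal with
  | |- is_true (0 < _ + _) => refine (addr_gt0 _ _)
  | |- is_true (0 < _ * _) => refine (mulr_gt0 _ _)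
  | |- is_true (0 < _ ^+ _) => refine (exprn_gt0 _ _)
  | |- is_true (0 < _%:R) => by rewrite ltr0n
  end.

Section section_polynomial_factors.
Variable K : numFieldType.
Implicit Types x v : K.

(** A nonzero polynomial would have as many distinct natural roots as its size. This passes from
    identities between values to identities between coefficients. *)
Lemma horner_seq_eq0 (s : seq K) : (forall x, horner_rec s x = 0) -> forall i, s`_i = 0.
Proof.
move=> h i; rewrite -coef_Poly; suff -> : Poly s = 0 by rewrite coef0.
apply/eqP/negPn/negP => s0.
have r : all (root (Poly s)) [seq j%:R | j <- iota 0 (size (Poly s))].
  by apply/allP => x _; rewrite /root horner_Poly h.
have u : uniq [seq j%:R : K | j <- iota 0 (size (Poly s))].
  by rewrite map_inj_uniq ?iota_uniq // => a b /eqP; rewrite eqr_nat => /eqP.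
by have := max_poly_roots s0 r u; rewrite size_map size_iota ltnn.
Qed.

Lemma mulf_eq0r (a b : K) : a != 0 -> a * b = 0 -> b = 0.
Proof. by move=> a0 /eqP; rewrite mulf_eq0 (negPf a0) => /eqP. Qed.

(** The shape of the ideal membership certificates below, whose last premise is left to [ring]. *)
Lemma lincomb_eq0 (a b c d p q l m y : K) : p = 0 -> q = 0 -> l = 0 -> m = 0 ->
  y = a * p + b * q + c * l + d * m -> y = 0.
Proof. by move=> -> -> -> -> ->; rewrite !mulr0 !addr0. Qed.

Lemma sec_root_free (r u w : K) : ~ forall x, sec x (r * x ^+ 2 + u * x + w) = 0.
Proof.
move=> h.
have /horner_seq_eq0 c : forall x, horner_rec [::
  w ^+ 4 + 48 * w ^+ 3 + (20 * 1000 + 24) * w ^+ 2 - (35 * 1000 + 648) * w - 24;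
  4 * u * w ^+ 3 + 144 * u * w ^+ 2 + (40 * 1000 + 48) * u * w - (35 * 1000 + 648) * u + 120 *
    w ^+ 3 - (67 * 1000 + 240) * w ^+ 2 + (42 * 1000 + 400) * w + (24 * 1000 + 720);
  4 * r * w ^+ 3 + 144 * r * w ^+ 2 + (40 * 1000 + 48) * r * w - (35 * 1000 + 648) * r + 6 *
    u ^+ 2 * w ^+ 2 + 144 * u ^+ 2 * w + (20 * 1000 + 24) * u ^+ 2 + 360 * u * w ^+ 2 -
    (134 * 1000 + 480) * u * w + (42 * 1000 + 400) * u - 6 * w ^+ 3 + (57 * 1000 + 384) * w ^+ 2
    + (235 * 1000 + 528) * w + (197 * 1000 + 272);
  12 * r * u * w ^+ 2 + 288 * r * u * w + (40 * 1000 + 48) * r * u + 360 * r * w ^+ 2 -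
    (134 * 1000 + 480) * r * w + (42 * 1000 + 400) * r + 4 * u ^+ 3 * w + 48 * u ^+ 3 + 360 *
    u ^+ 2 * w - (67 * 1000 + 240) * u ^+ 2 - 18 * u * w ^+ 2 + (114 * 1000 + 768) * u * w +
    (235 * 1000 + 528) * u - (20 * 1000 + 360) * w ^+ 2 - (223 * 1000 + 960) * w + (244 * 1000 +
    320);
  6 * r ^+ 2 * w ^+ 2 + 144 * r ^+ 2 * w + (20 * 1000 + 24) * r ^+ 2 + 12 * r * u ^+ 2 * w + 144
    * r * u ^+ 2 + 720 * r * u * w - (134 * 1000 + 480) * r * u - 18 * r * w ^+ 2 + (114 * 1000
    + 768) * r * w + (235 * 1000 + 528) * r + u ^+ 4 + 120 * u ^+ 3 - 18 * u ^+ 2 * w +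
    (57 * 1000 + 384) * u ^+ 2 - (40 * 1000 + 720) * u * w - (223 * 1000 + 960) * u - 14 *
    w ^+ 2 + (104 * 1000 + 264) * w + (60 * 1000 + 744);
  12 * r ^+ 2 * u * w + 144 * r ^+ 2 * u + 360 * r ^+ 2 * w - (67 * 1000 + 240) * r ^+ 2 + 4 * r
    * u ^+ 3 + 360 * r * u ^+ 2 - 36 * r * u * w + (114 * 1000 + 768) * r * u - (40 * 1000 +
    720) * r * w - (223 * 1000 + 960) * r - 6 * u ^+ 3 - (20 * 1000 + 360) * u ^+ 2 - 28 * u * w
    + (104 * 1000 + 264) * u - (4 * 1000 + 480) * w + (4 * 1000 + 480);
  4 * r ^+ 3 * w + 48 * r ^+ 3 + 6 * r ^+ 2 * u ^+ 2 + 360 * r ^+ 2 * u - 18 * r ^+ 2 * w +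
    (57 * 1000 + 384) * r ^+ 2 - 18 * r * u ^+ 2 - (40 * 1000 + 720) * r * u - 28 * r * w +
    (104 * 1000 + 264) * r - 14 * u ^+ 2 - (4 * 1000 + 480) * u - 6 * w - 72;
  4 * r ^+ 3 * u + 120 * r ^+ 3 - 18 * r ^+ 2 * u - (20 * 1000 + 360) * r ^+ 2 - 28 * r * u -
    (4 * 1000 + 480) * r - 6 * u;
  r ^+ 4 - 6 * r ^+ 3 - 14 * r ^+ 2 - 6 * r + 1] x = 0.
  by move=> x; rewrite -[RHS](h x) /= /sec /sec0 /sec1 /sec2 /sec3; ring.
have c5 := c 5; have c6 := c 6; have c7 := c 7; have c8 := c 8.
move: c5 c6 c7 c8 => {c h} /= c5 c6 c7 c8.
(* The coefficient of x^8 is the part of weight 8 of [sec] at v = r, x = 1. *)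
have /eqP : (r + 1) ^+ 2 * (r ^+ 2 - 8 * r + 1) = 0 by rewrite -[RHS]c8; ring.
rewrite mulf_eq0 expf_eq0 /= => /orP[/eqP r1|/eqP m].
  have {}r1 : r = - 1 by rewrite -[r]addr0 -(subrr 1) addrA r1 add0r.
  (* At the double root r = -1 the coefficient of x^7 does not depend on u; it is -16000. *)
  suff /eqP : (16 * 1000 : K) = 0 by apply/negP; numneq0.
  by move: c7; rewrite r1 => c7; rewrite -[RHS]oppr0 -c7; ring.
(* Modulo r^2 - 8 r + 1, both u in [c7] and w in [c6] have coefficient 20 (4 r - 1), and (4 r - 1)
   (4 r - 31) = 15. Multiplying by 4 r - 31 thus leaves 300 u and 300 w. *)
have {c7}uE : u = 274 * r - 126.
  apply/eqP; rewrite -subr_eq0; apply/eqP; apply: (@mulf_eq0r 300); first by numneq0.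
  by apply: (@lincomb_eq0 (4 * r - 31) (- (16 * r ^+ 2 * u + 480 * r ^+ 2 - 68 * r * u -
    (81 * 1000 + 320) * r - 114 * u - (37 * 1000 + 800))) 0 0 _ _ _ _ _ c7 m m m); ring.
rewrite {}uE in c5 c6.
have {c6}wE : 3 * w = (257 * 1000 + 980) - (208 * 1000 + 594) * r.
  apply/eqP; rewrite -subr_eq0; apply/eqP; apply: (@mulf_eq0r 100); first by numneq0.
  by apply: (@lincomb_eq0 (4 * r - 31) (- ((1 * 1000 ^+ 2 + 801 * 1000 + 824) * r ^+ 3 + 16 *
    r ^+ 2 * w - (6 * 1000 ^+ 2 + 217 * 1000 + 416) * r ^+ 2 - 68 * r * w - (43 * 1000 ^+ 2 +
    297 * 1000 + 944) * r - 114 * w + (15 * 1000 ^+ 2 + 191 * 1000 + 536))) 0 0 _ _ _ _ _ c6 m m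
    m); ring.
move/eqP: wE; rewrite -subr_eq0 => /eqP wE.
have e : (6 * 1000 ^+ 2 + 498 * 1000 + 925) - (78 * 1000 ^+ 2 + 411 * 1000 + 461) * r = 0.
  apply: (@mulf_eq0r 600); first by numneq0.
  by apply: (@lincomb_eq0 3 (- ((3 * 1000 + 288) * r ^+ 3 - (11 * 1000 + 16) * r ^+ 2 -
    (43 * 1000 + 856) * r - 952)) (- (- (439 * 1000 ^+ 2 + 7 * 1000 + 184) * r ^+ 2 -
    (995 * 1000 ^+ 2 + 566 * 1000 + 848) * r - (5 * 1000 ^+ 3 + 118 * 1000 ^+ 2 + 49 * 1000 +
    624))) 0 _ _ _ _ _ c5 wE m m); ring.
(* This number is the resultant of r^2 - 8 r + 1 and the linear polynomial in [e]. *)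
suff /eqP : (2 * 1000 ^+ 5 + 113 * 1000 ^+ 4 + 871 * 1000 ^+ 3 + 608 * 1000 ^+ 2 + 874 * 1000 +
  746 : K) = 0.
  by apply/negP; numneq0.
by apply: (@lincomb_eq0 ((78 * 1000 ^+ 2 + 411 * 1000 + 461) ^+ 2) ((78 * 1000 ^+ 2 + 411 * 1000
  + 461) * r - (620 * 1000 ^+ 2 + 792 * 1000 + 763)) 0 0 _ _ _ _ _ m e m m); ring.
Qed.
(* Giving v weight 2 and x weight 1, these are the coefficients of weight at least 5
   of the product; the part of weight 8 of [sec x v] is
   (v + x^2)^2 (v^2 - 8 x^2 v + x^4). *)
Lemma weight_equations (s a b t c d e s' a' b' t' c' d' e' : K) :
  s + s' + 6 = 0 ->
  a + a' - 120 = 0 ->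
  b + b' - 48 = 0 ->
  s * s' + t + t' + 14 = 0 ->
  s * a' + a * s' + c + c' + (20 * 1000 + 360) = 0 ->
  s * b' + a * a' + b * s' + d + d' - (57 * 1000 + 384) = 0 ->
  a * b' + b * a' + e + e' + (67 * 1000 + 240) = 0 ->
  s * t' + t * s' + 6 = 0 ->
  s * c' + a * t' + t * a' + c * s' + (4 * 1000 + 480) = 0 ->
  s * d' + a * c' + b * t' + t * b' + c * a' + d * s' - (104 * 1000 + 264) = 0 ->
  t * t' - 1 = 0 ->
  t * c' + c * t' = 0 ->
  t * d' + c * c' + d * t' + 72 = 0 ->
  t * e' + c * d' + d * c' + e * t' - (4 * 1000 + 480) = 0 ->
  False.
Proof.
wlog ts : s a b t c d e s' a' b' t' c' d' e' / 1 - s + t = 0.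
  move=> W h32 h31 h30 h24 h23 h22 h21 h16 h15 h14 h08 h07 h06 h05.
  (* The parts of weight 8 of the two factors at x = 1, v = -1, where their product vanishes. *)
  have /eqP : (1 - s + t) * (1 - s' + t') = 0.
    by apply: (@lincomb_eq0 1 (- 1) 1 (- 1) _ _ _ _ _ h08 h16 h24 h32); ring.
  rewrite mulf_eq0 => /orP[]/eqP z.
    by apply: (W s a b t c d e s' a' b' t' c' d' e').
  by apply: (W s' a' b' t' c' d' e' s a b t c d e) => //;
    [rewrite -[RHS]h32|rewrite -[RHS]h31|rewrite -[RHS]h30|rewrite -[RHS]h24|rewrite -[RHS]h23
    |rewrite -[RHS]h22|rewrite -[RHS]h21|rewrite -[RHS]h16|rewrite -[RHS]h15|rewrite -[RHS]h14
    |rewrite -[RHS]h08|rewrite -[RHS]h07|rewrite -[RHS]h06|rewrite -[RHS]h05]; ring.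
move=> h32 h31 h30 h24 h23 h22 h21 h16 h15 h14 h08 h07 h06 h05.
(* The root v = -1 of the product is double: this is the derivative there, the first factor
   vanishing with derivative s - 2. *)
have /eqP : (s - 2) * (1 - s' + t') = 0.
  by apply: (@lincomb_eq0 3 (- 2) 1 (2 - s') _ _ _ _ _ h32 h24 h16 ts); ring.
have tE : t = s - 1 by apply: subr0_eq; rewrite -[RHS]ts; ring.
rewrite {}tE {ts} in h24 h16 h15 h14 h08 h07 h06 h05.
rewrite mulf_eq0 => /orP[]/eqP z; last first.
  have tE : t' = s' - 1 by apply: subr0_eq; rewrite -[RHS]z; ring.
  rewrite {}tE in h15 h07.
  (* If v + x^2 divides both parts of weight 8, the part of weight 7 of the product vanishes at x =
     1, v = -1, but that of [sec] is -16000 there. *)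
  suff /eqP : (16 * 1000 : K) = 0 by apply/negP; numneq0.
  by apply: (@lincomb_eq0 (- 1) 1 (- 1) 1 _ _ _ _ _ h31 h23 h15 h07); ring.
(* The parts of weight 8 are now (v + x^2)^2 and v^2 - 8 x^2 v + x^4. They are coprime, so the lower
   parts are determined: a and c by weight 7, then b and d by weight 6. *)
have {z}sE : s = 2 := subr0_eq z.
rewrite {}sE in h32 h24 h23 h22 h16 h15 h14 h08 h07 h06 h05.
have s'E : s' = - 8 by apply: subr0_eq; rewrite -[RHS]h32; ring.
have t'E : t' = 1 by apply: subr0_eq; rewrite -[RHS]h08; ring.
have c'E : c' = - c by apply: subr0_eq; rewrite -[RHS]h07 t'E; ring.
have a'E : a' = 120 - a by apply: subr0_eq; rewrite -[RHS]h31; ring.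
have b'E : b' = 48 - b by apply: subr0_eq; rewrite -[RHS]h30; ring.
rewrite {}s'E {}t'E {}c'E {}a'E {}b'E {h32 h31 h30 h24 h16 h08 h07} in h23 h22 h21 h15 h14 h06 h05.
have aE : a = 2 * 1000 + 60.
  apply: subr0_eq; apply: (@mulf_eq0r (- 10)); first by rewrite oppr_eq0; numneq0.
  by rewrite -[RHS]h23; ring.
have cE : c = 460.
  apply: subr0_eq; apply: (@mulf_eq0r (- 10)); first by rewrite oppr_eq0; numneq0.
  by rewrite -[RHS]h15; ring.
rewrite {}aE {}cE {h23 h15} in h22 h21 h14 h06 h05.
have d'E : d' = (211 * 1000 + 528) - d by apply: subr0_eq; rewrite -[RHS]h06; ring.
rewrite {}d'E {h06} in h22 h14 h05.
have bE : b = - (384 * 1000 + 216).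
  apply: subr0_eq; apply: (@mulf_eq0r (- 10)); first by rewrite oppr_eq0; numneq0.
  by rewrite -[RHS]h22; ring.
have dE : d = - (152 * 1000 + 116).
  apply: subr0_eq; apply: (@mulf_eq0r (- 10)); first by rewrite oppr_eq0; numneq0.
  by rewrite -[RHS]h14; ring.
rewrite {}bE {}dE {h22 h14} in h21 h05.
(* The equations [h21] and [h05] of weight 5 both prescribe e + e', with different values. *)
suff /eqP : (1 * 1000 ^+ 3 + 299 * 1000 ^+ 2 + 785 * 1000 : K) = 0 by apply/negP; numneq0.
by apply: (@lincomb_eq0 1 (- 1) 0 0 _ _ _ _ _ h21 h05 h05 h05); ring.
Qed.

Lemma sec_no_quadratic_factors (s a b t c d e f s' a' b' t' c' d' e' f' : K) :
  ~ forall x v, (v ^+ 2 + (s * x ^+ 2 + a * x + b) * v + (t * x ^+ 4 + c * x ^+ 3 + d * x ^+ 2 +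
    e * x + f)) *
    (v ^+ 2 + (s' * x ^+ 2 + a' * x + b') * v + (t' * x ^+ 4 + c' * x ^+ 3 + d' * x ^+ 2 + e' *
      x + f')) = sec x v.
Proof.
move=> h.
have {}h x : forall i, [::
  (t * x ^+ 4 + c * x ^+ 3 + d * x ^+ 2 + e * x + f) * (t' * x ^+ 4 + c' * x ^+ 3 + d' * x ^+ 2
    + e' * x + f') - sec0 x;
  (s * x ^+ 2 + a * x + b) * (t' * x ^+ 4 + c' * x ^+ 3 + d' * x ^+ 2 + e' * x + f') +
  (s' * x ^+ 2 + a' * x + b') * (t * x ^+ 4 + c * x ^+ 3 + d * x ^+ 2 + e * x + f) - sec1 x;
  (t * x ^+ 4 + c * x ^+ 3 + d * x ^+ 2 + e * x + f) + (t' * x ^+ 4 + c' * x ^+ 3 + d' * x ^+ 2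
    + e' * x + f') +
  (s * x ^+ 2 + a * x + b) * (s' * x ^+ 2 + a' * x + b') - sec2 x;
  (s * x ^+ 2 + a * x + b) + (s' * x ^+ 2 + a' * x + b') - sec3 x]`_i = 0.
  apply: horner_seq_eq0 => v; apply/eqP; move/eqP: (h x v); rewrite -subr_eq0 => /eqP {1}<-.
  by rewrite /= /sec; apply/eqP; ring.
have /horner_seq_eq0 h3 : forall x, horner_rec [::
  b + b' - 48;
  a + a' - 120;
  s + s' + 6] x = 0.
  by move=> x; rewrite -[RHS](h x 3) /= /sec3; ring.
have /horner_seq_eq0 h2 : forall x, horner_rec [::
  b * b' + f + f' - (20 * 1000 + 24);
  a * b' + b * a' + e + e' + (67 * 1000 + 240);
  s * b' + a * a' + b * s' + d + d' - (57 * 1000 + 384);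
  s * a' + a * s' + c + c' + (20 * 1000 + 360);
  s * s' + t + t' + 14] x = 0.
  by move=> x; rewrite -[RHS](h x 2) /= /sec2; ring.
have /horner_seq_eq0 h1 : forall x, horner_rec [::
  b * f' + f * b' + (35 * 1000 + 648);
  a * f' + b * e' + e * b' + f * a' - (42 * 1000 + 400);
  s * f' + a * e' + b * d' + d * b' + e * a' + f * s' - (235 * 1000 + 528);
  s * e' + a * d' + b * c' + c * b' + d * a' + e * s' + (223 * 1000 + 960);
  s * d' + a * c' + b * t' + t * b' + c * a' + d * s' - (104 * 1000 + 264);
  s * c' + a * t' + t * a' + c * s' + (4 * 1000 + 480);
  s * t' + t * s' + 6] x = 0.
  by move=> x; rewrite -[RHS](h x 1) /= /sec1; ring.
have /horner_seq_eq0 h0 : forall x, horner_rec [::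
  f * f' + 24;
  e * f' + f * e' - (24 * 1000 + 720);
  d * f' + e * e' + f * d' - (197 * 1000 + 272);
  c * f' + d * e' + e * d' + f * c' - (244 * 1000 + 320);
  t * f' + c * e' + d * d' + e * c' + f * t' - (60 * 1000 + 744);
  t * e' + c * d' + d * c' + e * t' - (4 * 1000 + 480);
  t * d' + c * c' + d * t' + 72;
  t * c' + c * t';
  t * t' - 1] x = 0.
  by move=> x; rewrite -[RHS](h x 0) /= /sec0; ring.
clear h.
have h32 := h3 2; have h31 := h3 1%N; have h30 := h3 0%N.
have h24 := h2 4; have h23 := h2 3; have h22 := h2 2; have h21 := h2 1%N.
have h16 := h1 6; have h15 := h1 5; have h14 := h1 4.
have h08 := h0 8; have h07 := h0 7; have h06 := h0 6; have h05 := h0 5.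
move: h32 h31 h30 h24 h23 h22 h21 h16 h15 h14 h08 h07 h06 h05 => {h3 h2 h1 h0} /=.
exact: weight_equations.
Qed.
End section_polynomial_factors.

Section section_of_octic.
Variables (K : comNzRingType) (x y : K).

Local Notation term := (Z * (nat * nat))%type.

Let ev (l : seq term) : K := \sum_(m <- l) Zr K m.1 * (y ^+ m.2.1 * x ^+ m.2.2).

Fixpoint collect_term (m : term) (l : seq term) :=
  if l is m' :: l' then
    if m.2 == m'.2 then ((m.1 + m'.1)%BZ, m.2) :: l' else m' :: collect_term m l'
  else [:: m].

Let ev_collect_term m l : ev (collect_term m l) = Zr K m.1 * (y ^+ m.2.1 * x ^+ m.2.2) + ev l.
Proof.
rewrite /ev; elim: l => [|m' l IH] /=; first by rewrite big_seq1 big_nil addr0.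
case: eqP => [e|_]; rewrite !big_cons /=; first by rewrite ZrD mulrDl e addrA.
by rewrite IH addrCA.
Qed.

(** The odd powers of y cancel on x_2 = x_3 = 1: their collected coefficients are 0. *)
Lemma octic_section : octic (fun j : 'I_4 => nth 0 [:: y; x; 1; 1] j) = sec x (y ^+ 2).
Proof.
have -> : octic (fun j : 'I_4 => nth 0 [:: y; x; 1; 1] j) =
    ev (foldr (fun m => collect_term (m.1, (nth 0 m.2 0, nth 0 m.2 1)%N)) [::] octic_terms).
  rewrite /octic; elim: octic_terms => [|m l IH] /=; first by rewrite /ev !big_nil.
  rewrite big_cons ev_collect_term IH !big_ord_recl big_ord0 /= !expr1n !mulr1.
  by [].
(* After this step [zn] is opaque, so the coefficients remain combinations of small numerals, as in
   [sec]. *)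
have [zn [Zn ->]] : exists zn, (forall n, Zr K (zn n) = n%:R) /\
  foldr (fun m => collect_term (m.1, (nth 0 m.2 0, nth 0 m.2 1)%N)) [::] octic_terms = [::
  ((- (zn 24%N))%BZ, (0, 0)%N); ((zn 24%N * zn 1000%N + zn 720%N)%BZ, (0, 1)%N); ((zn 197%N * zn
    1000%N + zn 272%N)%BZ, (0, 2)%N);
  ((zn 244%N * zn 1000%N + zn 320%N)%BZ, (0, 3)%N); ((zn 60%N * zn 1000%N + zn 744%N)%BZ, (0,
    4)%N); ((zn 4%N * zn 1000%N + zn 480%N)%BZ, (0, 5)%N);
  ((- (zn 72%N))%BZ, (0, 6)%N); ((zn 1%N)%BZ, (0, 8)%N); ((zn 0%N)%BZ, (1, 0)%N);
  ((zn 0%N)%BZ, (1, 1)%N); ((zn 0%N)%BZ, (1, 2)%N); ((zn 0%N)%BZ, (1, 3)%N);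
  ((zn 0%N)%BZ, (1, 4)%N); ((zn 0%N)%BZ, (1, 5)%N); ((zn 0%N)%BZ, (1, 6)%N);
  ((- (zn 35%N * zn 1000%N + zn 648%N))%BZ, (2, 0)%N); ((zn 42%N * zn 1000%N + zn 400%N)%BZ, (2,
    1)%N); ((zn 235%N * zn 1000%N + zn 528%N)%BZ, (2, 2)%N);
  ((- (zn 223%N * zn 1000%N + zn 960%N))%BZ, (2, 3)%N); ((zn 104%N * zn 1000%N + zn 264%N)%BZ,
    (2, 4)%N); ((- (zn 4%N * zn 1000%N + zn 480%N))%BZ, (2, 5)%N);
  ((- (zn 6%N))%BZ, (2, 6)%N); ((zn 0%N)%BZ, (3, 0)%N); ((zn 0%N)%BZ, (3, 1)%N);
  ((zn 0%N)%BZ, (3, 2)%N); ((zn 0%N)%BZ, (3, 3)%N); ((zn 0%N)%BZ, (3, 4)%N);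
  ((zn 20%N * zn 1000%N + zn 24%N)%BZ, (4, 0)%N); ((- (zn 67%N * zn 1000%N + zn 240%N))%BZ, (4,
    1)%N); ((zn 57%N * zn 1000%N + zn 384%N)%BZ, (4, 2)%N);
  ((- (zn 20%N * zn 1000%N + zn 360%N))%BZ, (4, 3)%N); ((- (zn 14%N))%BZ, (4, 4)%N); ((zn
    0%N)%BZ, (5, 0)%N);
  ((zn 0%N)%BZ, (5, 1)%N); ((zn 0%N)%BZ, (5, 2)%N); ((zn 48%N)%BZ, (6, 0)%N);
  ((zn 120%N)%BZ, (6, 1)%N); ((- (zn 6%N))%BZ, (6, 2)%N); ((zn 1%N)%BZ, (8, 0)%N)].
  exists Z.of_nat; split; last by vm_compute.
  by case=> // n; rewrite /Zr /= SuccNat2Pos.id_succ.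
rewrite /ev !big_cons big_nil /= /sec /sec0 /sec1 /sec2 /sec3 !(ZrN, ZrD, ZrM, Zn).
ring.
Qed.
End section_of_octic.

(** * Irreducibility *)

Section bivariate.
Variable K : fieldType.
Implicit Types P Q T : {poly {poly K}}.

Definition total_degree_le a P := forall j i, (a < j + i)%N -> P`_j`_i = 0.

Lemma total_degree_le_size a P j : total_degree_le a P -> (size (P`_j)%R <= a.+1 - j)%N.
Proof. by move=> h; apply/leq_sizeP => i hi; apply: h; lia. Qed.

Lemma total_degree_le_swapXY a P : total_degree_le a P -> total_degree_le a (swapXY P).
Proof. by move=> h j i; rewrite coef_swapXY addnC; exact: h. Qed.

(** Here s and t are the sizes of P_0 and Q_0. The size of the product forces s = a + 1, which a
    coefficient of positive index cannot reach. *)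
Fact degree_drop a b s t j : (s <= a.+1 - 0 -> t <= b.+1 - 0 -> (s + t).-1 = (a + b).+1 ->
  s <= a.+1 - j.+1 -> False)%N.
Proof. lia. Qed.

(* Modulo the lower coefficients, the coefficient of index [j] of the product
   is [P`_0 * Q`_j + P`_j * Q`_0]; coprimality and the degree bounds make both
   terms vanish. *)
Lemma sparse_factors N a b P Q : total_degree_le a P -> total_degree_le b Q ->
  size (P * Q)`_0 = (a + b)%N.+1 -> separable_poly (P * Q)`_0 ->
  (forall j, ~~ (N %| j)%N -> (P * Q)`_j = 0) ->
  forall j, ~~ (N %| j)%N -> P`_j = 0 /\ Q`_j = 0.
Proof.
move=> hP hQ; rewrite coef0M separable_mul => sz /and3P[_ _ cop] h.
have P00 : P`_0 != 0 by apply: contra_eq_neq sz => ->; rewrite mul0r size_poly0.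
have Q00 : Q`_0 != 0 by apply: contra_eq_neq sz => ->; rewrite mulr0 size_poly0.
have sP := total_degree_le_size 0 hP; have sQ := total_degree_le_size 0 hQ.
move: sz; rewrite size_mul // => sz.
elim/ltn_ind => -[_|j IH] Nj; first by rewrite dvdn0 in Nj.
have := h _ Nj; rewrite coefM big_ord_recl big_ord_recr /= big1 ?add0r; last first.
  move=> i _; rewrite /bump /= add1n subSS; have ij := ltn_ord i.
  have [Ni|/IH[]//] := boolP (N %| i.+1)%N; last by move=> -> _; rewrite mul0r.
  have [] // := IH (j - i)%N; [lia| |by move=> _ ->; rewrite mulr0].
  by apply: contra Nj => Nji; have -> : j.+1 = (i.+1 + (j - i))%N; [lia|rewrite dvdn_add].
rewrite /bump /= add1n subSS subnn subn0 => e.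
have sPj := total_degree_le_size j.+1 hP; have sQj := total_degree_le_size j.+1 hQ.
split; apply/eqP/negPn/negP => n0.
  have : P`_0 %| P`_j.+1.
    rewrite -(Gauss_dvdpl _ cop); apply/dvdpP; exists (- Q`_j.+1).
    by apply/eqP; rewrite mulNr -addr_eq0 addrC [Q`__ * _]mulrC e.
  by move/(dvdp_leq n0) => le; exact: (degree_drop sP sQ sz (leq_trans le sPj)).
have : Q`_0 %| Q`_j.+1.
  rewrite coprimep_sym in cop; rewrite -(Gauss_dvdpl _ cop); apply/dvdpP; exists (- P`_j.+1).
  by apply/eqP; rewrite mulNr -addr_eq0 [Q`__ * _]mulrC e.
move/(dvdp_leq n0) => le; rewrite addnC [(a + b)%N]addnC in sz.
exact: (degree_drop sQ sP sz (leq_trans le sQj)).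
Qed.

(** T(x^k, y^l), where y is the outer variable. *)
Definition comp_monomials k l T := map_poly (comp_poly 'X^k) T \Po 'X^l.

Lemma coef_comp_monomials k l T j i : (0 < k)%N -> (0 < l)%N ->
  (comp_monomials k l T)`_j`_i =
  if (l %| j)%N && (k %| i)%N then T`_(j %/ l)`_(i %/ k) else 0.
Proof.
move=> k0 l0; rewrite coef_comp_poly_Xn //; case: ifP => _ /=; last by rewrite coef0.
by rewrite coef_map coef_comp_poly_Xn.
Qed.

Lemma comp_monomialsP k l P : (0 < k)%N -> (0 < l)%N ->
  (forall j, ~~ (l %| j)%N -> P`_j = 0) -> (forall i, ~~ (k %| i)%N -> (swapXY P)`_i = 0) ->
  exists T, P = comp_monomials k l T.
Proof.
move=> k0 l0 hl hk.
exists (\poly_(j < size P) \poly_(i < size P`_(l * j)) P`_(l * j)`_(k * i)).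
apply/polyP => j; apply/polyP => i; rewrite coef_comp_monomials //.
have [/dvdnP[{}j ->]|lj] := boolP (l %| j)%N; last by rewrite hl ?coef0.
have [/dvdnP[{}i ->]|ki] := boolP (k %| i)%N; last by rewrite -coef_swapXY hk ?coef0.
rewrite /= !mulnK // coef_poly; case: ltnP => hj; last first.
  by rewrite coef0 [P`__]nth_default ?coef0 // (leq_trans hj) // leq_pmulr.
rewrite coef_poly [(l * j)%N]mulnC [(k * i)%N]mulnC; case: ltnP => // hi.
by rewrite nth_default // (leq_trans hi) // leq_pmulr.
Qed.

Lemma comp_monomials_inj k l : (0 < k)%N -> (0 < l)%N -> injective (comp_monomials k l).
Proof.
move=> k0 l0 S T e; apply/polyP => j; apply/polyP => i.
have := coef_comp_monomials T (j * l) (i * k) k0 l0.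
by rewrite -e coef_comp_monomials // !dvdn_mull // !mulnK.
Qed.

Lemma comp_monomialsM k l : {morph comp_monomials k l : S T / S * T}.
Proof. by move=> S T; rewrite /comp_monomials !rmorphM. Qed.

End bivariate.

(** The derivative is p'(X^k) times k X^(k-1), and X does not divide p(X^k) because p(0) is
    nonzero. *)
Lemma separable_comp_Xn (K : numFieldType) (p : {poly K}) k : (0 < k)%N ->
  separable_poly p -> p.[0] != 0 -> separable_poly (p \Po 'X^k).
Proof.
rewrite !separable_poly.unlock => k0 sp p0; rewrite deriv_comp coprimepMr coprimep_comp_poly //=.
rewrite derivXn -scaler_nat coprimepZr ?pnatr_eq0 -?lt0n // coprimep_expr //.
have := coprimep_XsubC (p \Po 'X^k) 0; rewrite polyC0 subr0 => ->.
by rewrite /root horner_comp hornerXn expr0n gtn_eqF.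
Qed.

(* Driven by the syntax of the argument: rewriting with [rmorphD] would unfold
   the numerals into sums. *)
Ltac push_rmorph :=
  lazymatch goal with
  | |- _ (?a + ?b) = _ => refine (etrans (rmorphD _ a b) (f_equal2 +%R _ _)); push_rmorph
  | |- _ (?a * ?b) = _ => refine (etrans (rmorphM _ a b) (f_equal2 *%R _ _)); push_rmorph
  | |- _ (- ?a) = _ => refine (etrans (rmorphN _ a) (f_equal -%R _)); push_rmorph
  | |- _ (?a ^+ ?n) = _ => refine (etrans (rmorphXn _ n a) (f_equal (fun z => z ^+ n) _));
    push_rmorph
  | |- _ (?n%:R) = _ => exact: rmorph_nat
  | |- _ => idtac
  end.

Section section_morphism.
Variables (R S : comNzRingType) (f : {rmorphism R -> S}).

Lemma rmorph_sec0 x : f (sec0 x) = sec0 (f x).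
Proof. by rewrite /sec0; push_rmorph. Qed.

Lemma rmorph_sec x v : f (sec x v) = sec (f x) (f v).
Proof. by rewrite /sec /sec0 /sec1 /sec2 /sec3; push_rmorph. Qed.

Lemma rmorph_edge v : f (edge v) = edge (f v).
Proof. by rewrite /edge; push_rmorph. Qed.

End section_morphism.

Section section_factors.
Variable K : numFieldType.

Lemma bezout_coprimep (c : K) (u v p q : {poly K}) : c != 0 -> u * p + v * q = c%:P -> coprimep p q.
Proof.
move=> c0 e; apply/Bezout_coprimepP; exists (u, v).
by rewrite /= e polyC_eqp1.
Qed.

Let deriv_nat n : (n%:R : {poly K})^`() = 0.
Proof. by rewrite -polyC_natr derivC. Qed.

Let dE := (deriv_nat, derivD, derivN, derivM, derivXn, derivX).

Lemma separable_sec0 : separable_poly (sec0 'X : {poly K}).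
Proof.
have dX : (sec0 'X)^`() = sec0' 'X :> {poly K}.
  by rewrite /sec0 /sec0' !dE; ring.
rewrite separable_poly.unlock dX.
apply: (@bezout_coprimep (209 * 1000 ^+ 4 + 207 * 1000 ^+ 3 + 64 * 1000 ^+ 2 + 60 * 1000)); last
  first.
  by apply: etrans (sec0_bezout _) (esym _); push_rmorph.
by numneq0.
Qed.

Lemma separable_edge : separable_poly (edge 'X : {poly K}).
Proof.
have dX : (edge 'X)^`() = edge' 'X :> {poly K}.
  by rewrite /edge /edge' !dE; ring.
rewrite separable_poly.unlock dX.
apply: (@bezout_coprimep (158 * 1000 ^+ 5 + 227 * 1000 ^+ 4 + 313 * 1000 ^+ 3 +
  855 * 1000 ^+ 2)); last first.
  by apply: etrans (edge_bezout _) (esym _); push_rmorph.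
by numneq0.
Qed.

Definition sec_poly : {poly {poly K}} := sec 'X%:P 'X.

Lemma coef0_sec_poly : sec_poly`_0 = sec0 'X.
Proof.
rewrite -horner_coef0; apply: (etrans (rmorph_sec (horner_eval 0) _ _)).
rewrite /= !horner_evalE hornerC hornerX.
by rewrite /sec !expr0n !mulr0 !addr0.
Qed.

Lemma swapXY_sec_poly : swapXY sec_poly = sec 'X 'X%:P.
Proof.
have := rmorph_sec (swapXY : {rmorphism {poly {poly K}} -> {poly {poly K}}}) 'X%:P 'X.
by move=> /= ->; rewrite swapXY_Y swapXY_X.
Qed.

Lemma coef0_swapXY_sec_poly : (swapXY sec_poly)`_0 = edge 'X.
Proof.
rewrite -horner_coef0 swapXY_sec_poly; apply: (etrans (rmorph_sec (horner_eval 0) _ _)).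
by rewrite /= !horner_evalE hornerC hornerX sec_edge.
Qed.

Lemma coef4_sec_poly : sec_poly`_4 = 1.
Proof.
have e : sec_poly = (sec0 'X)%:P + (sec1 'X)%:P * 'X + (sec2 'X)%:P * 'X^2 + (sec3 'X)%:P * 'X^3
  + 'X^4.
  by rewrite /sec_poly /sec; congr (_ + _ * _ + _ * _ + _ * _ + _); apply: esym;
    rewrite /sec0 /sec1 /sec2 /sec3; push_rmorph.
by rewrite e !coefD coefC !coefCM coefX !coefXn /= !mulr0 !add0r.
Qed.

Lemma coef_sec0 : (sec0 'X : {poly K})`_8 = 1.
Proof.
have e : sec0 'X = 'X^8 + (((- 72)%:P * 'X^6) + ((4 * 1000 + 480)%:P * 'X^5) + ((60 * 1000 +
  744)%:P * 'X^4)
  + ((244 * 1000 + 320)%:P * 'X^3) + ((197 * 1000 + 272)%:P * 'X^2) + ((24 * 1000 + 720)%:P *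
    'X) - 24%:P) :> {poly K}.
  by rewrite /sec0; ring.
by rewrite e !(coefD, coefN, coefC, coefCM, coefX, coefXn) /= !mulr0 !addr0 subr0 addr0.
Qed.

Lemma coef_edge : (edge 'X : {poly K})`_4 = 1.
Proof.
have e : edge 'X = 'X^4 + (48%:P * 'X^3 + (20 * 1000 + 24)%:P * 'X^2 - (35 * 1000 + 648)%:P * 'X
  - 24%:P) :> {poly K}.
  by rewrite /edge; ring.
by rewrite e !(coefD, coefN, coefC, coefCM, coefX, coefXn) /= !mulr0 !addr0 !subr0 addr0.
Qed.

Lemma horner_sec_poly x v : sec_poly.[v%:P].[x] = sec x v.
Proof.
transitivity ((sec 'X v%:P).[x]).
  by congr horner; apply: (etrans (rmorph_sec (horner_eval v%:P) _ _)); rewrite /= !horner_evalE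
    hornerC hornerX.
by apply: (etrans (rmorph_sec (horner_eval x) _ _)); rewrite /= !horner_evalE hornerC hornerX.
Qed.

End section_factors.

Section sec_poly_factors.
Variable K : numFieldType.
Implicit Types a b : {poly {poly K}}.

Lemma coef_coef_eq0 a j : (forall i, a`_j`_i = 0) -> a`_j = 0.
Proof. by move=> h; apply/polyP => i; rewrite coef0. Qed.

Definition weight_le n a := forall j i, (2 * n < 2 * j + i)%N -> a`_j`_i = 0.

Lemma horner_weight_le n a x v : weight_le n a ->
  a.[v%:P].[x] = \sum_(j < n.+1) \sum_(i < (2 * (n - j)).+1) a`_j`_i * x ^+ i * v ^+ j.
Proof.
move=> h; rewrite (@horner_coef_wide _ n.+1 a); last first.
  by apply/leq_sizeP => j hj; apply: coef_coef_eq0 => i; apply: h; lia.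
rewrite horner_sum; apply: eq_bigr => j _; rewrite -rmorphXn hornerM hornerC -mulr_suml.
congr (_ * _); apply: horner_coef_wide; apply/leq_sizeP => i hi; apply: h.
have := ltn_ord j; lia.
Qed.

Lemma sec_poly_no_linear_factor a b : weight_le 1 a -> a`_1`_0 != 0 -> a * b <> sec_poly K.
Proof.
move=> w c0 e; set c := a`_1`_0 in c0.
apply: (@sec_root_free K (- a`_0`_2 / c) (- a`_0`_1 / c) (- a`_0`_0 / c)) => x.
set v := (X in sec x X); rewrite -horner_sec_poly -e !hornerM (horner_weight_le _ _ w).
rewrite !big_ord_recl !big_ord0 /= /bump /= !add1n !expr0 !expr1 -/c.
rewrite -[RHS](mul0r b.[v%:P].[x]); congr (_ * _).
by rewrite /v; field.
Qed.

Lemma sec_poly_no_quadratic_factors a b : weight_le 2 a -> weight_le 2 b ->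
  a`_2`_0 * b`_2`_0 = 1 -> a * b <> sec_poly K.
Proof.
move=> wa wb c1 e; set c := a`_2`_0 in c1; set d := b`_2`_0 in c1.
(* As c d = 1, the factors d a and c b have the same product and are monic in v. *)
apply: (@sec_no_quadratic_factors K (d * a`_1`_2) (d * a`_1`_1) (d * a`_1`_0)
  (d * a`_0`_4) (d * a`_0`_3) (d * a`_0`_2) (d * a`_0`_1) (d * a`_0`_0)
  (c * b`_1`_2) (c * b`_1`_1) (c * b`_1`_0)
  (c * b`_0`_4) (c * b`_0`_3) (c * b`_0`_2) (c * b`_0`_1) (c * b`_0`_0)) => x v.
rewrite -horner_sec_poly -e !hornerM (horner_weight_le _ _ wa) (horner_weight_le _ _ wb).
rewrite !big_ord_recl !big_ord0 /= /bump /= !add1n !expr0 !expr1 -/c -/d.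
set A := (X in _ = X * _); set B := (X in _ = _ * X).
transitivity ((d * A) * (c * B)); last by rewrite mulrACA [d * c]mulrC c1 mul1r.
have e2 : v ^+ 2 = c * d * v ^+ 2 by rewrite c1 mul1r.
by congr (_ * _); rewrite [X in X + _ + _ = _]e2 /A /B; ring.
Qed.

Lemma swapXY_comp_monomials k l a : (0 < k)%N -> (0 < l)%N ->
  swapXY (comp_monomials k l a) = comp_monomials l k (swapXY a).
Proof.
move=> k0 l0; apply/polyP => j; apply/polyP => i.
by rewrite coef_swapXY !coef_comp_monomials // coef_swapXY andbC.
Qed.

Lemma coef0_comp_monomials k l a : (0 < l)%N -> (comp_monomials k l a)`_0 = a`_0 \Po 'X^k.
Proof. by move=> l0; rewrite coef_comp_poly_Xn // dvdn0 div0n coef_map. Qed.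

Lemma size_coef0M d e (P Q : {poly {poly K}}) : total_degree_le d P -> total_degree_le e Q ->
  (P * Q)`_0`_(d + e) != 0 -> size (P * Q)`_0 = (d + e)%N.+1.
Proof.
move=> hP hQ n0; apply/eqP; rewrite eqn_leq; apply/andP; split; last first.
  by rewrite ltnNge; apply: contra n0 => /leq_sizeP/(_ _ (leqnn _))->.
rewrite coef0M (leq_trans (size_polyMleq _ _)) //.
have := total_degree_le_size 0 hP; have := total_degree_le_size 0 hQ; rewrite !subn0.
by move=> h1 h2; have := leq_add h2 h1; rewrite addSn addnS; case: (_ + _)%N.
Qed.

Lemma horner0_sec0_neq0 : (sec0 'X : {poly K}).[0] != 0.
Proof.
have -> : (sec0 'X : {poly K}).[0] = - 24.
  apply: (etrans (rmorph_sec0 (horner_eval 0) _)).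
  by rewrite /= horner_evalE hornerX /sec0 !expr0n /=; ring.
by rewrite oppr_eq0 pnatr_eq0.
Qed.

Lemma horner0_edge_neq0 : (edge 'X : {poly K}).[0] != 0.
Proof.
have -> : (edge 'X : {poly K}).[0] = - 24.
  apply: (etrans (rmorph_edge (horner_eval 0) _)).
  by rewrite /= horner_evalE hornerX /edge !expr0n /=; ring.
by rewrite oppr_eq0 pnatr_eq0.
Qed.

(** The constant terms in either variable have full degree 8 k = d + e, as [sparse_factors]
    requires; [swapXY] exchanges the variables. *)
Lemma pullback_factor_degree k d e (P Q : {poly {poly K}}) : (0 < k)%N ->
  total_degree_le d P -> total_degree_le e Q -> (d + e = 8 * k)%N ->
  P * Q = comp_monomials k (2 * k) (sec_poly K) -> d = 0%N \/ e = 0%N.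
Proof.
move=> k0 hP hQ de PQ; have l0 : (0 < 2 * k)%N by rewrite muln_gt0.
have sparse := sparse_factors hP hQ.
have sparse' := sparse_factors (total_degree_le_swapXY hP) (total_degree_le_swapXY hQ).
have szPQ := size_coef0M hP hQ.
have szPQ' := size_coef0M (total_degree_le_swapXY hP) (total_degree_le_swapXY hQ).
have S : swapXY P * swapXY Q = comp_monomials (2 * k) k (swapXY (sec_poly K)).
  by rewrite -rmorphM /= PQ swapXY_comp_monomials.
have {sparse szPQ} h j : ~~ (2 * k %| j)%N -> P`_j = 0 /\ Q`_j = 0.
  apply: sparse.
  - apply: szPQ; rewrite PQ de coef0_comp_monomials // coef0_sec_poly coef_comp_poly_Xn //.
    by rewrite dvdn_mull // mulnK // coef_sec0 oner_eq0.
  - rewrite PQ coef0_comp_monomials // coef0_sec_poly; apply: separable_comp_Xn => //.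
      exact: separable_sec0.
    exact: horner0_sec0_neq0.
  - move=> m /negPf nj; rewrite PQ; apply/polyP => i.
    by rewrite coef_comp_monomials // nj coef0.
have {sparse' szPQ'} h' j : ~~ (k %| j)%N -> (swapXY P)`_j = 0 /\ (swapXY Q)`_j = 0.
  apply: sparse'.
  - apply: szPQ'; rewrite S de coef0_comp_monomials // coef0_swapXY_sec_poly coef_comp_poly_Xn //.
    have -> : (8 * k = 4 * (2 * k))%N by lia.
    by rewrite dvdn_mull // mulnK // coef_edge oner_eq0.
  - rewrite S coef0_comp_monomials // coef0_swapXY_sec_poly; apply: separable_comp_Xn => //.
      exact: separable_edge.
    exact: horner0_edge_neq0.
  - move=> m /negPf nj; rewrite S; apply/polyP => i.
    by rewrite coef_comp_monomials // nj coef0.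
have [a Pa] : exists a, P = comp_monomials k (2 * k) a.
  by apply: comp_monomialsP => // j nj; [case: (h j nj)|case: (h' j nj)].
have [b Qb] : exists b, Q = comp_monomials k (2 * k) b.
  by apply: comp_monomialsP => // j nj; [case: (h j nj)|case: (h' j nj)].
have {PQ S}ab : a * b = sec_poly K.
  by apply: (comp_monomials_inj k0 l0); rewrite comp_monomialsM -Pa -Qb.
have wa : forall j i, (d < 2 * k * j + k * i)%N -> a`_j`_i = 0.
  move=> j i /hP; rewrite Pa coef_comp_monomials // [(2 * k * j)%N]mulnC [(k * i)%N]mulnC.
  by rewrite dvdn_mull // dvdn_mull // !mulnK.
have wb : forall j i, (e < 2 * k * j + k * i)%N -> b`_j`_i = 0.
  move=> j i /hQ; rewrite Qb coef_comp_monomials // [(2 * k * j)%N]mulnC [(k * i)%N]mulnC.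
  by rewrite dvdn_mull // dvdn_mull // !mulnK.
have := coef4_sec_poly K; rewrite -ab coefM => {h h'} sum1.
(* A nonzero summand of the coefficient 1 of v^4 gives 2 k n <= d and 2 k (4 - n) <= e, both
   equalities as d + e = 8 k. The other summands then vanish, so this one is 1. *)
have [n nn0] : exists n : 'I_5, a`_n * b`_(4 - n) != 0.
  apply/existsP; apply: contra_eqT sum1 => /existsPn z.
  rewrite big1 1?eq_sym ?oner_eq0 // => i _; by apply/eqP; have := z i; rewrite negbK.
have n4 : (n < 5)%N := ltn_ord n.
have dn : d = (2 * k * n)%N.
  have : (2 * k * n <= d)%N.
    rewrite leqNgt; apply: contra nn0 => lt; suff -> : a`_n = 0 by rewrite mul0r.
    by apply: coef_coef_eq0 => i; apply: wa; lia.
  have : (2 * k * (4 - n) <= e)%N.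
    rewrite leqNgt; apply: contra nn0 => lt; suff -> : b`_(4 - n) = 0 by rewrite mulr0.
    by apply: coef_coef_eq0 => i; apply: wb; lia.
  move: (n : nat) n4 => m; nia.
have en : e = (2 * k * (4 - n))%N by nia.
move: sum1; rewrite (bigD1 n) //= big1 ?addr0; last first.
  move=> i ni; have i4 := ltn_ord i; have {}ni : (i <> n :> nat) by move/val_inj/eqP; apply/negP.
  case: (ltnP n i) => lt; last first.
    suff -> : b`_(4 - i) = 0 by rewrite mulr0.
    by apply: coef_coef_eq0 => j; apply: wb; nia.
  suff -> : a`_i = 0 by rewrite mul0r.
  by apply: coef_coef_eq0 => j; apply: wa; nia.
move/(congr1 (fun p : {poly K} => p`_0)); rewrite coef0M coef1 /= => {nn0} c1.
have {}wa : weight_le n a by move=> j i lt; apply: wa; nia.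
have {}wb : weight_le (4 - n) b by move=> j i lt; apply: wb; nia.
have c0 : a`_n`_0 != 0 /\ b`_(4 - n)`_0 != 0.
  by split; apply: contra_eq_neq c1 => ->; rewrite ?mul0r ?mulr0 eq_sym oner_eq0.
case: n n4 dn en wa wb c1 c0 => -[|[|[|[|[|//]]]]] /= _ _ dn en wa wb c1 [c0 c0'].
- by left; rewrite dn muln0.
- by case: (sec_poly_no_linear_factor wa c0 ab).
- by case: (sec_poly_no_quadratic_factors wa wb c1 ab).
- by rewrite mulrC in ab; case: (sec_poly_no_linear_factor wb c0' ab).
- by right; rewrite en muln0.
Qed.
End sec_poly_factors.

Lemma mpoly_msize_le1_unit n (K : fieldType) (A : mpoly n K) :
  A != 0 -> (msize A <= 1)%N -> A \is a GRing.unit.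
Proof.
move=> A0 /msize1_polyC e; rewrite e rmorph_unit // unitfE.
by apply: contraNneq A0 => z; rewrite e z mpolyC0.
Qed.

Lemma msize_unit n (K : fieldType) (A : mpoly n K) : A \is a GRing.unit -> (msize A <= 1)%N.
Proof. by case/andP => /eqP-> _; rewrite msizeC; case: eqP. Qed.

Section bivariate_restriction.
Variable K : fieldType.

(** The outer variable is y = x_0, the inner one x = x_1. *)
Definition coord_restriction (j : 'I_4) : {poly {poly K}} := nth 0 [:: 'X; 'X%:P; 1; 1] j.
Definition restriction : mpoly 4 K -> {poly {poly K}} := mmap (polyC \o polyC) coord_restriction.

HB.instance Definition _ := GRing.RMorphism.on restriction.

Lemma restrictionX j : restriction (mpolyX K (mnm1 j)) = coord_restriction j.
Proof. by rewrite /restriction mmapX mmap1U. Qed.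

Lemma total_degree_le_restriction (A : mpoly 4 K) :
  total_degree_le (msize A).-1 (restriction A).
Proof.
move=> j i lt; rewrite /restriction /mmap !coef_sum big1_seq // => m /= /msize_mdeg_lt ltm.
rewrite /mmap1 !big_ord_recl big_ord0 /= !expr1n !mulr1 -rmorphXn coefCM coefCM coefMC coefXn.
case: eqP => [je|_]; last by rewrite mul0r coef0 mulr0.
rewrite mul1r coefXn; case: eqP => [ie|_]; last by rewrite mulr0.
by move: ltm; rewrite mdegE !big_ord_recl big_ord0; lia.
Qed.

End bivariate_restriction.

Lemma dhomog_octic_pullback (K : comNzRingType) k :
  octic_pullback K k \is @ishomog1 4 K (8 * k)%N mdeg.
Proof.
rewrite /octic_pullback /octic big_seq rpred_sum // => m mt.
have d8 : (\sum_(j < 4) nth 0%N m.2 j = 8)%N.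
  by apply/eqP; move: m mt; apply/allP; rewrite -[all _ _]/(all (fun m : BinInt.Z * seq nat =>
    \sum_(j < 4) nth 0 m.2 j == 8)%N octic_terms); under eq_all do rewrite !big_ord_recl big_ord0.
have h j e : ((mpolyX K (mnm1 j)) ^+ k) ^+ e \is @ishomog1 4 K (1 * k * e)%N mdeg.
  by apply/dhomogMn/dhomogMn; rewrite dhomogX; apply/eqP/mdeg1.
rewrite /Zr mulrzl rpredMz // -d8 big_distrl /=.
apply: (big_ind2 (fun p d => p \is @ishomog1 4 K d mdeg)).
- exact: dhomog1.
- by move=> p d q e; exact: dhomogM.
- by move=> j _; rewrite mulnC -[k in (k * _)%N]mul1n.
Qed.

Section irreducible.
Variable K : numFieldType.

Lemma restriction_octic_pullback k : (0 < k)%N ->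
  restriction (octic_pullback K k) = comp_monomials k (2 * k) (sec_poly K).
Proof.
move=> k0; transitivity (octic (fun j : 'I_4 => coord_restriction K j ^+ k)).
  apply: etrans (rmorph_octic (@restriction K : {rmorphism mpoly 4 K -> {poly {poly K}}}) _) _.
  congr octic; apply/funext => j; rewrite -restrictionX; exact: rmorphXn.
transitivity (octic (fun j : 'I_4 => nth 0 [:: 'X^k; ('X^k)%:P; 1; 1 : {poly {poly K}}] j)).
  congr octic; apply/funext => j; rewrite /coord_restriction.
  by case: j => [[|[|[|[|//]]]]] //= _; rewrite ?expr1n ?rmorphXn.
rewrite octic_section.
rewrite /comp_monomials /sec_poly.
rewrite (rmorph_sec (map_poly (comp_poly 'X^k) : {rmorphism {poly {poly K}} -> {poly {poly
  K}}})) /=.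
rewrite (rmorph_sec (comp_poly 'X^(2 * k) : {rmorphism {poly {poly K}} -> {poly {poly K}}})) /=.
rewrite map_polyC map_polyX /= comp_polyC !comp_polyX.
by rewrite mulnC exprM.
Qed.

(** The bounds given to [pullback_factor_degree] are the degrees of [A] and [B] themselves, so the
    one that is 0 makes its factor a nonzero constant. *)
Lemma octic_pullback_irreducible k : (0 < k)%N -> mpoly_irreducible (octic_pullback K k).
Proof.
move=> k0; set F := octic_pullback K k.
have F0 : F != 0.
  apply/eqP => z; have /eqP := coef4_sec_poly K; apply/negP.
  suff -> : sec_poly K = 0 by rewrite coef0 eq_sym oner_eq0.
  apply: (@comp_monomials_inj _ k (2 * k)); rewrite ?muln_gt0 ?k0 //.
  rewrite -restriction_octic_pullback // -/F z rmorph0.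
  by rewrite /comp_monomials !rmorph0.
have sF : (msize F).-1 = (8 * k)%N.
  have h := dhomog_octic_pullback K k.
  by rewrite (dhomog_uniq F0 h (dhomog_msize h)).
split=> //.
  apply/negP => /msize_unit h; suff : (8 * k <= 0)%N by rewrite leqn0 muln_eq0 /= eqn0Ngt k0.
  by rewrite -sF -subn1 leq_subLR.
move=> A B FAB.
have A0 : A != 0 by apply: contraNneq F0 => z; rewrite FAB z mul0r.
have B0 : B != 0 by apply: contraNneq F0 => z; rewrite FAB z mulr0.
have := @pullback_factor_degree K k (msize A).-1 (msize B).-1 (restriction A) (restriction B) k0
  (@total_degree_le_restriction K A) (@total_degree_le_restriction K B).
rewrite -rmorphM /= -FAB restriction_octic_pullback // => /(_ _ erefl) [|e|e].
- have pos (C : mpoly 4 K) : C != 0 -> (0 < msize C)%N by rewrite lt0n msize_poly_eq0.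
  rewrite -sF FAB msizeM //; move: (pos A A0) (pos B B0); case: (msize A) => // a _.
  by case: (msize B) => // b _; rewrite addSn addnS.
- by left; apply: mpoly_msize_le1_unit => //; move: e; case: (msize A) => // a /= ->.
- by right; apply: mpoly_msize_le1_unit => //; move: e; case: (msize B) => // a /= ->.
Qed.
End irreducible.

(** * Lower bounds *)

Definition generic_points : seq point_data :=
  [seq d <- octic_points | all (fun j => ~~ z12_is0 (nth z12_0 d.1.2 j)) (iota 0 4)].

Lemma octic_points_ok : all point_ok octic_points.
Proof. by vm_compute. Qed.

Lemma octic_points_pivots : all (fun d => d.1.1 < 4)%N octic_points.
Proof. by vm_compute. Qed.

Lemma octic_points_distinct : pairwise distinct_points octic_points.
Proof. by vm_compute. Qed.

(** Besides the 44 points with nonzero coordinates, 24 have one zero coordinate and 12 have two: 44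
    * 27 + 24 * 9 + 12 * 3 = 1440. *)
Lemma octic_points_fiber3 : sumn [seq fiber_size 3 d | d <- octic_points] = 1440%N.
Proof.
under eq_map do rewrite /fiber_size unlock.
by vm_compute.
Qed.

Lemma size_generic_points : size generic_points = 44%N.
Proof. by vm_compute. Qed.

Lemma generic_points_nonzero d : d \in generic_points ->
  all (fun j => ~~ z12_is0 (nth z12_0 d.1.2 j)) (iota 0 4).
Proof. by rewrite mem_filter => /andP[]. Qed.

Lemma generic_points_fiber k : sumn [seq fiber_size k d | d <- generic_points] = (44 * k ^ 3)%N.
Proof.
rewrite -size_generic_points; have : {subset generic_points <= generic_points} by [].
elim: {1 3 4}generic_points => [|d l IH] sub //=; rewrite mulSn.
rewrite IH; last by move=> e el; apply: sub; rewrite in_cons el orbT.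
congr (_ + _)%N; have /allP zd := @generic_points_nonzero d (sub d (mem_head _ _)).
rewrite /fiber_size !big_cons big_nil; have z m : (m < 3)%N ->
    z12_is0 (nth z12_0 d.1.2 (bump d.1.1 m)) = false.
  move=> m3; apply: negbTE; apply: zd; rewrite mem_iota add0n /= ltnS.
  by apply: leq_trans m3; rewrite /bump -add1n leq_add2r leq_b1.
by rewrite !z // muln1.
Qed.

Lemma mu_D4_ge (R : realType) k : (0 < k)%N ->
  (counting (D4_points (octic_pullback R[i] k)) <= mu_D4 R (8 * k))%E.
Proof.
move=> k0; apply: ereal_sup_ubound; exists (octic_pullback R[i] k) => //.
by split; [exact: dhomog_octic_pullback|exact: octic_pullback_irreducible].
Qed.

Lemma mu_D4_ge_generic (R : realType) k : (0 < k)%N ->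
  ((44 * k ^ 3)%N%:R%:E <= mu_D4 R (8 * k))%E.
Proof.
move=> k0; apply: le_trans (mu_D4_ge R k0).
rewrite -generic_points_fiber; refine (@counting_D4_points R generic_points k k0 _ _ _ _).
- by apply/allP => d; rewrite mem_filter => /andP[_]; exact: (allP octic_points_ok).
- by apply/allP => d; rewrite mem_filter => /andP[_]; exact: (allP octic_points_pivots).
- exact: pairwise_filter _ octic_points_distinct.
- move=> d j /generic_points_nonzero/allP/(_ j); rewrite mem_iota ltn_ord.
  by move=> /(_ isT)/negPf->.
Qed.

Lemma mu_D4_ge_24 (R : realType) : (1440%:R%:E <= mu_D4 R 24)%E.
Proof.
apply: le_trans (mu_D4_ge R (isT : (0 < 3)%N)); rewrite -octic_points_fiber3.
exact: (@counting_D4_points R octic_points 3 isT octic_points_ok octic_points_pivots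
  octic_points_distinct).
Qed.

Local Open Scope ring_scope.
Local Open Scope ereal_scope.

Theorem mainTheorem1 (R : realType) :
  [/\ 44%:R%:E <= mu_D4 R 8,
      352%:R%:E <= mu_D4 R 16,
      1440%:R%:E <= mu_D4 R 24 &
      forall k : nat, (1 <= k)%N -> (44 * k ^ 3)%N%:R%:E <= mu_D4 R (8 * k)].
Proof.
split; [exact: (mu_D4_ge_generic R (k := 1))|exact: (mu_D4_ge_generic R (k := 2))| |].
- exact: mu_D4_ge_24.
- by move=> k; exact: mu_D4_ge_generic.
Qed.
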